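(* Let $n\geq 2$, let $A=A(x)$ be a smooth matrix-valued function on $\mathbb{R}^n$ such that the $n\times n$ matrix $A(x)$ is invertible for every $x\in\mathbb{R}^n$, let $f\in(\mathcal{E}'(\mathbb{R}^n))^n$ be a compactly supported covector-valued distribution, and let $V\subset\mathbb{R}^n$ be a nonempty open set. If $\mathrm{d}(Af)|_V=0$ and $N_Af|_V=0$, then $f=A^{-1}(\mathrm{d}\psi)$ for some $\psi\in\mathcal{E}'(\mathbb{R}^n)$.
   Context: $\mathcal{E}'(\mathbb{R}^n)$ is the space of compactly supported distributions and $\mathcal{D}'(\mathbb{R}^n)$ the space of all distributions on $\mathbb{R}^n$. $f\in(\mathcal{E}'(\mathbb{R}^n))^n$ means $f=(f_1,\dots,f_n)$ with each $f_i\in\mathcal{E}'(\mathbb{R}^n)$, with pairing $\langle f,\varphi\rangle=\sum_i\langle f_i,\varphi_i\rangle$. One-forms are identified with vector fields. The exterior derivative of a covector-valued distribution $g$ is given, in the sense of distributions, by $(\mathrm{d}g)_{ij}=\partial_i g_j-\partial_j g_i$. For a scalar distribution $\psi$, $\mathrm{d}\psi=(\partial_1\psi,\dots,\partial_n\psi)$. Restrictions to $V$ are restrictions of distributions to the open set $V$. For a smooth matrix field $A$ and a covector-valued distribution $f$, $Af$ is defined by $\langle Af,\varphi\rangle=\langle f,A^T\varphi\rangle$, where $(A^T\varphi)(x)=A(x)^T\varphi(x)$ (so $(Af)_i=\sum_jA_{ij}f_j$). $A^{-1}$ denotes the pointwise inverse matrix field, acting in the same way. The X-ray transform of one-forms is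 $X_1f(z,\theta)=\int_{\mathbb{R}}f(z+t\theta)\cdot\theta\,dt$ for $\theta\in S^{n-1}$, $z\in\theta^\perp$, with adjoint $(X_1^*\psi)_i(x)=\int_{S^{n-1}}\theta_i\,\psi(x-(x\cdot\theta)\theta,\theta)\,d\theta$. Its normal operator $N_1=X_1^*X_1$ extends to $N_1:(\mathcal{E}'(\mathbb{R}^n))^n\to(\mathcal{D}'(\mathbb{R}^n))^n$ and is given by $$(N_1f)_i=\sum_{j=1}^n\frac{2x_ix_j}{|x|^{n+1}}\ast f_j .$$ The generalized X-ray transform is $X_A=X_1\circ A$, and its normal operator is $N_A=X_A^*X_A=A^T\circ N_1\circ A:(\mathcal{E}'(\mathbb{R}^n))^n\to(\mathcal{D}'(\mathbb{R}^n))^n$. *)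

(* Defs.v *)
From HB Require Import structures.
From mathcomp Require Import all_boot all_order all_algebra.
From mathcomp Require Import all_classical all_reals all_analysis.

Set Implicit Arguments.
Unset Strict Implicit.
Unset Printing Implicit Defensive.

Import Order.TTheory GRing.Theory Num.Theory.
Import numFieldNormedType.Exports.

Local Open Scope classical_set_scope.
Local Open Scope ring_scope.

(* The n-fold power of a sigma-finite measure, as a measure on n-tuples equipped
   with the product sigma-algebra. *)
Section CartesianPower.
Context d (T : measurableType d) (R : realType).
Variable m : {sigma_finite_measure set T -> \bar R}.

Section Step.
Variables (n : nat) (mu : {sigma_finite_measure set (n.-tuple T) -> \bar R}).

Definition tuple_consp (p : T * n.-tuple T) : n.+1.-tuple T :=
  [tuple of p.1 :: p.2].

Lemma measurable_tuple_consp :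
  measurable_fun [set: T * n.-tuple T] tuple_consp.
Proof. exact: measurable_cons. Qed.

Definition power_step : set (n.+1.-tuple T) -> \bar R :=
  pushforward (m \x mu)%E tuple_consp.

Let power_step_measure : {measure set (n.+1.-tuple T) -> \bar R} :=
  measure_function_pushforward__canonical__measure_function_Measure
    (m \x mu)%E measurable_tuple_consp.

HB.instance Definition _ := isMeasure.Build _ _ _ power_step
  (measure0 power_step_measure) (measure_ge0 power_step_measure)
  (@measure_semi_sigma_additive _ _ _ power_step_measure).

Lemma power_step_sigma_finite : sigma_finite setT power_step.
Proof.
have /sigma_finiteP[F [TF ndF Foo]] := sigma_finiteT m.
have /sigma_finiteP[G [TG ndG Goo]] := sigma_finiteT mu.
pose uncons (t : n.+1.-tuple T) := (thead t, [tuple of behead t]).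
have munc : measurable_fun [set: n.+1.-tuple T] uncons.
  apply/measurable_fun_pairP; split; first exact: measurable_tnth.
  exact: measurable_behead.
have consK p : uncons (tuple_consp p) = p.
  by case: p => x t; rewrite /uncons/tuple_consp theadE; congr pair; apply/val_inj.
exists (fun i => uncons @^-1` (F i `*` G i)).
  rewrite -preimage_bigcup (_ : \bigcup_i _ = setT) ?preimage_setT//.
  rewrite -setXTT TF TG predeqE => -[x y]; split.
    by move=> [i _ []/= ? ?]; split; exists i.
  move=> [/= [i _ Fix] [k _ Gky]]; exists (maxn i k) => //; split.
  - by move: x Fix; exact/subsetPset/ndF/leq_maxl.
  - by move: y Gky; exact/subsetPset/ndG/leq_maxr.
move=> i; have [? ?] := Foo i; have [? ?] := Goo i; split.
  by rewrite -[X in measurable X]setTI; apply: munc => //; exact: measurableX.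
rewrite /power_step /pushforward -comp_preimage.
rewrite (_ : uncons \o tuple_consp = id) ?preimage_id; last exact/funext.
by rewrite product_measure1E// lte_mul_pinfty// ge0_fin_numE.
Qed.

HB.instance Definition _ :=
  @Measure_isSigmaFinite.Build _ _ _ power_step power_step_sigma_finite.

End Step.

Fixpoint power_measure n : {sigma_finite_measure set (n.-tuple T) -> \bar R} :=
  if n is n'.+1 then power_step (power_measure n')
  else dirac [tuple].

End CartesianPower.

Section Distributions.
Context {R : realType} {n : nat}.
Local Notation E := 'rV[R]_n.
Implicit Types (phi : E -> R) (V K : set E).

(* The library has no sigma-algebra on row vectors, hence the detour by tuples. *)
Definition integral_rV (g : E -> R) : R :=
  \int[power_measure (@lebesgue_measure R) n]_t g (\row_i tnth t i).

Definition partial (i : 'I_n) phi : E -> R :=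
  fun x => 'D_(delta_mx 0 i : E) phi x.

(* [:: i1; ...; ik] stands for the operator partial_i1 ... partial_ik. *)
Definition partials (s : seq 'I_n) phi : E -> R := foldr partial phi s.

Definition smooth phi : Prop := forall s : seq 'I_n,
  continuous (partials s phi) /\
  forall (i : 'I_n) (x : E), derivable (partials s phi) x (delta_mx 0 i).

Definition support phi : set E := closure [set x | phi x != 0].

Definition test_function phi : Prop := smooth phi /\ compact (support phi).

(* The seminorms max_(|s| <= N) sup_K |partial^s phi| (K compact) generating the
   Frechet topology of C^oo(R^n); for K empty the value is 0. *)
Definition seminorm K (N : nat) phi : R :=
  sup [set r | exists s x, [/\ (size s <= N)%N, K x & r = `|partials s phi x|]].

(* Distributions are represented by functionals that are total on all functions
   E -> R. Only the values on test functions matter for an element of D'(R^n),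
   and only those on smooth functions for an element of E'(R^n). *)
Definition functional := (E -> R) -> R.
Implicit Types (u v k psi : functional) (f g : 'I_n -> functional).

Definition linear_on_smooth u : Prop :=
  forall (a : R) phi chi, smooth phi -> smooth chi ->
    u (fun x => a * phi x + chi x) = a * u phi + u chi.

(* E'(R^n) is the space of continuous linear functionals on C^oo(R^n), the
   compactly supported distributions acting on all smooth functions. *)
Definition compact_distribution u : Prop :=
  linear_on_smooth u /\
  exists K (N : nat) (C : R), compact K /\
    forall phi, smooth phi -> `|u phi| <= C * seminorm K N phi.

Definition eq_compact_distribution u v : Prop :=
  forall phi, smooth phi -> u phi = v phi.

(* u|_V = 0 as a distribution on the open set V *)
Definition vanishes_on V u : Prop :=
  forall phi, test_function phi -> support phi `<=` V -> u phi = 0.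

Definition dpartial (i : 'I_n) u : functional := fun phi => - u (partial i phi).

Definition dgrad psi : 'I_n -> functional := fun i => dpartial i psi.

Definition dext g (i j : 'I_n) : functional :=
  fun phi => dpartial i (g j) phi - dpartial j (g i) phi.

Definition smooth_mx (A : E -> 'M[R]_n) : Prop :=
  forall i j, smooth (fun x => A x i j).

(* (A f)_i = \sum_j A_ij f_j, a smooth function a acting on a distribution u by
   <a u, phi> = <u, a phi>. *)
Definition mx_act (A : E -> 'M[R]_n) f : 'I_n -> functional :=
  fun i phi => \sum_(j < n) f j (fun x => A x i j * phi x).

Definition regular_distribution (h : E -> R) : functional :=
  fun phi => integral_rV (fun x => h x * phi x).

(* <k * u, phi> = <u(y), <k(x), phi(x + y)>> for k in D'(R^n) and u in E'(R^n) *)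
Definition convolution k u : functional :=
  fun phi => u (fun y => k (fun x => phi (x + y))).

(* The norm of the library on 'rV[R]_n is the sup norm. *)
Definition euclidean_norm (x : E) : R := Num.sqrt (\sum_(i < n) x 0 i ^+ 2).

Definition xray_kernel (i j : 'I_n) (x : E) : R :=
  2 * x 0 i * x 0 j / euclidean_norm x ^+ n.+1.

Definition N1 f : 'I_n -> functional :=
  fun i phi => \sum_(j < n)
    convolution (regular_distribution (xray_kernel i j)) (f j) phi.

Definition NA (A : E -> 'M[R]_n) f : 'I_n -> functional :=
  mx_act (fun x => (A x)^T) (N1 (mx_act A f)).

End Distributions.

(* Main.v *)
Require Import Defs.
From mathcomp Require Import all_boot all_order all_algebra.
From mathcomp Require Import all_classical all_reals all_analysis.
From mathcomp Require Import measurable_realfun.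
From mathcomp Require Import ring lra.

Set Implicit Arguments.
Unset Strict Implicit.
Unset Printing Implicit Defensive.

Import Order.TTheory GRing.Theory Num.Theory.
Import numFieldNormedType.Exports.

Local Open Scope classical_set_scope.
Local Open Scope ring_scope.

(** Put g := A f. Since A is invertible, testing N_A f against the columns of
    the inverse of A turns the hypothesis into N_1 g = 0 on V ([N1_of_NA]), and
    dg = 0 on V is given. The claim is that g = d psi with psi compactly
    supported; f is then recovered by applying the inverse of A ([mx_actK]).

    The first half is that dg vanishes everywhere. Put s(x) = |x|^(1-n). The
    matrix kernel k_jl = 2 x_j x_l / |x|^(n+1) of N_1 satisfies
      (n-1) (d_i k_jl - d_j k_il) = 2 (delta_jl d_i s - delta_il d_j s)
    as distributions ([kernel_identity]), so that d(N_1 g) is a nonzero multiple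
    of s * dg. Hence each component u of dg vanishes on V together with s * u
    ([dext_conv_scalar_kernel]), and it remains to prove unique continuation for
    the Riesz potential s ([riesz_unique_continuation]). This is done by moments
    rather than by Fourier or Kelvin transforms. Translate a point of V to the
    origin. The functional u is blind to what happens near 0, so s may be
    replaced there by a smooth function p^(n-1), with p(y) = 1/|y| away from 0.
    Let Z be the space of smooth F such that u kills all mollifications of F at
    small scale; it contains p^(n-1), is stable under derivatives and under
    changes near 0, and u kills its elements. Applying the Laplacian, which maps
    |y|^(-a) to a (a+2-n) |y|^(-a-2) with a nonzero factor when a >= n-1, puts
    all |y|^(1-n-2j) in Z; further derivatives put y^al |y|^(1-n-2j) in Z for
    every multi-index al of length at most j. The condition on j is then removed:
    on a ball containing the support of u the constant 1 is the limit of
    polynomials in p^2 without constant term. So the compactly supported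
    distribution p^(n-1) u kills all polynomials; these are dense by Landau's
    kernels ([polynomial_density]), whence u = 0.

    The second half is the Poincare lemma with compact supports
    ([poincare_compact]). If J integrates functions in the coordinate x_i0 from
    0, put psi(phi) := - g_i0 (J phi). Closedness gives g = d psi up to the
    values of g_i0 on functions that do not depend on x_i0; such a function is a
    derivative in another coordinate x_i1 of a function of the same kind, and
    closedness shows that g_i0 kills it. This is where n >= 2 is used again. *)

(** * Smooth functions *)

Section SmoothFunctions.
Context {R : realType} {n : nat}.
Local Notation E := 'rV[R]_n.
Implicit Types (phi chi : E -> R) (i : 'I_n) (x y : E).

Lemma partials_rcons (s : seq 'I_n) i phi :
  partials (rcons s i) phi = partials s (partial i phi).
Proof. by rewrite /partials foldr_rcons. Qed.

(** Smoothness graded by the order of differentiability, so that stability under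
    products, inverses and substitutions is an induction on that order. *)
Fixpoint CN (N : nat) phi : Prop :=
  continuous phi /\
  if N is N'.+1 then
    forall i, (forall x, derivable phi x (delta_mx 0 i)) /\ CN N' (partial i phi)
  else True.

(** The constructor keeps the predicate from unfolding during unification. *)
Variant Coo phi : Prop := CooI of forall N, CN N phi.

Lemma CN_continuous N phi : CN N phi -> continuous phi.
Proof. by case: N => [|N] []. Qed.

Lemma CNS N phi : CN N.+1 phi -> CN N phi.
Proof.
elim: N phi => [|N IH] phi; first by case.
by case=> cp dp; split => // i; have [d1 d2] := dp i; split => //; exact: IH.
Qed.

(** Smoothness of every member of a family of functions that is closed under
    partial derivatives. *)
Lemma Coo_coind (P : (E -> R) -> Prop) :
  (forall phi, P phi -> continuous phi) ->
  (forall phi i x, P phi -> derivable phi x (delta_mx 0 i)) ->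
  (forall phi i, P phi -> P (partial i phi)) ->
  forall phi, P phi -> Coo phi.
Proof.
move=> Pc Pd Pp phi Pphi; constructor => N.
elim: N phi Pphi => [|N IH] phi Pphi; split; try exact: Pc.
  exact: I.
by move=> i; split=> [x|]; [exact: Pd|exact/IH/Pp].
Qed.

Lemma Coo_continuous phi : Coo phi -> continuous phi.
Proof. by case=> /(_ 0%N) []. Qed.

Lemma Coo_derivable phi i x : Coo phi -> derivable phi x (delta_mx 0 i).
Proof. by case=> /(_ 1%N) [_ /(_ i)[+ _]]; exact. Qed.

Lemma Coo_partial i phi : Coo phi -> Coo (partial i phi).
Proof. by case=> cp; constructor=> N; have [_ /(_ i)[_ +]] := cp N.+1. Qed.

Lemma Coo_partials s phi : Coo phi -> Coo (partials s phi).
Proof. by move=> sp; elim: s => //= i s; exact: Coo_partial. Qed.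

Lemma smoothP phi : smooth phi <-> Coo phi.
Proof.
split=> [|sp s]; last first.
  have := Coo_partials s sp; split=> [|i x]; first exact: Coo_continuous.
  exact: Coo_derivable.
move: phi; apply: Coo_coind.
- by move=> phi /(_ [::])[].
- by move=> phi i x /(_ [::])[_]; exact.
- move=> phi i sp s; rewrite -partials_rcons; exact: sp.
Qed.

Lemma partial_cst (c : R) i : partial i (fun=> c) = fun=> 0.
Proof. by apply/funext => x; rewrite /partial derive_cst. Qed.

Lemma CN_cst N (c : R) : CN N (fun=> c).
Proof.
elim: N c => [|N IH] c; split=> //; try exact: cst_continuous.
by move=> i; split=> [x|]; [exact: derivable_cst | rewrite partial_cst; exact: IH].
Qed.

Lemma Coo_cst (c : R) : Coo ((fun=> c) : E -> R).
Proof. by constructor => N; exact: CN_cst. Qed.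

Lemma partialD i phi chi x : derivable phi x (delta_mx 0 i) ->
  derivable chi x (delta_mx 0 i) ->
  partial i (fun y => phi y + chi y) x = partial i phi x + partial i chi x.
Proof. by move=> dp dc; exact: (deriveD dp dc). Qed.

Lemma partialM i phi chi x : derivable phi x (delta_mx 0 i) ->
  derivable chi x (delta_mx 0 i) ->
  partial i (fun y => phi y * chi y) x =
  partial i phi x * chi x + phi x * partial i chi x.
Proof.
move=> dp dc; rewrite /partial [LHS](deriveM dp dc) addrC.
by congr (_ + _); rewrite mulrC.
Qed.

Lemma CND N phi chi : CN N phi -> CN N chi -> CN N (fun x => phi x + chi x).
Proof.
elim: N phi chi => [|N IH] phi chi [cp dp] [cc dc]; split => //.
- by move=> x; apply: continuousD; [exact: cp|exact: cc].
- by move=> x; apply: continuousD; [exact: cp|exact: cc].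
move=> i; have [d1 d2] := dp i; have [d3 d4] := dc i; split=> [x|].
  exact: derivableD.
rewrite (_ : partial i _ = fun x => partial i phi x + partial i chi x); first exact: IH.
by apply/funext => x; rewrite partialD.
Qed.

Lemma CNM N phi chi : CN N phi -> CN N chi -> CN N (fun x => phi x * chi x).
Proof.
elim: N phi chi => [|N IH] phi chi Hp Hc; move: (Hp) (Hc) => [cp dp] [cc dc]; split => //.
- by move=> x; apply: continuousM; [exact: cp|exact: cc].
- by move=> x; apply: continuousM; [exact: cp|exact: cc].
move=> i; have [d1 d2] := dp i; have [d3 d4] := dc i; split=> [x|].
  exact: derivableM.
rewrite (_ : partial i _ = fun x => partial i phi x * chi x + phi x * partial i chi x); last first.
  by apply/funext => x; rewrite partialM.
by apply: CND; apply: IH => //; exact: CNS.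
Qed.

Lemma CooD phi chi : Coo phi -> Coo chi -> Coo (fun x => phi x + chi x).
Proof. by move=> [p] [c]; constructor=> N; exact: CND. Qed.

Lemma CooM phi chi : Coo phi -> Coo chi -> Coo (fun x => phi x * chi x).
Proof. by move=> [p] [c]; constructor=> N; exact: CNM. Qed.

Lemma CooZ (c : R) phi : Coo phi -> Coo (fun x => c * phi x).
Proof. by move=> p; apply: CooM => //; exact: Coo_cst. Qed.

Lemma CooN phi : Coo phi -> Coo (fun x => - phi x).
Proof.
move=> /(@CooZ (-1)); congr Coo; by apply/funext=> x; rewrite mulN1r.
Qed.

Lemma CooB phi chi : Coo phi -> Coo chi -> Coo (fun x => phi x - chi x).
Proof. by move=> p c; apply: CooD => //; exact: CooN. Qed.

Lemma CooX phi m : Coo phi -> Coo (fun x => phi x ^+ m).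
Proof.
move=> p; elim: m => [|m IH].
  by rewrite (_ : (fun _ => _) = fun=> 1); [exact: Coo_cst | apply/funext].
rewrite (_ : (fun _ => _) = fun x => phi x * phi x ^+ m); first exact: CooM.
by apply/funext => x; rewrite exprS.
Qed.

Lemma Coo_sum (I : Type) (r : seq I) (P : pred I) (F : I -> E -> R) :
  (forall k, Coo (F k)) -> Coo (fun x => \sum_(k <- r | P k) F k x).
Proof.
move=> sF; elim: r => [|k r IH].
  rewrite (_ : (fun _ => _) = fun=> 0); first exact: Coo_cst.
  by apply/funext => x; rewrite big_nil.
rewrite (_ : (fun _ => _) = fun x => (if P k then F k x else 0) + \sum_(k <- r | P k) F k x).
  by apply: CooD => //; case: (P k) => //; exact: Coo_cst.
by apply/funext => x; rewrite big_cons; case: (P k); rewrite ?add0r.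
Qed.

Lemma Coo_prod (I : Type) (r : seq I) (P : pred I) (F : I -> E -> R) :
  (forall k, Coo (F k)) -> Coo (fun x => \prod_(k <- r | P k) F k x).
Proof.
move=> sF; elim: r => [|k r IH].
  rewrite (_ : (fun _ => _) = fun=> 1); first exact: Coo_cst.
  by apply/funext => x; rewrite big_nil.
rewrite (_ : (fun _ => _) = fun x => (if P k then F k x else 1) * \prod_(k <- r | P k) F k x).
  by apply: CooM => //; case: (P k) => //; exact: Coo_cst.
by apply/funext => x; rewrite big_cons; case: (P k); rewrite ?mul1r.
Qed.

Lemma coord_is_derive (j : 'I_n) x (v : E) :
  is_derive x v (fun y : E => y 0 j) (v 0 j).
Proof.
apply: DeriveDef; first exact/diff_derivable/differentiable_coord.
apply: (cvg_lim (@Rhausdorff R)) => /=.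
apply: cvg_near_cst; near=> h.
have h0 : h != 0 by near: h; exact: nbhs_dnbhs_neq.
by rewrite !mxE addrK -[_ *: _]/(_ * _) mulKf.
Unshelve. all: by end_near. Qed.

Lemma partial_coord i (j : 'I_n) x : partial i (fun y : E => y 0 j) x = (i == j)%:R.
Proof.
rewrite /partial (@derive_val _ _ _ _ _ _ _ (coord_is_derive j x _)).
by rewrite mxE eqxx eq_sym.
Qed.

Lemma Coo_coord (j : 'I_n) : Coo (fun y : E => y 0 j).
Proof.
have cc : continuous (fun y : E => y 0 j) by exact: coord_continuous.
constructor; case=> [|N]; split=> // i; split=> [x|]; first exact: (@ex_derive _ _ _ _ _ _ _ (coord_is_derive j x _)).
rewrite (_ : partial i _ = fun=> (i == j)%:R); first exact: CN_cst.
by apply/funext => x; exact: partial_coord.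
Qed.

Lemma derive_line phi x v (t : R) :
  'D_1 (fun h : R => phi (h *: v + x)) t = 'D_v phi (t *: v + x).
Proof.
rewrite /derive; set g1 := fun h => h^-1 *: _; set g2 := fun h => h^-1 *: _.
suff -> : g1 = g2 by [].
apply/funext => h; rewrite /g1 /g2 /=.
by rewrite scalerDl addrA [_%:A]mulr1.
Qed.

Lemma derivable_line phi x v (t : R) : derivable phi (t *: v + x) v ->
  derivable (fun h : R => phi (h *: v + x)) t 1.
Proof.
move=> /derivable1P; rewrite /derivable.
set g1 := fun h => h^-1 *: _; set g2 := fun h => h^-1 *: _.
suff -> : g1 = g2 by [].
apply/funext => h; rewrite /g1 /g2 /=.
by rewrite addr0 scalerDl addrA [_%:A]mulr1 scale0r add0r.
Qed.

Lemma is_derive_line phi x v (t d : R) : is_derive (t *: v + x) v phi d ->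
  is_derive t 1 (fun h : R => phi (h *: v + x)) d.
Proof.
move=> [dp <-]; apply: DeriveDef; first exact: derivable_line.
exact: derive_line.
Qed.

Lemma is_derive_line0 phi x v (d : R) :
  is_derive (0 : R) 1 (fun h : R => phi (h *: v + x)) d -> is_derive x v phi d.
Proof.
move=> [dp <-]; apply: DeriveDef; first exact: ((derivable1P phi x v).2 dp).
by rewrite derive_line scale0r add0r.
Qed.

Lemma is_derive_comp1 (f : R -> R) phi x v (df dphi : R) :
  is_derive (phi x) 1 f df -> is_derive x v phi dphi ->
  is_derive x v (fun y => f (phi y)) (df * dphi).
Proof.
move=> dfx dp; apply: is_derive_line0.
have dg : is_derive (0 : R) 1 (fun h : R => phi (h *: v + x)) dphi.
  by apply: is_derive_line; rewrite scale0r add0r.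
apply: (is_derive1_comp _ dg).
by rewrite scale0r add0r.
Qed.

(** Bootstrap: when the partial derivatives of p are expressed by p itself, as
    for 1/phi and 1/sqrt(phi), regularity of order N gives order N+1. *)
Lemma Coo_ode (p : E -> R) (Q : R -> R) (H : 'I_n -> E -> R) :
  continuous p -> (forall i x, derivable p x (delta_mx 0 i)) ->
  (forall N, CN N p -> CN N (fun x => Q (p x))) ->
  (forall i, Coo (H i)) ->
  (forall i x, partial i p x = Q (p x) * H i x) ->
  Coo p.
Proof.
move=> cp dp HQ sH pp; constructor; elim=> [//|N IH]; split=> // i.
split=> [x|]; first exact: dp.
rewrite (_ : partial i p = fun x => Q (p x) * H i x); last exact/funext/pp.
by apply: CNM; [exact: HQ | by case: (sH i)].
Qed.

Lemma CooV phi : Coo phi -> (forall x, phi x != 0) ->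
  Coo (fun x => (phi x)^-1).
Proof.
move=> sp p0.
apply: (@Coo_ode _ (fun t => - (t * t)) (fun i => partial i phi)).
- by move=> x; apply: continuousV => //; exact: Coo_continuous.
- by move=> i x; apply: derivableV => //; exact: Coo_derivable.
- move=> N c; rewrite (_ : (fun _ => _) = fun x => (fun=> -1) x * ((phi x)^-1 * (phi x)^-1)).
    by apply: CNM; [exact: CN_cst|exact: CNM].
  by apply/funext => x; rewrite mulN1r.
- by move=> i; exact: Coo_partial.
- move=> i x; rewrite /partial [LHS](deriveV (p0 x))//; last exact: Coo_derivable.
  by rewrite -[_ *: _]/(_ * _) expr2 invfM.
Qed.

End SmoothFunctions.

(** * Derivatives, inverse square roots and flat functions *)

Section Differentiation.
Context {R : realType} {n : nat}.
Local Notation E := 'rV[R]_n.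
Implicit Types (phi chi : E -> R) (i : 'I_n) (x y : E).

Lemma is_derive_eps (V : normedModType R) (phi : V -> R) (x v : V) (d : R) :
  (forall eps, 0 < eps -> exists2 delta, 0 < delta & forall h, `|h| < delta ->
     `|phi (h *: v + x) - phi x - h * d| <= eps * `|h|) ->
  is_derive x v phi d.
Proof.
move=> H.
have cv : (fun h : R => h^-1 *: ((phi \o shift x) (h *: v) - phi x)) @ 0^' --> d.
  apply/cvgrPdist_le => eps eps0; have [del del0 Hd] := H _ eps0.
  near=> h.
  have h0 : h != 0 by near: h; exact: nbhs_dnbhs_neq.
  have hd : `|h| < del by near: h; exact: dnbhs0_lt.
  rewrite -(ler_pM2l (_ : 0 < `|h|)) ?normr_gt0// -normrM mulrBr -[_ *: _]/(_ * _).
  by rewrite mulVKf// distrC [leRHS]mulrC; exact: Hd.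
apply: DeriveDef; last exact: (cvg_lim (@Rhausdorff R) cv).
by apply/cvg_ex; exists d.
Unshelve. all: by end_near. Qed.

Lemma continuous_eps (V : normedModType R) (f : V -> R) :
  (forall (x : V) eps, 0 < eps -> exists2 delta, 0 < delta & forall y : V, `|x - y| < delta ->
     `|f x - f y| <= eps) -> continuous f.
Proof.
move=> H x; apply/cvgrPdist_le => eps eps0; have [del del0 Hd] := H x _ eps0.
by apply/nbhs_normP; exists del.
Qed.

Lemma Coo_is_derive phi i x : Coo phi ->
  is_derive x (delta_mx 0 i) phi (partial i phi x).
Proof. by move=> cp; apply/derivableP; exact: Coo_derivable. Qed.

Lemma partial_is_derive phi i x (d : R) :
  is_derive x (delta_mx 0 i) phi d -> partial i phi x = d.
Proof. by move=> dp; exact: (@derive_val _ _ _ _ _ _ _ dp). Qed.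

Lemma is_derive_continuous1 (f : R -> R) (t d : R) : is_derive t 1 f d -> {for t, continuous f}.
Proof.
by move=> [df _]; apply/differentiable_continuous/derivable1_diffP.
Qed.

Lemma is_derive_inv1 (t : R) : t != 0 -> is_derive t 1 (fun s : R => s^-1) (- t ^- 2).
Proof.
by move=> tn0; have := @is_deriveV R id t 1 1 tn0 (is_derive_id _ _); rewrite [_ *: _]mulr1.
Qed.

Lemma Coo_invsqrt (q : E -> R) : Coo q -> (forall x, 0 < q x) ->
  Coo (fun x => (Num.sqrt (q x))^-1).
Proof.
move=> sq q0; have s0 x : Num.sqrt (q x) != 0 by rewrite sqrtr_eq0 -ltNge.
have dp i x : is_derive x (delta_mx 0 i) (fun y => Num.sqrt (q y))
    ((2 * Num.sqrt (q x))^-1 * partial i q x).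
  by apply: is_derive_comp1; [exact: is_derive1_sqrt|exact: Coo_is_derive].
have dip i x : is_derive x (delta_mx 0 i) (fun y => (Num.sqrt (q y))^-1)
    (((Num.sqrt (q x))^-1) ^+ 3 * (- 2^-1 * partial i q x)).
  apply: (is_derive_eq (is_derive_comp1 (is_derive_inv1 (s0 x)) (dp i x))).
  by field; rewrite s0.
apply: (@Coo_ode _ _ _ (fun t => t ^+ 3) (fun i x => - 2^-1 * partial i q x)).
- move=> x; apply: (@continuous_comp _ _ _ q (fun t => (Num.sqrt t)^-1)).
    exact: Coo_continuous.
  apply: (@continuous_comp _ _ _ (@Num.sqrt R) (fun t => t^-1)).
    exact: sqrt_continuous.
  exact: is_derive_continuous1 (is_derive_inv1 (s0 x)).
- by move=> i x; have [] := dip i x.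
- move=> N c; rewrite (_ : (fun _ => _) = fun x =>
     (Num.sqrt (q x))^-1 * ((Num.sqrt (q x))^-1 * (Num.sqrt (q x))^-1)).
    by apply: CNM => //; exact: CNM.
  by apply/funext => x; rewrite !exprS expr0 mulr1.
- by move=> i; apply: CooZ; exact: Coo_partial.
- by move=> i x; exact: partial_is_derive.
Qed.

(** The exponents k make the family t^(-k) exp(-1/t) stable under
    differentiation, which is how exp(-1/t) is seen to be smooth at 0. *)
Definition flat (k : nat) (t : R) : R :=
  if 0 < t then t^-1 ^+ k * expR (- t^-1) else 0.

Lemma flat_ge0 k t : 0 <= flat k t.
Proof.
rewrite /flat; case: ifPn => // t0.
by rewrite mulr_ge0// ?expR_ge0// exprn_ge0// invr_ge0 ltW.
Qed.

Lemma flat_eq0 k t : t <= 0 -> flat k t = 0.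
Proof. by rewrite /flat leNgt => /negbTE ->. Qed.

Lemma flat_gt0 k t : 0 < t -> 0 < flat k t.
Proof.
by move=> t0; rewrite /flat t0 mulr_gt0// ?expR_gt0// exprn_gt0// invr_gt0.
Qed.

(** With s = 1/t this is exp(s) >= s^(k+1)/(k+1)!; it yields both the continuity
    and the derivative of [flat] at 0. *)
Lemma flat_bound k t : flat k t <= k.+1`!%:R * `|t|.
Proof.
rewrite /flat; case: ifPn => t0; last by rewrite mulr_ge0// ler0n.
rewrite (gtr0_norm t0); set s := t^-1; have s0 : 0 < s by rewrite invr_gt0.
have -> : t = s^-1 by rewrite invrK.
rewrite expRN ler_pdivlMr// mulrAC -exprSr ler_pdivrMr ?expR_gt0//.
have f0 : 0 < (k.+1`!%:R : R) by rewrite ltr0n fact_gt0.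
rewrite mulrC -ler_pdivrMr//; apply: le_trans (expR_ge1Dxn k (ltW s0)).
by rewrite lerDr.
Qed.

Lemma lt_nbhsr_pos (t : R) : 0 < t -> \forall s \near nbhs t, 0 < s.
Proof.
by move=> t0; near do rewrite -oppr_lt0; apply: Nlt_nbhsl; rewrite oppr_lt0.
Unshelve. all: by end_near. Qed.

Lemma flat_is_derive k (t : R) :
  is_derive t 1 (flat k) (- k%:R * flat k.+1 t + flat k.+2 t).
Proof.
have [t0|t0|->] := ltgtP t 0.
- rewrite !flat_eq0 ?ltW// mulr0 addr0.
  apply: (@near_eq_is_derive _ _ _ (cst (0 : R)) _ t (1 : R) (0 : R)).
  near=> s; rewrite flat_eq0// ltW//.
  by near: s; exact: lt_nbhsl.
- have tn0 : t != 0 by rewrite gt_eqF.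
  have dV := is_derive_inv1 tn0.
  have dVX := @is_deriveX _ _ (fun s : R => s^-1) k t 1 _ dV.
  have dN : is_derive t 1 (fun s : R => - s^-1) (t ^- 2).
    by have := is_deriveN dV; rewrite opprK.
  have dE := @is_derive1_comp _ expR (fun s : R => - s^-1) t _ _ (is_derive_expR _) dN.
  have D := is_deriveM dVX dE.
  apply: is_derive_eq; first apply: (near_eq_is_derive _ D).
    near=> s; have s0 : 0 < s by near: s; exact: lt_nbhsr_pos.
    by rewrite /flat s0 !fctE.
  rewrite /flat t0 !fctE -[LHS]/(t^-1 ^+ k * (expR (- t^-1) / t ^+ 2) +
    expR (- t^-1) * ((k%:R * t^-1 ^+ k.-1) * - t ^- 2)).
  case: k {dVX D} => [|k]; first by rewrite mulr0n !expr0; field.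
  by rewrite /= !exprS; set w := _ ^+ k; field.
- rewrite !(flat_eq0 _ (lexx 0)) mulr0 addr0.
  apply: is_derive_eps => eps eps0; set C : R := k.+2`!%:R.
  have C0 : 0 < C by rewrite ltr0n fact_gt0.
  exists (eps / C); first by rewrite divr_gt0.
  move=> h hd; rewrite mulr0 subr0 addr0 [_ *: _]mulr1 (flat_eq0 k (lexx 0)) subr0.
  rewrite ger0_norm ?flat_ge0//.
  have [h0|h0] := leP h 0; first by rewrite flat_eq0// mulr_ge0// ltW.
  have -> : flat k h = flat k.+1 h * h.
    by rewrite /flat h0 exprS; field; rewrite gt_eqF.
  rewrite (gtr0_norm h0) ler_pM2r//; apply: le_trans (flat_bound _ _) _.
  by rewrite mulrC -ler_pdivlMr// ltW.
Unshelve. all: by end_near. Qed.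

Lemma Coo_flat k phi : Coo phi -> Coo (fun x => flat k (phi x)).
Proof.
move=> [cp]; constructor => N; elim: N k => [|N IH] k; have Cp := CooI cp.
  split=> //.
  move=> x; apply: continuous_comp; first exact: Coo_continuous.
  exact: is_derive_continuous1 (flat_is_derive _ _).
have dp i x : is_derive x (delta_mx 0 i) (fun y => flat k (phi y))
   ((- k%:R * flat k.+1 (phi x) + flat k.+2 (phi x)) * partial i phi x).
  by apply: is_derive_comp1; [exact: flat_is_derive|exact: Coo_is_derive].
split.
  exact: CN_continuous (IH k).
move=> i; split=> [x|]; first by have [] := dp i x.
have -> : partial i (fun y => flat k (phi y)) = fun x =>
   (((fun=> - k%:R) x * flat k.+1 (phi x)) + flat k.+2 (phi x)) * partial i phi x.
  by apply/funext => x; apply: partial_is_derive.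
apply: CNM; last by have [] := Coo_partial i Cp.
by apply: CND => //; apply: CNM => //; exact: CN_cst.
Qed.

Lemma is_derive_affine (eps : R) (c : E) i x phi :
  derivable phi (eps *: x + c) (delta_mx 0 i) ->
  is_derive x (delta_mx 0 i) (fun y => phi (eps *: y + c))
    (eps * partial i phi (eps *: x + c)).
Proof.
move=> dp; apply: is_derive_line0.
have -> : (fun h : R => phi (eps *: (h *: delta_mx 0 i + x) + c)) =
    (fun h => phi (h *: delta_mx 0 i + (eps *: x + c))) \o (fun h => eps * h).
  apply/funext => h /=; congr phi.
  by rewrite scalerDr scalerA addrA.
rewrite mulrC; apply: is_derive1_comp.
  apply: is_derive_line; rewrite mulr0 scale0r add0r; exact/derivableP.
by have := is_deriveZ eps (is_derive_id (0 : R) (1 : R)); rewrite [_ *: _]mulr1.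
Qed.

Lemma partial_affine (eps : R) (c : E) i phi : Coo phi ->
  partial i (fun y => phi (eps *: y + c)) = fun x => eps * partial i phi (eps *: x + c).
Proof.
move=> cp; apply/funext => x; apply: partial_is_derive; apply: is_derive_affine.
exact: Coo_derivable.
Qed.

Lemma Coo_affine (eps : R) (c : E) phi : Coo phi -> Coo (fun x => phi (eps *: x + c)).
Proof.
move=> [cp]; constructor => N; elim: N phi cp => [|N IH] phi cp; have Cp := CooI cp.
  split=> // x; apply: (@continuous_comp _ _ _ (fun x => eps *: x + c) phi).
    by apply: continuousD; [exact: scaler_continuous|exact: cst_continuous].
  exact: Coo_continuous.
split; first exact: CN_continuous (IH _ cp).
move=> i; split=> [x|].
  by have [] := is_derive_affine (@Coo_derivable _ _ phi i (eps *: x + c) Cp).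
rewrite partial_affine//.
apply: CNM; first exact: CN_cst.
by apply: IH; have [] := Coo_partial i Cp.
Qed.

End Differentiation.

(** * Bounds on derivatives, and distributions with compact support *)

Section Bounds.
Context {R : realType} {n : nat}.
Local Notation E := 'rV[R]_n.
Implicit Types (phi chi : E -> R) (i : 'I_n) (x y : E) (u : (E -> R) -> R).

Lemma le_mx_norm x (r : R) : 0 <= r -> (forall i, `|x 0 i| <= r) -> `|x| <= r.
Proof.
move=> r0 xr; rewrite -[leLHS]/(mx_norm x) mx_normrE; apply/bigmax_leP; split=> //.
by move=> [a i] _ /=; rewrite (ord1 a).
Qed.

Lemma coord_le_norm x i : `|x 0 i| <= `|x|.
Proof.
rewrite -[leRHS]/(mx_norm x) mx_normrE; apply/bigmax_geP; right => /=.
by exists (0, i).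
Qed.

Lemma norm_unit_le i (h : R) : `|h *: (delta_mx 0 i : E)| <= `|h|.
Proof.
apply: le_mx_norm => // j; rewrite !mxE eqxx /=.
by case: eqP; rewrite ?mulr1// mulr0 normr0.
Qed.

Lemma compact_ball (M : R) : compact [set x : E | `|x| <= M].
Proof.
apply: bounded_closed_compact.
  exists M; split; first exact: num_real.
  by move=> r Mr x /= xM; rewrite (le_trans xM)// ltW.
apply: (@closed_comp _ _ (fun x : E => `|x|) [set t | t <= M]).
  by move=> x _; exact: norm_continuous.
exact: closed_le.
Qed.

Lemma continuous_bounded_ball phi (M : R) : continuous phi ->
  exists2 B, 0 <= B & forall x, `|x| <= M -> `|phi x| <= B.
Proof.
move=> cp; have cK : compact (phi @` [set x : E | `|x| <= M]).
  apply: continuous_compact; last exact: compact_ball.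
  exact: continuous_subspaceT.
have [B [_ HB]] := compact_bounded cK.
exists (`|B| + 1); first by rewrite addr_ge0.
move=> x xM; apply: HB; last by exists x.
by rewrite (le_lt_trans (ler_norm B))// ltrDl.
Qed.

Lemma uniform_continuity phi (M eps : R) : continuous phi -> 0 < eps ->
  exists2 delta, 0 < delta & forall x y, `|x| <= M -> `|x - y| < delta ->
    `|phi x - phi y| < eps.
Proof.
move=> cp eps0; pose K := [set x : E | `|x| <= M].
have cK : cover_compact K by rewrite -compact_cover; exact: compact_ball.
have e2 : 0 < eps / 2 by rewrite divr_gt0.
have rP x : exists r : R, 0 < r /\ forall y, `|x - y| < r -> `|phi x - phi y| < eps / 2.
  have /cvgrPdist_lt/(_ _ e2) := cp x.
  by move=> /nbhs_ballP[r /= r0 Hr]; exists r; split => // y xy; apply: Hr; rewrite -ball_normE.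
pose r x := xget 1 [set r : R | 0 < r /\ forall y, `|x - y| < r -> `|phi x - phi y| < eps / 2].
have r_spec x : 0 < r x /\ forall y, `|x - y| < r x -> `|phi x - phi y| < eps / 2.
  by rewrite /r; case: xgetP => [y _ //|nH]; have [s Hs] := rP x; case: (nH s Hs).
have [] := cK E setT (fun x => ball x (r x / 2)).
- by move=> x _; exact: ball_open.
- move=> x _; exists x => //; apply: ballxx; rewrite divr_gt0//.
  by have [] := r_spec x.
move=> D _ KD.
exists (\big[Order.min/1]_(x <- finmap.enum_fset D) (r x / 2)).
  elim: (finmap.enum_fset D) => [|x s IH]; first by rewrite big_nil.
  by rewrite big_cons lt_min IH andbT divr_gt0//; have [] := r_spec x.
move=> x y xM xy; have [z zD zx] := KD _ xM.
have [rz Hz] := r_spec z.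
move: zx; rewrite -ball_normE /= => zx.
have xyr : `|x - y| < r z / 2.
  apply: lt_le_trans xy _.
  have : z \in finmap.enum_fset D by exact: zD.
  elim: (finmap.enum_fset D) => // w s IH; rewrite inE big_cons ge_min => /orP[/eqP<-|/IH ->].
    by rewrite lexx.
  by rewrite orbT.
have -> : phi x - phi y = (phi z - phi y) - (phi z - phi x) by ring.
apply: le_lt_trans (ler_normB _ _) _; rewrite (splitr eps); apply: ltrD.
  apply: Hz; rewrite (_ : z - y = (z - x) + (x - y)); last by rewrite addrA subrK.
  by rewrite (le_lt_trans (ler_normD _ _))// (splitr (r z)) ltrD.
by apply: Hz; apply: lt_le_trans zx _; lra.
Qed.

(** The seminorms over balls, stated as upper bounds to avoid suprema. *)
Definition Cbound (M : R) (N : nat) phi (B : R) :=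
  forall s x, (size s <= N)%N -> `|x| <= M -> `|partials s phi x| <= B.

Lemma CboundS M N phi B : Cbound M N.+1 phi B <->
  (forall x, `|x| <= M -> `|phi x| <= B) /\ forall i, Cbound M N (partial i phi) B.
Proof.
split=> [H|[H0 H1] s x].
  split=> [x|i s x sN]; first exact: (H [::]).
  by rewrite -partials_rcons; apply: H; rewrite size_rcons.
case: (lastP s) => [_|{}s i]; first exact: H0.
by rewrite size_rcons partials_rcons; exact: H1.
Qed.

Lemma Cbound_le M N phi B B' : B <= B' -> Cbound M N phi B -> Cbound M N phi B'.
Proof. by move=> BB H s x sN xM; apply: le_trans BB; exact: H. Qed.

Lemma Cbound_sub M M' N N' phi B : M <= M' -> (N <= N')%N ->
  Cbound M' N' phi B -> Cbound M N phi B.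
Proof.
move=> MM NN H s x sN xM; apply: H; [exact: leq_trans NN|exact: le_trans MM].
Qed.

Lemma Cbound_ge0 M N phi B : 0 <= M -> Cbound M N phi B -> 0 <= B.
Proof.
by move=> M0 /(_ [::] 0); rewrite normr0 => /(_ (leq0n _) M0); exact: le_trans.
Qed.

Lemma Cbound_exists M N phi : Coo phi -> exists2 B, 0 <= B & Cbound M N phi B.
Proof.
elim: N phi => [|N IH] phi cp;
  have [B B0 HB] := continuous_bounded_ball M (Coo_continuous cp).
  by exists B => // -[|//] x _ xM; exact: HB.
have /choice[b Hb] i : exists b, 0 <= b /\ Cbound M N (partial i phi) b.
  by have [b b0 Hb] := IH _ (Coo_partial i cp); exists b.
exists (B + \sum_i b i); first by rewrite addr_ge0// sumr_ge0// => i _; have [] := Hb i.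
apply/CboundS; split=> [x xM|i].
  by rewrite (le_trans (HB _ xM))// lerDl sumr_ge0// => i _; have [] := Hb i.
have [b0 Hbi] := Hb i; apply: Cbound_le Hbi.
rewrite (bigD1 i)//= addrCA lerDl addr_ge0// sumr_ge0// => j _.
by have [] := Hb j.
Qed.

Lemma CboundD M N phi chi B B' : Coo phi -> Coo chi ->
  Cbound M N phi B -> Cbound M N chi B' -> Cbound M N (fun x => phi x + chi x) (B + B').
Proof.
elim: N phi chi => [|N IH] phi chi cp cc H1 H2.
  by move=> [|//] x _ xM; rewrite (le_trans (ler_normD _ _))// lerD// ?(H1 [::])// ?(H2 [::]).
move/CboundS: H1 => [H1 K1]; move/CboundS: H2 => [H2 K2].
apply/CboundS; split=> [x xM|i].
  by rewrite (le_trans (ler_normD _ _))// lerD// ?H1 ?H2.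
have -> : partial i (fun x => phi x + chi x) = fun x => partial i phi x + partial i chi x.
  by apply/funext => x; rewrite partialD//; exact: Coo_derivable.
by apply: IH => //; exact: Coo_partial.
Qed.

(** The constant depends on chi only: multiplication by chi is continuous. *)
Lemma CboundM M N chi : 0 <= M -> Coo chi -> exists2 C, 0 <= C & forall phi B, Coo phi ->
  Cbound M N phi B -> Cbound M N (fun x => chi x * phi x) (C * B).
Proof.
move=> M0; elim: N chi => [|N IH] chi cc;
  have [C C0 HC] := continuous_bounded_ball M (Coo_continuous cc).
  exists C => // phi B cp HB [|//] x _ xM /=.
  by rewrite normrM ler_pM// ?HC// (HB [::]).
have [C1 C10 HC1] := IH _ cc.
have /choice[c Hc] i : exists c, 0 <= c /\ forall phi B, Coo phi ->
  Cbound M N phi B -> Cbound M N (fun x => partial i chi x * phi x) (c * B).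
  by have [c c0 Hc] := IH _ (Coo_partial i cc); exists c.
have S0 : 0 <= \sum_i c i by rewrite sumr_ge0// => i _; have [] := Hc i.
exists (C + (C1 + \sum_i c i)); first by rewrite !addr_ge0.
move=> phi B cp HB; have B0 := Cbound_ge0 M0 HB.
have HBN : Cbound M N phi B by exact: (Cbound_sub (lexx M) (leqnSn N)).
move/CboundS: HB => [H1 K1]; apply/CboundS; split=> [x xM|i].
  rewrite normrM; apply: (@le_trans _ _ (C * B)); first by rewrite ler_pM// ?HC ?H1.
  by rewrite ler_wpM2r// lerDl addr_ge0.
have -> : partial i (fun x => chi x * phi x) =
    fun x => partial i chi x * phi x + chi x * partial i phi x.
  by apply/funext => x; rewrite partialM//; exact: Coo_derivable.
have [c0 Hci] := Hc i.
apply: (@Cbound_le _ _ _ (c i * B + C1 * B)).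
  have ci : c i <= \sum_i c i.
    by rewrite (bigD1 i)//= lerDl sumr_ge0// => j _; have [] := Hc j.
  by rewrite -mulrDl ler_wpM2r//; lra.
apply: CboundD.
- by apply: CooM => //; exact: Coo_partial.
- by apply: CooM => //; exact: Coo_partial.
- exact: Hci.
- by apply: HC1 => //; exact: Coo_partial.
Qed.

Definition Coo_linear u := forall (a : R) phi chi, Coo phi -> Coo chi ->
  u (fun x => a * phi x + chi x) = a * u phi + u chi.

Definition Coo_bounded M N C u := forall phi B, Coo phi -> Cbound M N phi B ->
  `|u phi| <= C * B.

(** The compactly supported distributions, tested on balls: enlarging the
    compact set K to a ball costs nothing. *)
Variant Edist u : Prop := Edist_ of Coo_linear u &
  exists M N C, [/\ 0 <= M, 0 <= C & Coo_bounded M N C u].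

Lemma compact_distributionP u : compact_distribution u <-> Edist u.
Proof.
split=> [[lu [K [N [C [cK HC]]]]]|[lu [M [N [C [M0 C0 HC]]]]]].
  split=> [a phi chi cp cc|]; first by apply: lu; exact/smoothP.
  have [M0 [_ HM0]] := compact_bounded cK.
  pose M := `|M0| + 1.
  have KM x : K x -> `|x| <= M.
    by move=> Kx; apply: HM0 => //; rewrite /M (le_lt_trans (ler_norm M0))// ltrDl.
  exists M, N, `|C|; split; [by rewrite /M addr_ge0|by []|].
  move=> phi B cp HB.
  have B0 : 0 <= B by apply: Cbound_ge0 HB; rewrite /M addr_ge0.
  apply: le_trans (HC phi _) _; first exact/smoothP.
  rewrite /seminorm; set S := (X in sup X).
  have ubS : ubound S B by move=> _ [s [x [sN Kx ->]]]; apply: HB => //; exact: KM.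
  have [S0|/nonemptyPn S0] := pselect (S !=set0); last first.
    by rewrite S0 sup0 mulr0 mulr_ge0.
  have sB : sup S <= B by exact: ge_sup.
  have s0 : 0 <= sup S.
    have [r Sr] := S0; apply: (@le_trans _ _ r).
      by have [s [x [_ _ ->]]] := Sr.
    by apply: ub_le_sup Sr; exists B.
  apply: (@le_trans _ _ (`|C| * sup S)); first by rewrite ler_wpM2r// ler_norm.
  by rewrite ler_wpM2l.
split=> [a phi chi /smoothP cp /smoothP cc|]; first exact: lu.
exists [set x | `|x| <= M], N, C; split; first exact: compact_ball.
move=> phi /smoothP cp; apply: HC => // s x sN xM.
have [B _ HB] := Cbound_exists M N cp.
apply: ub_le_sup; last by exists s, x.
by exists B => _ [t [y [tN yM ->]]]; exact: HB.
Qed.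

End Bounds.

(** * Operations on distributions with compact support *)

Section DistTheory.
Context {R : realType} {n : nat}.
Local Notation E := 'rV[R]_n.
Implicit Types (phi chi : E -> R) (i : 'I_n) (x y : E) (u v : (E -> R) -> R).

Lemma Edist_linear u : Edist u -> Coo_linear u.
Proof. by case. Qed.

Lemma linear_ext u phi chi : (forall x, phi x = chi x) -> u phi = u chi.
Proof. by move=> pc; congr u; apply/funext. Qed.

Lemma linearC0 u : Coo_linear u -> u (fun=> 0) = 0.
Proof.
move=> lu; have := lu 1 _ _ (Coo_cst 0) (Coo_cst 0).
rewrite (_ : (fun _ => _) = fun=> 0); last by apply/funext => x; rewrite mulr0 addr0.
by rewrite mul1r => /eqP; rewrite -subr_eq0 opprD addNKr oppr_eq0 => /eqP.
Qed.

Lemma linearCD u phi chi : Coo_linear u -> Coo phi -> Coo chi ->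
  u (fun x => phi x + chi x) = u phi + u chi.
Proof.
move=> lu cp cc; have := lu 1 _ _ cp cc; rewrite mul1r => <-.
by apply: linear_ext => x; rewrite mul1r.
Qed.

Lemma linearCZ u (a : R) phi : Coo_linear u -> Coo phi -> u (fun x => a * phi x) = a * u phi.
Proof.
move=> lu cp; have := lu a _ _ cp (Coo_cst 0); rewrite linearC0// addr0 => <-.
by apply: linear_ext => x; rewrite addr0.
Qed.

Lemma linearCB u phi chi : Coo_linear u -> Coo phi -> Coo chi ->
  u (fun x => phi x - chi x) = u phi - u chi.
Proof.
move=> lu cp cc; have := lu (-1) _ _ cc cp; rewrite mulN1r addrC => <-.
by apply: linear_ext => x; rewrite mulN1r addrC.
Qed.

Lemma linearC_sum u (I : Type) (r : seq I) (F : I -> E -> R) : Coo_linear u ->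
  (forall k, Coo (F k)) ->
  u (fun x => \sum_(k <- r) F k x) = \sum_(k <- r) u (F k).
Proof.
move=> lu cF; elim: r => [|k r IH].
  rewrite big_nil -[RHS](linearC0 lu).
  by apply: linear_ext => x; rewrite big_nil.
rewrite big_cons -IH -linearCD//; last exact: Coo_sum.
by apply: linear_ext => x; rewrite big_cons.
Qed.

Lemma partial_near0 i phi (r : R) : (forall x, `|x| < r -> phi x = 0) ->
  forall x, `|x| < r -> partial i phi x = 0.
Proof.
move=> p0 x xr; apply: partial_is_derive.
apply: is_derive_eps => eps eps0; exists (r - `|x|); first by rewrite subr_gt0.
move=> h hr; rewrite (p0 x)// p0.
  by rewrite mulr0 !subr0 normr0 mulr_ge0// ltW.
rewrite (le_lt_trans (ler_normD _ _))// -ltrBrDr (le_lt_trans _ hr)//.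
exact: norm_unit_le.
Qed.

Lemma partial_far0 i phi (r : R) : (forall x, r < `|x| -> phi x = 0) ->
  forall x, r < `|x| -> partial i phi x = 0.
Proof.
move=> p0 x xr; apply: partial_is_derive.
apply: is_derive_eps => eps eps0; exists (`|x| - r); first by rewrite subr_gt0.
move=> h hr; rewrite (p0 x)// p0.
  by rewrite mulr0 !subr0 normr0 mulr_ge0// ltW.
rewrite addrC; apply: lt_le_trans (lerB_normD _ _).
by rewrite ltrBrDr addrC -ltrBrDr (le_lt_trans _ hr)//; exact: norm_unit_le.
Qed.

Lemma partials_near0 s phi (r : R) : (forall x, `|x| < r -> phi x = 0) ->
  forall x, `|x| < r -> partials s phi x = 0.
Proof. by move=> p0; elim: s => //= i s; exact: partial_near0. Qed.

Lemma partials_far0 s phi (r : R) : (forall x, r < `|x| -> phi x = 0) ->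
  forall x, r < `|x| -> partials s phi x = 0.
Proof. by move=> p0; elim: s => //= i s; exact: partial_far0. Qed.

(** Derivatives on the closed ball only see values on a larger open ball. *)
Lemma Edist_local u : Edist u -> exists2 M, 0 <= M & forall phi chi, Coo phi -> Coo chi ->
  (forall x, `|x| < M -> phi x = chi x) -> u phi = u chi.
Proof.
case=> lu [M [N [C [M0 C0 HC]]]]; exists (M + 1); first by rewrite addr_ge0.
move=> phi chi cp cc pc; apply/eqP; rewrite -subr_eq0 -linearCB//.
rewrite -normr_le0 (le_trans (HC _ 0 _ _)) ?mulr0//; first exact: CooB.
move=> s x _ xM; rewrite (@partials_near0 _ _ (M + 1)) ?normr0//.
  by move=> y yM; rewrite pc// subrr.
by rewrite (le_lt_trans xM)// ltrDl.
Qed.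

Lemma Edist_partial u i : Edist u -> Edist (fun phi => u (partial i phi)).
Proof.
case=> lu [M [N [C [M0 C0 HC]]]]; split.
  move=> a phi chi cp cc; rewrite -lu; try exact: Coo_partial.
  congr u; apply/funext => x; apply: partial_is_derive.
  have h1 := Coo_is_derive i x (CooZ a cp).
  have -> : a * partial i phi x + partial i chi x =
    partial i (fun y => a * phi y) x + partial i chi x.
    congr (_ + _); apply/esym/partial_is_derive.
    have := is_deriveZ a (Coo_is_derive i x cp); exact.
  by apply: is_deriveD; exact: Coo_is_derive.
exists M, N.+1, C; split=> // phi B cp /CboundS[_ HB].
by apply: HC => //; exact: Coo_partial.
Qed.

Lemma Edist_mul u chi : Coo chi -> Edist u -> Edist (fun phi => u (fun x => chi x * phi x)).
Proof.
move=> cc [lu [M [N [C [M0 C0 HC]]]]]; split.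
  move=> a phi psi cp cs; rewrite -lu; try exact: CooM.
  by apply: linear_ext => x; rewrite mulrDr mulrCA.
have [D D0 HD] := CboundM N M0 cc.
exists M, N, (C * D); split=> //; first by rewrite mulr_ge0.
move=> phi B cp HB; rewrite -mulrA; apply: HC; first exact: CooM.
exact: HD.
Qed.

Lemma Edist0 : Edist (fun _ : E -> R => 0).
Proof.
split=> [a phi chi _ _|]; first by rewrite mulr0 addr0.
by exists 0, 0%N, 0; split=> // phi B _ _; rewrite normr0 mul0r.
Qed.

Lemma EdistD u v : Edist u -> Edist v -> Edist (fun phi => u phi + v phi).
Proof.
move=> [lu [M [N [C [M0 C0 HC]]]]] [lv [M' [N' [C' [M0' C0' HC']]]]]; split.
  by move=> a phi chi cp cc; rewrite lu// lv// mulrDr addrACA.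
exists (Num.max M M'), (maxn N N'), (C + C'); split; first by rewrite le_max M0.
  by rewrite addr_ge0.
move=> phi B cp HB; rewrite (le_trans (ler_normD _ _))// mulrDl lerD//.
  by apply: HC => //; apply: Cbound_sub HB; rewrite ?le_max ?lexx// leq_maxl.
by apply: HC' => //; apply: Cbound_sub HB; rewrite ?le_max ?lexx ?orbT// leq_maxr.
Qed.

Lemma EdistN u : Edist u -> Edist (fun phi => - u phi).
Proof.
move=> [lu [M [N [C [M0 C0 HC]]]]]; split.
  by move=> a phi chi cp cc; rewrite lu// opprD mulrN.
by exists M, N, C; split=> // phi B cp HB; rewrite normrN; exact: HC.
Qed.

Lemma Edist_sum (I : Type) (r : seq I) (u : I -> (E -> R) -> R) :
  (forall k, Edist (u k)) -> Edist (fun phi => \sum_(k <- r) u k phi).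
Proof.
move=> Eu; elim: r => [|k r IH].
  rewrite (_ : (fun _ => _) = fun=> 0); first exact: Edist0.
  by apply/funext => phi; rewrite big_nil.
rewrite (_ : (fun _ => _) = fun phi => u k phi + \sum_(k <- r) u k phi); first exact: EdistD.
by apply/funext => phi; rewrite big_cons.
Qed.

Lemma Coo_shift (c : E) phi : Coo phi -> Coo (fun x => phi (x + c)).
Proof.
move=> /(Coo_affine 1 c); congr Coo.
by apply/funext => x; rewrite scale1r.
Qed.

Lemma partial_shift (c : E) i phi : Coo phi ->
  partial i (fun x => phi (x + c)) = fun x => partial i phi (x + c).
Proof.
move=> cp; have := partial_affine 1 c i cp.
rewrite (_ : (fun y : E => phi (1 *: y + c)) = fun y => phi (y + c)).
  by move=> ->; apply/funext => x; rewrite mul1r scale1r.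
by apply/funext => x; rewrite scale1r.
Qed.

Lemma partials_shift (c : E) s phi : Coo phi ->
  partials s (fun x => phi (x + c)) = fun x => partials s phi (x + c).
Proof.
move=> cp; elim: s => //= i s ->; apply: partial_shift; exact: Coo_partials.
Qed.

Lemma Edist_shift u c : Edist u -> Edist (fun phi => u (fun x => phi (x + c))).
Proof.
move=> [lu [M [N [C [M0 C0 HC]]]]]; split.
  by move=> a phi chi cp cc; rewrite -lu//; exact: Coo_shift.
exists (M + `|c|), N, C; split=> //; first by rewrite addr_ge0.
move=> phi B cp HB; apply: HC; first exact: Coo_shift.
move=> s x sN xM; rewrite partials_shift//; apply: HB => //.
by rewrite (le_trans (ler_normD _ _))// lerD2r.
Qed.

(** The uniformity in z is what allows differentiation under an integral. *)
Lemma taylor1 phi i (M eps : R) : Coo phi -> 0 < eps ->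
  exists2 delta, 0 < delta & forall z h, `|z| <= M -> `|h| < delta ->
    `|phi (h *: delta_mx 0 i + z) - phi z - h * partial i phi z| <= eps * `|h|.
Proof.
move=> cp eps0.
have [del del0 Hd] := uniform_continuity M (Coo_continuous (Coo_partial i cp)) eps0.
exists del => // z h zM hd.
pose g (t : R) := phi (t *: delta_mx 0 i + z).
have dg (t : R) : is_derive t 1 g (partial i phi (t *: delta_mx 0 i + z)).
  by apply: is_derive_line; exact: Coo_is_derive.
have near_le t : `|t| <= `|h| -> `|partial i phi (t *: delta_mx 0 i + z) - partial i phi z| <= eps.
  move=> th; rewrite distrC ltW// Hd// opprD addrCA subrr addr0 normrN.
  by rewrite (le_lt_trans (norm_unit_le _ _))// (le_lt_trans th).
have g0 : g 0 = phi z by rewrite /g scale0r add0r.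
rewrite -g0 -/(g h).
have cg (a b : R) : {within `[a, b], continuous g}.
  apply: continuous_subspaceT => t; exact: is_derive_continuous1 (dg t).
suff [c [ch ->]] : exists c, `|c| <= `|h| /\
    g h - g 0 = h * partial i phi (c *: delta_mx 0 i + z).
  by rewrite -mulrBr normrM mulrC ler_wpM2r// near_le.
have [h0|h0|->] := ltgtP h 0.
- have [c] := MVT h0 (fun t _ => dg t) (cg _ _).
  rewrite in_itv /= => /andP[hc c0] e; exists c; split.
    by rewrite !ltr0_norm// lerN2 ltW.
  by rewrite -[LHS]opprB e; ring.
- have [c] := MVT h0 (fun t _ => dg t) (cg _ _).
  rewrite in_itv /= => /andP[c0 ch] e; exists c; split.
    by rewrite !gtr0_norm// ltW.
  by rewrite e; ring.
- by exists 0; rewrite subrr mul0r.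
Qed.

End DistTheory.

(** * Differentiation of averages

    Convolutions (where a_x is a translation) and means along segments (where
    a_x contracts one coordinate) are both of the form
      y |-> int k(x) phi(a_x(y)) dx
    with maps a_x that carry lines in direction i to lines in direction i,
    rescaled by c_i(x). Differentiation in direction i thus replaces k by k c_i
    and phi by its partial derivative: the form is preserved. *)

Section Averaging.
Context d {X : measurableType d} {R : realType} {n : nat}.
Local Notation E := 'rV[R]_n.
Variables (mu : {measure set X -> \bar R}) (a : X -> E -> E) (c : 'I_n -> X -> R).
Hypothesis a_meas : forall (phi : E -> R) y, continuous phi ->
  measurable_fun setT (fun x => phi (a x y)).
Hypothesis a_lip : forall x y y', `|a x y - a x y'| <= `|y - y'|.
Hypothesis c_meas : forall i, measurable_fun setT (c i).
Hypothesis c_le1 : forall i x, `|c i x| <= 1.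
Hypothesis a_line : forall x i (h : R) y,
  a x (h *: delta_mx 0 i + y) = (h * c i x) *: delta_mx 0 i + a x y.
Implicit Types (phi : E -> R) (k g : X -> R) (x : X) (y : E).

Definition L1mu (k : X -> R) := mu.-integrable setT (EFin \o k).

Definition avg k phi y : R := \int[mu]_x (k x * phi (a x y)).

(** For y in a bounded set, k may be traded for an integrable weight that only
    charges points x with a_x(y) in a fixed ball. A locally integrable k is
    truncated when phi has compact support; the derivatives of phi are included
    so that the property passes to them. *)
Definition dominated k phi := forall M, exists k1 M',
  [/\ L1mu k1, (forall x y, `|y| <= M -> k1 x != 0 -> `|a x y| <= M') &
      forall x y s, `|y| <= M ->
        k x * partials s phi (a x y) = k1 x * partials s phi (a x y)].

Lemma L1mu_le k g : L1mu k -> measurable_fun setT g -> (forall x, `|g x| <= `|k x|) -> L1mu g.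
Proof.
move=> kL mg gk; apply: (le_integrable measurableT _ _ kL).
  exact/measurable_EFinP.
by move=> x _ /=; rewrite lee_fin.
Qed.

Lemma L1mu_meas k : L1mu k -> measurable_fun setT k.
Proof. by move=> /integrableP[/measurable_EFinP]. Qed.

Lemma L1muZ (b : R) k : L1mu k -> L1mu (fun x => b * k x).
Proof. by move=> kL; have := integrableZl measurableT b kL. Qed.

Lemma L1muD k g : L1mu k -> L1mu g -> L1mu (fun x => k x + g x).
Proof. by move=> kL gL; have := integrableD measurableT kL gL. Qed.

Lemma L1muB k g : L1mu k -> L1mu g -> L1mu (fun x => k x - g x).
Proof. by move=> kL gL; have := integrableB measurableT kL gL. Qed.

Lemma L1mu_norm k : L1mu k -> L1mu (fun x => `|k x|).
Proof. by move=> kL; have := integrable_norm kL. Qed.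

Lemma L1mu_bounded k g (B : R) : L1mu k -> measurable_fun setT g -> 0 <= B ->
  (forall x, k x != 0 -> `|g x| <= B) -> L1mu (fun x => k x * g x).
Proof.
move=> kL mg B0 gB; apply: (L1mu_le (L1muZ B kL)).
  by apply: measurable_funM => //; exact: L1mu_meas.
move=> x; rewrite !normrM mulrC (ger0_norm B0).
by have [->|k0] := eqVneq (k x) 0; [rewrite normr0 !mulr0|rewrite ler_wpM2r ?gB].
Qed.

Lemma norm_Rintegral_le k g (B : R) : L1mu k -> L1mu g ->
  (forall x, `|g x| <= B * `|k x|) -> `|\int[mu]_x g x| <= B * \int[mu]_x `|k x|.
Proof.
move=> kL gL gB; apply: le_trans (le_normr_Rintegral measurableT gL) _.
rewrite -RintegralZl//; last exact: L1mu_norm.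
apply: le_Rintegral => //; [exact: L1mu_norm | exact/L1muZ/L1mu_norm].
Qed.

Lemma avg_L1 k phi y : Coo phi -> dominated k phi -> L1mu (fun x => k x * phi (a x y)).
Proof.
move=> cp /(_ `|y|)[k1 [M [k1L aM kk1]]].
have -> : (fun x => k x * phi (a x y)) = fun x => k1 x * phi (a x y).
  by apply/funext => x; exact: (kk1 x y [::]).
have [B B0 HB] := continuous_bounded_ball M (Coo_continuous cp).
apply: (L1mu_bounded k1L _ B0); first exact/a_meas/Coo_continuous.
by move=> x k10; apply/HB/aM.
Qed.

Lemma dominated_partial k phi i : dominated k phi ->
  dominated (fun x => k x * c i x) (partial i phi).
Proof.
move=> dk M; have [k1 [M' [k1L aM kk1]]] := dk M.
exists (fun x => k1 x * c i x), M'; split.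
- by apply: (L1mu_bounded k1L (c_meas i) ler01) => x _.
- by move=> x y yM; rewrite mulf_eq0 negb_or => /andP[k10 _]; exact: aM.
- move=> x y s yM; rewrite -partials_rcons -[LHS]mulrA -[RHS]mulrA.
  by rewrite [LHS]mulrCA [RHS]mulrCA kk1.
Qed.

Lemma avg_continuous k phi : Coo phi -> dominated k phi -> continuous (avg k phi).
Proof.
move=> cp dk; apply: continuous_eps => y0 eps eps0; have [k1 [M' [k1L aM kk1]]] := dk (`|y0| + 1).
have avgE y : `|y| <= `|y0| + 1 -> avg k phi y = \int[mu]_x (k1 x * phi (a x y)).
  by move=> yM; apply: eq_Rintegral => x _; exact: (kk1 x y [::]).
have L1 y : `|y| <= `|y0| + 1 -> L1mu (fun x => k1 x * phi (a x y)).
  move=> yM; rewrite (_ : (fun _ => _) = fun x => k x * phi (a x y)).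
    exact: avg_L1.
  by apply/funext => x; rewrite -(kk1 x y [::]).
have y0M : `|y0| <= `|y0| + 1 by rewrite lerDl.
set I := \int[mu]_x `|k1 x|.
have I0 : 0 <= I by apply: Rintegral_ge0.
have eI : 0 < eps / (I + 1) by rewrite divr_gt0// ltr_wpDl.
have [del del0 Hd] := uniform_continuity M' (Coo_continuous cp) eI.
exists (Num.min del 1) => [|y]; first by rewrite lt_min del0 ltr01.
rewrite lt_min => /andP[yd y1].
have yM : `|y| <= `|y0| + 1.
  rewrite -[y](subrK y0) addrC (le_trans (ler_normD _ _))// lerD2l.
  by rewrite distrC ltW.
rewrite !avgE// -RintegralB; [|by []|exact: L1|exact: L1].
apply: (@le_trans _ _ (eps / (I + 1) * I)).
  apply: norm_Rintegral_le => //; first by apply: L1muB; exact: L1.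
  move=> x; rewrite -mulrBr normrM mulrC.
  have [->|k10] := eqVneq (k1 x) 0; first by rewrite normr0 !mulr0.
  rewrite ler_wpM2r// ltW// Hd// ?aM//.
  exact: le_lt_trans (a_lip _ _ _) yd.
rewrite mulrAC ler_pdivrMr ?ltr_wpDl// ler_wpM2l ?lerDl// ltW//.
Qed.

Lemma avg_is_derive k phi i y : Coo phi -> dominated k phi ->
  is_derive y (delta_mx 0 i) (avg k phi) (avg (fun x => k x * c i x) (partial i phi) y).
Proof.
move=> cp dk; have [k1 [M' [k1L aM kk1]]] := dk (`|y| + 1).
have cpi := Coo_partial i cp; have dki := dominated_partial i dk.
set I := \int[mu]_x `|k1 x|.
have I0 : 0 <= I by apply: Rintegral_ge0.
have yM0 : `|y| <= `|y| + 1 by rewrite lerDl.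
apply: is_derive_eps => eps eps0.
have eI : 0 < eps / (I + 1) by rewrite divr_gt0// ltr_wpDl.
have [del del0 Hd] := taylor1 i M' cp eI.
exists (Num.min del 1); first by rewrite lt_min del0 ltr01.
move=> h; rewrite lt_min => /andP[hd h1].
have yM : `|h *: delta_mx 0 i + y| <= `|y| + 1.
  rewrite addrC (le_trans (ler_normD _ _))// lerD2l.
  by rewrite (le_trans (norm_unit_le _ _))// ltW.
have L1 := avg_L1 y cp dk; have L2 := avg_L1 (h *: delta_mx 0 i + y) cp dk.
have L3 := L1muZ h (avg_L1 y cpi dki).
rewrite /avg -RintegralB// -RintegralZl//; last exact: avg_L1.
rewrite -RintegralB//; last exact: L1muB.
apply: (@le_trans _ _ ((eps / (I + 1) * `|h|) * I)).
  apply: norm_Rintegral_le => //; first by apply: L1muB => //; exact: L1muB.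
  move=> x.
  rewrite (kk1 x (h *: delta_mx 0 i + y) [::])// (kk1 x y [::])//=.
  have -> : k x * c i x * partial i phi (a x y) = k1 x * c i x * partial i phi (a x y).
    by rewrite mulrAC (kk1 x y [:: i])// mulrAC.
  rewrite -mulrBr -!mulrA mulrCA -mulrBr normrM mulrC.
  have [->|k10] := eqVneq (k1 x) 0; first by rewrite normr0 !mulr0.
  rewrite [leRHS](_ : _ = eps / (I + 1) * `|h| * `|k1 x|); last by rewrite !mulrA.
  rewrite ler_wpM2r// (mulrA h) a_line.
  have hc : `|h * c i x| <= `|h| by rewrite normrM ler_piMr.
  apply: le_trans (Hd _ _ (aM x y yM0 k10) (le_lt_trans hc hd)) _.
  by rewrite ler_wpM2l// ltW.
rewrite mulrAC ler_wpM2r// mulrAC ler_pdivrMr ?ltr_wpDl// ler_wpM2l ?lerDl// ltW//.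
Qed.

Lemma Coo_avg k phi : Coo phi -> dominated k phi -> Coo (avg k phi).
Proof.
move=> cp dk; apply: (@Coo_coind _ _ (fun psi => exists k phi,
  [/\ Coo phi, dominated k phi & psi = avg k phi])); last by exists k, phi.
- by move=> _ [k' [phi' [cp' dk' ->]]]; exact: avg_continuous.
- move=> _ i y [k' [phi' [cp' dk' ->]]].
  by have [] := avg_is_derive i y cp' dk'.
- move=> _ i [k' [phi' [cp' dk' ->]]].
  exists (fun x => k' x * c i x), (partial i phi'); split.
  + exact: Coo_partial.
  + exact: dominated_partial.
  + by apply/funext => y; apply: partial_is_derive; exact: avg_is_derive.
Qed.

Lemma partial_avg k phi i : Coo phi -> dominated k phi ->
  partial i (avg k phi) = avg (fun x => k x * c i x) (partial i phi).
Proof.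
by move=> cp dk; apply/funext => y; apply: partial_is_derive; exact: avg_is_derive.
Qed.

Lemma avg_le k phi y (B : R) : L1mu k -> L1mu (fun x => k x * phi (a x y)) ->
  (forall x, k x != 0 -> `|phi (a x y)| <= B) ->
  `|avg k phi y| <= B * \int[mu]_x `|k x|.
Proof.
move=> kL L1 pB; apply: norm_Rintegral_le => // x; rewrite normrM mulrC.
by have [->|k0] := eqVneq (k x) 0; [rewrite normr0 !mulr0|rewrite ler_wpM2r ?pB].
Qed.

End Averaging.

(** * Lebesgue measure on tuples: invariance and cubes *)

Section TupleMeasure.
Context {R : realType}.
Local Notation leb := (@lebesgue_measure R).
Local Notation mu n := (power_measure leb n).
Local Notation T := (measurableTypeR R).

Lemma measurable_affine (eps c : R) : measurable_fun [set: T] ((fun x => eps * x + c) : T -> T).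
Proof.
by apply: measurable_funD => //; apply: measurable_funM.
Qed.

(** The signs +1 and -1 cover the translations and the reflection that are
    needed for convolutions. *)
Lemma lebesgue_measure_affine (eps c : R) : eps = 1 \/ eps = -1 ->
  forall A, measurable A -> pushforward leb ((fun x => eps * x + c) : T -> T) A = leb A.
Proof.
move=> He A mA; apply/esym/(lebesgue_measure_unique (mu :=
  measure_function_pushforward__canonical__measure_function_Measure leb (measurable_affine eps c))) => //= _ [[a b]] _ <-.
rewrite /pushforward/=.
have [e|e] := He.
- have -> : ((fun x => eps * x + c) : T -> T) @^-1` `]a, b]%classic = `]a - c, b - c]%classic.
    by apply/seteqP; split=> x /=; rewrite !in_itv /= e; lra.
  rewrite !lebesgue_measure_itv/= !lte_fin ltrD2r.
  by case: ifP => // _; rewrite -!EFinB; congr EFin; ring.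
- have -> : ((fun x => eps * x + c) : T -> T) @^-1` `]a, b]%classic = `[c - b, c - a[%classic.
    by apply/seteqP; split=> x /=; rewrite !in_itv /= e; lra.
  rewrite !lebesgue_measure_itv/= !lte_fin ltrD2l ltrN2.
  by case: ifP => // _; rewrite -!EFinB; congr EFin; ring.
Qed.

Lemma ge0_integral_affine (eps c : R) (f : T -> \bar R) : eps = 1 \/ eps = -1 ->
  measurable_fun setT f -> (forall x, 0 <= f x)%E ->
  (\int[leb]_x f (eps * x + c)%R = \int[leb]_x f x)%E.
Proof.
move=> He mf f0.
have := @ge0_integral_pushforward _ _ _ _ _ _ (measurable_affine eps c) leb setT f measurableT mf (fun x _ => f0 x).
rewrite preimage_setT => <-.
apply: eq_measure_integral => [|? A mA _]; first exact: measurable_affine.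
exact: lebesgue_measure_affine.
Qed.

Lemma integral_power_step n (f : n.+1.-tuple T -> \bar R) :
  measurable_fun setT f -> (forall x, 0 <= f x)%E ->
  (\int[mu n.+1]_t f t = \int[leb]_x \int[mu n]_t f (tuple_consp (x, t)))%E.
Proof.
move=> mf f0.
have := @ge0_integral_pushforward _ _ _ _ _ _ (measurable_tuple_consp (T := T) (n := n)) (leb \x mu n)%E setT f measurableT mf (fun x _ => f0 x).
rewrite preimage_setT => e.
transitivity (\int[(leb \x mu n)%E]_x (f \o (@tuple_consp _ T n)) x)%E; first exact: e.
rewrite (fubini_tonelli1 (f \o (@tuple_consp _ T n)))//; last by move=> p; exact: f0.
apply: measurableT_comp => //; exact: measurable_tuple_consp.
Qed.

Definition affT n (eps : R) (c : 'I_n -> R) (t : n.-tuple T) : n.-tuple T :=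
  [tuple eps * tnth t i + c i | i < n].

Lemma measurable_affT n (eps : R) (c : 'I_n -> R) : measurable_fun setT (affT eps c).
Proof.
apply/measurable_fun_tnthP => i.
rewrite (_ : _ \o _ = fun t : n.-tuple T => eps * tnth t i + c i); last first.
  by apply/funext => t /=; rewrite tnth_mktuple.
apply: measurable_funD => //; apply: measurable_funM => //.
exact: measurable_tnth.
Qed.

Lemma affT_consp n (eps : R) (c : 'I_n.+1 -> R) x (t : n.-tuple T) :
  affT eps c (tuple_consp (x, t)) =
  tuple_consp (eps * x + c ord0, affT eps (fun i => c (lift ord0 i)) t).
Proof.
apply: eq_from_tnth => i; rewrite tnth_mktuple.
case: (unliftP ord0 i) => [j ->|->]; last by rewrite !tnth0.
by rewrite !tnthS tnth_mktuple.
Qed.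

Lemma ge0_integral_affT n (eps : R) (c : 'I_n -> R) (f : n.-tuple T -> \bar R) :
  eps = 1 \/ eps = -1 -> measurable_fun setT f -> (forall x, 0 <= f x)%E ->
  (\int[mu n]_t f (affT eps c t) = \int[mu n]_t f t)%E.
Proof.
move=> He; elim: n c f => [|n IH] c f mf f0.
  by apply: eq_integral => t _; congr f; rewrite (tuple0 t) (tuple0 (affT _ _ _)).
have mconsp (x : T) : measurable_fun setT (fun t : n.-tuple T => tuple_consp (x, t)).
  apply: measurableT_comp; first exact: measurable_tuple_consp.
  exact: measurable_pair1.
rewrite !integral_power_step//; last by apply: measurableT_comp => //; exact: measurable_affT.
pose F (x : T) := (\int[mu n]_t f (tuple_consp (x, t)))%E.
transitivity (\int[leb]_x F (eps * x + c ord0)%R)%E.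
  apply: eq_integral => x _; rewrite /F.
  under eq_integral do rewrite affT_consp.
  apply: (IH (fun i => c (lift ord0 i)) (fun t => f (tuple_consp (eps * x + c ord0, t)))) => //.
  exact: measurableT_comp (mconsp _).
apply: ge0_integral_affine => //; last by move=> x; apply: integral_ge0.
apply: (@measurable_fun_fubini_tonelli_F _ _ _ _ _ (mu n) (f \o (@tuple_consp _ T n))) => //;
  last by move=> p; exact: f0.
apply: measurableT_comp => //; exact: measurable_tuple_consp.
Qed.

Lemma integral_affT n (eps : R) (c : 'I_n -> R) (f : n.-tuple T -> \bar R) :
  eps = 1 \/ eps = -1 -> measurable_fun setT f ->
  (\int[mu n]_t f (affT eps c t) = \int[mu n]_t f t)%E.
Proof.
move=> He mf; rewrite [LHS]integralE [RHS]integralE; congr (_ - _)%E.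
  rewrite -[RHS](ge0_integral_affT c He); first by apply: eq_integral => t _; rewrite ?funeposE ?funenegE.
  - exact: measurable_funepos.
  - by [].
rewrite -[RHS](ge0_integral_affT c He); first by apply: eq_integral => t _; rewrite ?funeposE ?funenegE.
- exact: measurable_funeneg.
- by [].
Qed.

Definition cube n (r : R) : set (n.-tuple T) := [set t | forall i, `|tnth t i| <= r].
Arguments cube : clear implicits.

Lemma measurable_cube n r : measurable (cube n r).
Proof.
rewrite (_ : cube n r = \bigcap_(i in [set: 'I_n]) ((fun t : n.-tuple T => tnth t i) @^-1` `[- r, r])).
  apply: fin_bigcap_measurable => [|i _]; first exact: finite_finset.
  rewrite -[X in measurable X]setTI; exact: measurable_tnth.
apply/seteqP; split=> t /= H i; first by move=> _ /=; rewrite in_itv /= -ler_norml.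
by have := H i I; rewrite /= in_itv /= -ler_norml.
Qed.

Lemma measure_cube n r : 0 <= r -> mu n (cube n r) = ((2 * r) ^+ n)%:E.
Proof.
move=> r0; elim: n => [|n IH].
  by rewrite expr0 /= diracE mem_set// => -[].
transitivity ((leb \x mu n)%E (`[- r, r] `*` cube n r)).
  rewrite -[LHS]/((leb \x mu n)%E (@tuple_consp _ T n @^-1` cube n.+1 r)).
  suff -> : @tuple_consp _ T n @^-1` cube n.+1 r = `[- r, r] `*` cube n r by [].
  apply/seteqP; split=> -[x t] /=.
    move=> H; split; first by have := H ord0; rewrite tnth0 /= in_itv /= -ler_norml.
    by move=> i; have := H (lift ord0 i); rewrite tnthS.
  move=> [/= xr tr] i; case: (unliftP ord0 i) => [j ->|->]; last first.
    by rewrite tnth0; move: xr; rewrite in_itv /= -ler_norml.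
  by rewrite tnthS.
rewrite product_measure1E//; last exact: measurable_cube.
have e : leb `[- r, r]%classic = (2 * r)%:E.
  rewrite lebesgue_measure_itv /= lte_fin.
  case: ltP => rr; first by rewrite -EFinB; congr EFin; ring.
  by have -> : r = 0; [lra|rewrite mulr0].
transitivity ((2 * r)%:E * ((2 * r) ^+ n)%:E)%E; last by rewrite -EFinM exprS.
by rewrite -e -IH.
Qed.

End TupleMeasure.
Arguments cube {R} n r.

(** * Measurability of functions on row vectors *)

Section IntegralRV.
Context {R : realType} {n : nat}.
Local Notation E := 'rV[R]_n.
Local Notation T := (measurableTypeR R).
Implicit Types (phi chi k : E -> R) (i : 'I_n) (x y : E).

Definition rowT (t : n.-tuple T) : E := \row_i tnth t i.

Definition meas (g : E -> R) := measurable_fun [set: n.-tuple T] (fun t => g (rowT t)).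

Lemma rowT_norm_le (t : n.-tuple T) (r : R) : 0 <= r -> (`|rowT t| <= r) <-> cube n r t.
Proof.
move=> r0; split=> [tr i|H].
  by have := le_trans (coord_le_norm (rowT t) i) tr; rewrite mxE.
by apply: le_mx_norm => // i; rewrite mxE; exact: H.
Qed.

(** A continuous function is the pointwise limit of functions constant on the
    cells of a grid of mesh 1/(m+1), and those take countably many values on
    measurable cells. *)
Lemma meas_continuous phi : continuous phi -> meas phi.
Proof.
move=> cp.
pose d (m : nat) (t : n.-tuple T) : {ffun 'I_n -> int} :=
  [ffun i => Num.floor (m.+1%:R * tnth t i)].
pose p (m : nat) (f : {ffun 'I_n -> int}) : E := \row_i ((f i)%:~R / m.+1%:R).
apply: (@measurable_fun_cvg _ _ _ _ (fun m t => phi (p m (d m t)))); last first.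
  move=> t _; apply/cvgrPdist_le => eps eps0.
  have /cvgrPdist_le/(_ _ eps0) := cp (rowT t).
  move=> /nbhs_normP[r /= r0 Hr].
  near=> m; apply: Hr => /=.
  apply: (@le_lt_trans _ _ (m.+1%:R^-1)); last first.
    by near: m; exact: near_infty_natSinv_lt (PosNum r0).
  apply: le_mx_norm => // i; rewrite !mxE ffunE.
  have m0 : 0 < (m.+1%:R : R) by rewrite ltr0n.
  have := floor_itv (m.+1%:R * tnth t i); rewrite intrD => /andP[h1 h2].
  rewrite -(ler_pM2l m0) divff ?gt_eqF// -{1}(gtr0_norm m0) -normrM mulrBr mulrCA divff ?gt_eqF// mulr1.
  by rewrite ger0_norm ?subr_ge0// lerBlDl ltW.
move=> m; rewrite -[X in measurable_fun _ X]/((phi \o p m) \o d m).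
have md (f : {ffun 'I_n -> int}) : measurable [set t | d m t = f].
  have -> : [set t | d m t = f] = \bigcap_(i in [set: 'I_n])
      ((fun t : n.-tuple T => m.+1%:R * tnth t i) @^-1` `[(f i)%:~R, (f i + 1)%:~R[).
    apply/seteqP; split=> t /=.
      by move=> <- i _ /=; rewrite in_itv /= ffunE; exact: floor_itv.
    move=> H; apply/ffunP => i; rewrite ffunE; apply: floor_def.
    by have := H i I; rewrite /= in_itv.
  apply: fin_bigcap_measurable => [|i _]; first exact: finite_finset.
  rewrite -[X in measurable X]setTI.
  have mf : measurable_fun setT (fun t : n.-tuple T => m.+1%:R * tnth t i : T).
    by apply: measurable_funM => //; exact: measurable_tnth.
  exact: mf.
move=> _ Y mY; rewrite setTI.
have -> : ((phi \o p m) \o d m) @^-1` Y = \bigcup_f [set t | d m t = f /\ Y (phi (p m f))].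
  by apply/seteqP; split=> t /=; [move=> H; exists (d m t)|move=> [f _ [<-]]].
apply: countable_bigcupT_measurable; first exact: countableP.
move=> f; have [Yf|Yf] := pselect (Y (phi (p m f))).
  rewrite (_ : [set _ | _] = [set t | d m t = f]); first exact: md.
  by apply/seteqP; split=> t /=; [case|].
by rewrite (_ : [set _ | _] = set0)//; apply/seteqP; split=> t //= -[].
Unshelve. all: by end_near. Qed.

End IntegralRV.

(** * Convolution *)

Section Convolution.
Context {R : realType} {n : nat}.
Local Notation E := 'rV[R]_n.
Local Notation leb := (@lebesgue_measure R).
Local Notation T := (measurableTypeR R).
Local Notation mu := (power_measure leb n).
Implicit Types (phi chi k : E -> R) (i : 'I_n) (x y : E).

Definition L1 (g : E -> R) := L1mu mu (fun t => g (rowT t)).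

Lemma L1_meas g : L1 g -> meas g.
Proof. exact: L1mu_meas. Qed.

Lemma eq_integral_rV (f g : E -> R) : (forall x, f x = g x) -> integral_rV f = integral_rV g.
Proof. by move=> fg; apply: eq_Rintegral => t _; exact: fg. Qed.

Lemma integral_rV_affine (eps : R) (c : E) (g : E -> R) : eps = 1 \/ eps = -1 ->
  meas g -> integral_rV (fun x => g (eps *: x + c)) = integral_rV g.
Proof.
move=> He mg.
have e (t : n.-tuple T) : eps *: rowT t + c = rowT (affT eps (fun i => c 0 i) t).
  by apply/rowP => i; rewrite !mxE tnth_mktuple.
rewrite /integral_rV /Rintegral; congr fine.
transitivity (\int[mu]_t (g (rowT (affT eps (fun i => c 0 i) t)))%:E)%E.
  by apply: eq_integral => t _; rewrite -e.
apply: (integral_affT (fun i => c 0 i) He (f := fun t => (g (rowT t))%:E)).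
exact/measurable_EFinP.
Qed.

Lemma meas_ball (r : R) : meas (fun x : E => (`|x| <= r)%R%:R : R).
Proof.
apply: (@measurableT_comp _ _ _ _ _ _ (fun b : bool => b%:R : R)) => //.
apply: measurable_fun_ler => //.
by apply: meas_continuous => x; exact: norm_continuous.
Qed.

Lemma L1_ball (r : R) : L1 (fun x : E => (`|x| <= r)%R%:R : R).
Proof.
have [r0|r0] := leP 0 r; last first.
  rewrite (_ : (fun _ => _) = fun=> 0); first exact: integrable0.
  apply/funext => x; rewrite (_ : (_ <= _) = false)//.
  by apply/negbTE; rewrite -ltNge (lt_le_trans r0).
have -> : (fun x : E => (`|x| <= r)%R%:R) = (fun x => \1_[set x : E | `|x| <= r] x) :> (E -> R).
  by apply/funext => x; rewrite indicE mem_setE.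
rewrite /L1 /L1mu (_ : (fun _ => _) = \1_(cube n r)).
  have mc := @measurable_cube R n r.
  apply/integrableP; split; first exact/measurable_EFinP.
  rewrite (eq_integral (fun t => (\1_(cube n r) t)%:E)); last first.
    by move=> t _; rewrite gee0_abs// lee_fin.
  by rewrite integral_indic// setIT [ltLHS](measure_cube _ r0) ltry.
apply/funext => t; rewrite !indicE; congr (nat_of_bool _)%:R.
by apply/idP/idP => /set_mem H; apply/mem_set; apply/rowT_norm_le.
Qed.

Lemma integral_ball (r : R) : 0 <= r -> integral_rV (fun x : E => (`|x| <= r)%R%:R) = (2 * r) ^+ n.
Proof.
move=> r0; transitivity (fine (\int[mu]_t (\1_(cube n r) t)%:E)).
  congr fine; apply: eq_integral => t _; congr ((nat_of_bool _)%:R)%:E.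
  by apply/idP/idP => [H|/set_mem H]; [apply/mem_set|]; apply/rowT_norm_le.
rewrite integral_indic//; last exact: measurable_cube.
by rewrite setIT [X in fine X](measure_cube _ r0).
Qed.

Lemma L1_bounded g (B r : R) : meas g -> 0 <= B -> (forall x, `|g x| <= B) ->
  (forall x, r < `|x| -> g x = 0) -> L1 g.
Proof.
move=> mg B0 gB gr.
apply: (L1mu_le (L1muZ B (L1_ball r))) => // t.
rewrite normrM (ger0_norm B0); have [tr|tr] := leP `|rowT t| r.
  by rewrite normr1 mulr1.
by rewrite gr// normr0 mulr_ge0.
Qed.

Definition supported (r : R) (g : E -> R) := forall x, r < `|x| -> g x = 0.

Lemma L1_test phi r : continuous phi -> supported r phi -> L1 phi.
Proof.
move=> cp pr; have [B B0 HB] := continuous_bounded_ball r cp.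
apply: (L1_bounded (B := B) (r := r)) => //; first exact: meas_continuous.
by move=> x; have [xr|xr] := leP `|x| r; [exact: HB|rewrite pr// normr0].
Qed.

Definition L1loc k := meas k /\ forall r, L1 (fun x => k x * (`|x| <= r)%R%:R).

(** The convolution converges and is smooth when one of its factors has compact
    support. *)
Definition admissible k phi := (L1loc k /\ exists r, supported r phi) \/
  (L1 k /\ exists r, supported r k).

Definition conv k phi y := integral_rV (fun x => k x * phi (x + y)).

Let sh (t : n.-tuple T) (y : E) := rowT t + y.
Let one (i : 'I_n) (t : n.-tuple T) : R := 1.

Let sh_meas phi y : continuous phi -> measurable_fun setT (fun t => phi (sh t y)).
Proof.
move=> cp; apply: (@meas_continuous _ _ (fun x => phi (x + y))) => x.
apply: (@continuous_comp _ _ _ (fun x => x + y) phi); last exact: cp.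
by apply: continuousD => //; exact: cst_continuous.
Qed.

Let sh_lip t y y' : `|sh t y - sh t y'| <= `|y - y'|.
Proof. by rewrite /sh opprD addrACA subrr add0r. Qed.

Let one_meas i : measurable_fun setT (one i).
Proof. exact: measurable_cst. Qed.

Let one_le1 i t : `|one i t| <= 1.
Proof. by rewrite normr1. Qed.

Let sh_line t i (h : R) y : sh t (h *: delta_mx 0 i + y) = (h * one i t) *: delta_mx 0 i + sh t y.
Proof. by rewrite /sh /one mulr1 addrCA. Qed.

Lemma admissible_dominated k phi : admissible k phi ->
  dominated mu sh (fun t => k (rowT t)) phi.
Proof.
move=> [[[mk kL] [r pr]]|[kL [r kr]]] M.
  exists (fun t => k (rowT t) * (`|rowT t| <= r + M)%R%:R), (r + M + M); split.
  - exact: kL.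
  - move=> t y yM; rewrite mulf_eq0 negb_or => /andP[_].
    have [tM|tM] := leP `|rowT t| (r + M); last by rewrite eqxx.
    by move=> _; rewrite /sh (le_trans (ler_normD _ _))// lerD.
  - move=> t y s yM; have [tM|tM] := leP `|rowT t| (r + M); first by rewrite mulr1.
    rewrite mulr0 mul0r (@partials_far0 _ _ _ _ r) ?mulr0// /sh.
    rewrite (lt_le_trans _ (lerB_normD _ _))// ltrBrDr (le_lt_trans _ tM)//.
    by rewrite lerD2l.
exists (fun t => k (rowT t)), (r + M); split=> // t y yM k0.
rewrite /sh (le_trans (ler_normD _ _))// lerD//.
by have [//|/kr e] := leP `|rowT t| r; move: k0; rewrite e eqxx.
Qed.

Lemma admissible_partial k phi i : admissible k phi -> admissible k (partial i phi).
Proof.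
case=> [[kL [r pr]]|H]; [left|by right]; split=> //.
by exists r; exact: partial_far0.
Qed.

Lemma admissible_partials k phi s : admissible k phi -> admissible k (partials s phi).
Proof. by move=> H; elim: s => //= i s; exact: admissible_partial. Qed.

Lemma conv_L1 k phi y : Coo phi -> admissible k phi -> L1 (fun x => k x * phi (x + y)).
Proof.
move=> cp /admissible_dominated dk; exact: (avg_L1 sh_meas y cp dk).
Qed.

Lemma Coo_conv k phi : Coo phi -> admissible k phi -> Coo (conv k phi).
Proof.
move=> cp /admissible_dominated dk.
exact: (Coo_avg sh_meas sh_lip one_meas one_le1 sh_line cp dk).
Qed.

Lemma partial_conv k phi i : Coo phi -> admissible k phi ->
  partial i (conv k phi) = conv k (partial i phi).
Proof.
move=> cp /admissible_dominated dk.
rewrite [LHS](partial_avg sh_meas one_meas one_le1 sh_line i cp dk).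
by apply/funext => y; apply: eq_Rintegral => t _; rewrite /one mulr1.
Qed.

Lemma partials_conv k phi s : Coo phi -> admissible k phi ->
  partials s (conv k phi) = conv k (partials s phi).
Proof.
move=> cp ak; elim: s => //= i s ->; apply: partial_conv; first exact: Coo_partials.
exact: admissible_partials.
Qed.

Lemma conv_shift k phi (c : E) y : conv k (fun x => phi (x + c)) y = conv k phi (y + c).
Proof. by apply: eq_integral_rV => x; rewrite addrA. Qed.

Lemma convD k phi chi y : L1 (fun x => k x * phi (x + y)) -> L1 (fun x => k x * chi (x + y)) ->
  conv k (fun x => phi x + chi x) y = conv k phi y + conv k chi y.
Proof.
move=> h1 h2; rewrite /conv /integral_rV -RintegralD//.
by apply: eq_Rintegral => t _; rewrite mulrDr.
Qed.

Lemma convZ k phi (b : R) y : L1 (fun x => k x * phi (x + y)) ->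
  conv k (fun x => b * phi x) y = b * conv k phi y.
Proof.
move=> h1; rewrite /conv /integral_rV -RintegralZl//.
by apply: eq_Rintegral => t _; rewrite mulrCA.
Qed.

(** Convolution with 1 gives a constant function by translation invariance, and
    its derivative is the integral in question. *)
Lemma integral_partial phi i r : Coo phi -> supported r phi ->
  integral_rV (partial i phi) = 0.
Proof.
move=> cp pr.
have ak : admissible (fun=> 1) phi.
  left; split; last by exists r.
  split; first exact: measurable_cst.
  move=> s; rewrite (_ : (fun _ => _) = fun x : E => (`|x| <= s)%R%:R); first exact: L1_ball.
  by apply/funext => x; rewrite mul1r.
have e : conv (fun=> 1) phi = fun=> integral_rV phi.
  apply/funext => y.
  rewrite -(integral_rV_affine y (or_introl (erefl 1)) (meas_continuous (Coo_continuous cp))).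
  by apply: eq_integral_rV => x; rewrite mul1r scale1r.
have := partial_conv i cp ak; rewrite e partial_cst => /(congr1 (fun f => f 0)) ->.
by apply: eq_integral_rV => x; rewrite mul1r addr0.
Qed.

Lemma integral_by_parts phi chi i r : Coo phi -> Coo chi -> supported r phi ->
  integral_rV (fun x => partial i phi x * chi x) = - integral_rV (fun x => phi x * partial i chi x).
Proof.
move=> cp cc pr.
have cpc := CooM cp cc.
have spc : supported r (fun x => phi x * chi x) by move=> x xr; rewrite pr// mul0r.
have := integral_partial i cpc spc.
rewrite (eq_integral_rV (g := fun x => partial i phi x * chi x + phi x * partial i chi x)); last first.
  by move=> x; rewrite partialM//; exact: Coo_derivable.
rewrite /integral_rV RintegralD//.
- by move/eqP; rewrite addr_eq0 => /eqP.
- apply: (@L1_test (fun x => _ x * _ x) r); first by apply/Coo_continuous/CooM => //; exact: Coo_partial.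
  by move=> x xr; rewrite (partial_far0 _ pr)// mul0r.
- apply: (@L1_test (fun x => _ x * _ x) r); first by apply/Coo_continuous/CooM => //; exact: Coo_partial.
  by move=> x xr; rewrite pr// mul0r.
Qed.

End Convolution.

(** * Local integrability of the Riesz kernel *)

Section Kernel.
Context {R : realType} {n : nat}.
Local Notation E := 'rV[R]_n.
Local Notation leb := (@lebesgue_measure R).
Local Notation T := (measurableTypeR R).
Local Notation mu := (power_measure leb n).
Implicit Types (phi chi k : E -> R) (i l : 'I_n) (x y : E).

Lemma meas_norm : meas (fun x : E => `|x|).
Proof. by apply: meas_continuous => x; exact: norm_continuous. Qed.

Lemma meas_inv (g : E -> R) : (forall x, 0 <= g x) -> meas g -> meas (fun x => (g x)^-1).
Proof.
move=> g0 mg; rewrite /meas (_ : (fun _ => _) = (fun s => s `^ (-1)) \o (fun t => g (rowT t))).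
  by apply: measurableT_comp => //; exact: measurable_powR.
by apply/funext => t /=; rewrite powR_inv1.
Qed.

Lemma dyadic_layer (r s : R) : 0 < s -> s <= r ->
  exists j : nat, s <= r / 2 ^+ j /\ r / 2 ^+ j.+1 < s.
Proof.
move=> s0 sr; have r0 : 0 < r by exact: lt_le_trans sr.
have P2 m : 0 < (2 ^+ m : R) by rewrite exprn_gt0.
have ex : exists m, r / 2 ^+ m < s.
  exists (Num.truncn (r / s)).+1.
  rewrite ltr_pdivrMr// mulrC -ltr_pdivrMr//.
  apply: lt_trans (truncnS_gt _) _.
  by rewrite -natrX ltr_nat ltn_expl.
have [[|m] Hm Hmin] := ex_minnP ex.
  by move: Hm; rewrite expr0 divr1 ltNge sr.
exists m; split=> //; rewrite leNgt; apply/negP => H.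
by have := Hmin _ H; rewrite ltnn.
Qed.

(** A majorant of the kernels in terms of the sup norm, whose balls are cubes. *)
Definition riesz (d : nat) x : R := (`|x|^-1) ^+ d.

Lemma riesz_ge0 d x : 0 <= riesz d x.
Proof. by rewrite exprn_ge0// invr_ge0. Qed.

Lemma meas_riesz d : meas (riesz d).
Proof.
by apply: measurable_funX; apply: meas_inv => //; exact: meas_norm.
Qed.

(** On the dyadic layer between radii r / 2^(j+1) and r / 2^j the kernel is at
    most (2^(j+1) / r)^(n-1), and the cube of radius r / 2^j has measure
    (2 r / 2^j)^n: the contributions decay like 2^(-j). *)
Lemma L1loc_riesz : (0 < n.-1)%N -> L1loc (riesz n.-1).
Proof.
move=> n0; split; first exact: meas_riesz.
move=> r0.
suff H r : 0 < r -> L1 (fun x => riesz n.-1 x * (`|x| <= r)%R%:R).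
  apply: (L1mu_le (H (Num.max r0 1) _)); first by rewrite lt_max ltr01 orbT.
    by apply: measurable_funM; [exact: meas_riesz|exact: meas_ball].
  move=> t; rewrite !normrM ler_wpM2l//.
  have [t0|t0] := leP `|rowT t| r0; last by rewrite normr0.
  by rewrite (_ : (`|rowT t| <= _) = true)// le_max t0.
move=> r_gt0.
pose a (j : nat) : R := ((2 ^+ j.+1) / r) ^+ n.-1.
have a0 j : 0 <= a j by rewrite exprn_ge0// divr_ge0 ?exprn_ge0// ltW.
have P2 m : 0 < (2 ^+ m : R) by rewrite exprn_gt0.
pose F (j : nat) (t : n.-tuple T) : \bar R := (a j * \1_(cube n (r / 2 ^+ j)) t)%:E.
have rj0 j : 0 <= r / 2 ^+ j by rewrite divr_ge0// ltW.
have F0 j t : (0 <= F j t)%E by rewrite lee_fin mulr_ge0.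
have mF j : measurable_fun setT (F j).
  apply/measurable_EFinP/measurable_funM => //.
  by apply: measurable_indic; exact: measurable_cube.
have mg : measurable_fun setT (fun t => riesz n.-1 (rowT t) * (`|rowT t| <= r)%R%:R).
  by apply: measurable_funM; [exact: meas_riesz|exact: meas_ball].
apply/integrableP; split; first exact/measurable_EFinP.
pose C : R := (2 / r) ^+ n.-1 * (2 * r) ^+ n.
have IF j : (\int[mu]_t F j t = (C / 2 ^+ j)%:E)%E.
  rewrite /F; under eq_integral do rewrite EFinM.
  rewrite ge0_integralZl//; [|by apply/measurable_EFinP; apply: measurable_indic; exact: measurable_cube|by rewrite lee_fin].
  rewrite integral_indic//; last exact: measurable_cube.
  rewrite setIT [X in (_ * X)%E](measure_cube _ (rj0 j)) -EFinM; congr EFin.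
  have npos : (0 < n)%N by apply: leq_trans n0 (leq_pred n).
  have En (z : R) : z ^+ n = z * z ^+ n.-1 by rewrite -exprS prednK.
  rewrite /a /C !En; set m := n.-1.
  have P0 := P2 j; have r_n0 : r != 0 by rewrite gt_eqF.
  have -> : (2 ^+ j.+1 / r) = (2 / r) * 2 ^+ j by rewrite exprS; ring.
  have -> : 2 * (r / 2 ^+ j) = (2 * r) * (2 ^+ j)^-1 by rewrite mulrA.
  rewrite !exprMn !exprVn; set A := (2 ^+ j) ^+ m; set B := r ^+ m.
  have A0 : A != 0 by rewrite expf_neq0// gt_eqF.
  have B0 : B != 0 by rewrite expf_neq0.
  by field; rewrite ?A0 ?B0 ?r_n0 ?gt_eqF.
apply: (@le_lt_trans _ _ (\int[mu]_t (\sum_(j <oo) F j t))%E).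
  apply: ge0_le_integral => //.
  - by apply: measurableT_comp => //; exact/measurable_EFinP.
  - by apply: ge0_emeasurable_sum => [k x _ _|k _]; [exact: F0|exact: mF].
  - move=> t _ /=; rewrite normrM (ger0_norm (riesz_ge0 _ _)).
    have [tr|tr] := leP `|rowT t| r; last by rewrite normr0 mulr0 nneseries_ge0.
    rewrite normr1 mulr1.
    have [->|x0] := eqVneq (rowT t) 0.
      by rewrite /riesz normr0 invr0 expr0n gtn_eqF// nneseries_ge0.
    have tpos : 0 < `|rowT t| by rewrite normr_gt0.
    have [j [h1 h2]] := dyadic_layer tpos tr.
    apply: (@le_trans _ _ (F j t)).
      rewrite lee_fin indicE mem_set ?mulr1; last exact/rowT_norm_le.
      have ra : 0 <= 2 ^+ j.+1 / r by rewrite divr_ge0 ?(ltW (P2 _)) ?ltW.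
      apply: lerXn2r; rewrite ?nnegrE ?invr_ge0//.
      by rewrite -[leRHS]invrK lef_pV2 ?posrE ?invr_gt0 ?divr_gt0 ?normr_gt0// invf_div ltW.
    apply: le_trans (@nneseries_lim_ge _ (F^~ t) xpredT 0%N j.+1 _) => //.
    by rewrite big_nat_recr//= leeDr// sume_ge0.
rewrite integral_nneseries//.
apply: (@le_lt_trans _ _ (2 * C)%:E); last exact: ltry.
apply: lime_le; first by apply: is_cvg_nneseries => m _ _; apply: integral_ge0.
apply: nearW => N.
have -> : (\sum_(0 <= i < N) \int[mu]_t F i t = (2 * C - 2 * C / 2 ^+ N)%:E)%E.
  elim: N => [|N IH]; first by rewrite big_nil expr0 divr1 subrr.
  rewrite big_nat_recr//= IH IF -EFinD exprS; congr EFin.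
  by field; rewrite gt_eqF.
rewrite lee_fin gerBl divr_ge0 ?(ltW (P2 _))// mulr_ge0// mulr_ge0// exprn_ge0//.
  by rewrite divr_ge0// ltW.
by rewrite mulr_ge0// ltW.
Qed.

End Kernel.

(** * The exterior derivative of the kernel of the normal operator *)

Section KernelIdentity.
Context {R : realType} {n : nat}.
Local Notation E := 'rV[R]_n.
Local Notation leb := (@lebesgue_measure R).
Local Notation T := (measurableTypeR R).
Local Notation mu := (power_measure leb n).
Implicit Types (phi chi k : E -> R) (i j l : 'I_n) (x y : E).

Definition normsq x : R := \sum_(i < n) x 0 i ^+ 2.

Lemma normsq_ge0 x : 0 <= normsq x.
Proof. by apply: sumr_ge0 => i _; exact: sqr_ge0. Qed.

Lemma coord_sq_le x i : x 0 i ^+ 2 <= normsq x.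
Proof.
by rewrite /normsq (bigD1 i)//= lerDl sumr_ge0// => j _; exact: sqr_ge0.
Qed.

Lemma norm_le_euclid x : `|x| <= Num.sqrt (normsq x).
Proof.
apply: le_mx_norm => [|i]; first exact: sqrtr_ge0.
by rewrite -sqrtr_sqr ler_sqrt ?normsq_ge0// coord_sq_le.
Qed.

Lemma euclid_le_norm x : normsq x <= n%:R * `|x| ^+ 2.
Proof.
apply: (@le_trans _ _ (\sum_(i < n) `|x| ^+ 2)).
  apply: ler_sum => i _.
  by rewrite -[leLHS]ger0_norm ?sqr_ge0// normrX lerXn2r ?nnegrE// coord_le_norm.
by rewrite sumr_const card_ord mulr_natl.
Qed.

Lemma Coo_normsq : Coo normsq.
Proof. by apply: Coo_sum => i; apply: CooX; exact: Coo_coord. Qed.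

Lemma is_derive_pow (f : E -> R) m x (v : E) (df : R) : is_derive x v f df ->
  is_derive x v (fun y => f y ^+ m) (m%:R * f x ^+ m.-1 * df).
Proof.
move=> dfx; have := is_deriveX m dfx.
by rewrite (_ : f ^+ m = fun y => f y ^+ m)//; apply/funext => y; rewrite exprfctE.
Qed.

Lemma is_derive_bigsum (I : Type) (r : seq I) (F : I -> E -> R) x (v : E) (dF : I -> R) :
  (forall a, is_derive x v (F a) (dF a)) ->
  is_derive x v (fun y => \sum_(a <- r) F a y) (\sum_(a <- r) dF a).
Proof.
move=> dFk; elim: r => [|a r IH].
  rewrite big_nil (_ : (fun _ => _) = cst 0); first exact: is_derive_cst.
  by apply/funext => y; rewrite big_nil.
rewrite big_cons (_ : (fun _ => _) = F a + (fun y => \sum_(a <- r) F a y)).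
  exact: is_deriveD.
by apply/funext => y; rewrite big_cons.
Qed.

Lemma partial_normsq i x : partial i normsq x = 2 * x 0 i.
Proof.
apply: partial_is_derive.
have h j : is_derive x (delta_mx 0 i) (fun y : E => y 0 j ^+ 2) (2 * x 0 j * (i == j)%:R).
  have dj := coord_is_derive j x (delta_mx 0 i); rewrite mxE eqxx /= in dj.
  by apply: (is_derive_eq (is_derive_pow 2 dj)); rewrite expr1 eq_sym.
apply: (is_derive_eq (is_derive_bigsum (index_enum 'I_n) h)).
rewrite (bigD1 i)//= eqxx mulr1 big1 ?addr0// => j ji.
by rewrite eq_sym (negbTE ji) mulr0.
Qed.

(** The function 1/|x| with |x|^2 replaced by |x|^2 + eps, smooth for eps > 0.
    Only with eps = 0, where it vanishes at the origin by convention, does it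
    give the kernels themselves. *)
Definition reg (eps : R) x : R := (Num.sqrt (normsq x + eps))^-1.

Lemma Coo_reg (eps : R) : 0 < eps -> Coo (reg eps).
Proof.
move=> e0; apply: Coo_invsqrt; first by apply: CooD; [exact: Coo_normsq|exact: Coo_cst].
by move=> x; rewrite ltr_wpDl ?normsq_ge0.
Qed.

Lemma reg_ge0 eps x : 0 <= reg eps x.
Proof. by rewrite invr_ge0 sqrtr_ge0. Qed.

Lemma reg_is_derive (eps : R) m i x : 0 < eps ->
  is_derive x (delta_mx 0 i) (fun y => reg eps y ^+ m)
    (- m%:R * x 0 i * reg eps x ^+ m.+2).
Proof.
move=> e0; have q0 : 0 < normsq x + eps by rewrite ltr_wpDl ?normsq_ge0.
have s0 : Num.sqrt (normsq x + eps) != 0 by rewrite sqrtr_eq0 -ltNge.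
have dq : is_derive x (delta_mx 0 i) (fun y => normsq y + eps) (2 * x 0 i).
  have h1 : is_derive x (delta_mx 0 i) normsq (2 * x 0 i).
    by rewrite -partial_normsq; apply: Coo_is_derive; exact: Coo_normsq.
  have := is_deriveD h1 (is_derive_cst eps x (delta_mx 0 i)).
  by move=> H; apply: (is_derive_eq H); rewrite addr0.
have ds := is_derive_comp1 (is_derive1_sqrt q0) dq.
have dp := is_derive_comp1 (is_derive_inv1 s0) ds.
apply: (is_derive_eq (is_derive_pow m dp)).
rewrite /reg; case: m => [|m]; first by rewrite !mul0r oppr0 !mul0r.
by rewrite /= !exprS; set w := _ ^+ m; field; rewrite s0.
Qed.

Lemma reg_le eps x : 0 <= eps -> x != 0 -> reg eps x <= `|x|^-1.
Proof.
move=> e0 x0; have xp : 0 < `|x| by rewrite normr_gt0.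
have h : `|x| <= Num.sqrt (normsq x + eps).
  apply: le_trans (norm_le_euclid x) _.
  by rewrite ler_sqrt ?addr_ge0 ?normsq_ge0// lerDl.
by rewrite lef_pV2// posrE// (lt_le_trans xp).
Qed.

Lemma reg_riesz_le eps x d : 0 <= eps -> x != 0 -> reg eps x ^+ d <= riesz d x.
Proof.
by move=> e0 x0; rewrite /riesz lerXn2r ?nnegrE ?reg_ge0 ?invr_ge0// reg_le.
Qed.

Lemma reg_riesz_le2 eps x d j l : 0 <= eps -> x != 0 ->
  `|x 0 j * x 0 l * reg eps x ^+ d.+2| <= riesz d x.
Proof.
move=> e0 x0; have xp : 0 < `|x| by rewrite normr_gt0.
rewrite normrM [X in _ * X]ger0_norm ?exprn_ge0 ?reg_ge0// normrM.
apply: (@le_trans _ _ (`|x| * `|x| * riesz d.+2 x)).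
  apply: ler_pM; [by rewrite mulr_ge0|by rewrite exprn_ge0 ?reg_ge0| |exact: reg_riesz_le].
  by apply: ler_pM; rewrite ?coord_le_norm.
rewrite /riesz !exprS; set w := _ ^+ d.
by rewrite -mulrA !mulVKf ?gt_eqF.
Qed.

Definition scalar_kernel x : R := reg 0 x ^+ n.-1.

Lemma reg0E x : reg 0 x = (euclidean_norm x)^-1.
Proof. by rewrite /reg addr0. Qed.

Lemma xray_kernelE i j x : xray_kernel i j x = 2 * (x 0 i * x 0 j * reg 0 x ^+ n.+1).
Proof. by rewrite /xray_kernel -exprVn -reg0E -!mulrA. Qed.

Lemma meas_coord i : meas (fun x : E => x 0 i).
Proof. by apply: meas_continuous; apply: Coo_continuous; exact: Coo_coord. Qed.

Lemma meas_reg eps : meas (reg eps).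
Proof.
apply: meas_inv => [x|]; first exact: sqrtr_ge0.
apply: (@meas_continuous _ _ (fun x => Num.sqrt (normsq x + eps))) => x.
apply: (@continuous_comp _ _ _ (fun x => normsq x + eps) (@Num.sqrt R)); last exact: sqrt_continuous.
by apply: Coo_continuous; apply: CooD; [exact: Coo_normsq|exact: Coo_cst].
Qed.

Lemma meas_scalar_kernel : meas scalar_kernel.
Proof. by apply: measurable_funX; exact: meas_reg. Qed.

Lemma meas_xray_kernel i j : meas (xray_kernel i j : E -> R).
Proof.
rewrite (_ : (xray_kernel i j : E -> R) = fun x => 2 * (x 0 i * x 0 j * reg 0 x ^+ n.+1)); last first.
  by apply/funext => x; exact: xray_kernelE.
apply: measurable_funM => //; apply: measurable_funM.
  by apply: measurable_funM; exact: meas_coord.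
by apply: measurable_funX; exact: meas_reg.
Qed.

Lemma integral_lin4 (c1 c2 c3 c4 : R) (F1 F2 F3 F4 : E -> R) :
  L1 F1 -> L1 F2 -> L1 F3 -> L1 F4 ->
  integral_rV (fun x => c1 * F1 x + c2 * F2 x + (c3 * F3 x + c4 * F4 x)) =
  c1 * integral_rV F1 + c2 * integral_rV F2 + (c3 * integral_rV F3 + c4 * integral_rV F4).
Proof.
move=> h1 h2 h3 h4; rewrite /integral_rV.
have z1 := L1muZ c1 h1; have z2 := L1muZ c2 h2; have z3 := L1muZ c3 h3; have z4 := L1muZ c4 h4.
rewrite RintegralD//; [|exact: L1muD z1 z2|exact: L1muD z3 z4].
rewrite RintegralD; [|by []|exact: z1|exact: z2].
rewrite RintegralD; [|by []|exact: z3|exact: z4].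
by rewrite !RintegralZl//.
Qed.

Hypothesis hn : (2 <= n)%N.

Let n1 : (0 < n.-1)%N.
Proof. by rewrite -ltnS prednK// ltnW. Qed.

Let nE : n.+1 = n.-1.+2.
Proof. by rewrite prednK// ltnW. Qed.

Lemma L1loc_le k (C : R) : meas k -> 0 <= C -> (forall x, `|k x| <= C * riesz n.-1 x) -> L1loc k.
Proof.
move=> mk C0 kC; split=> // r; have [_ /(_ r) rl] := L1loc_riesz (R := R) n1.
apply: (L1mu_le (L1muZ C rl)).
  by apply: measurable_funM => //; exact: meas_ball.
move=> t; rewrite mulrA !normrM ler_wpM2r// (le_trans (kC _))//.
by rewrite -normrM ler_norm.
Qed.

Lemma L1loc_scalar_kernel : L1loc scalar_kernel.
Proof.
apply: (@L1loc_le _ 1) => //; first exact: meas_scalar_kernel.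
move=> x; rewrite mul1r ger0_norm ?exprn_ge0 ?reg_ge0//.
have [->|x0] := eqVneq x 0; last exact: reg_riesz_le.
rewrite /scalar_kernel /reg (_ : normsq 0 = 0) ?addr0 ?sqrtr0 ?invr0; last first.
  by rewrite /normsq big1// => i _; rewrite mxE expr0n.
by rewrite expr0n gtn_eqF// riesz_ge0.
Qed.

Lemma L1loc_xray_kernel i j : L1loc (xray_kernel i j : E -> R).
Proof.
apply: (@L1loc_le _ 2) => //; first exact: meas_xray_kernel.
move=> x; rewrite xray_kernelE normrM (ger0_norm (ler0n _ 2)) ler_wpM2l//.
have [->|x0] := eqVneq x 0; first by rewrite !mxE !mul0r normr0 riesz_ge0.
by rewrite nE; exact: reg_riesz_le2.
Qed.

(** Dominated convergence away from the origin, which is a null cube. *)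
Lemma integral_limit_eq0 (G_ : nat -> E -> R) (G D : E -> R) :
  (forall m, meas (G_ m)) -> L1 G -> L1 D ->
  (forall m x, x != 0 -> `|G_ m x| <= D x) ->
  (forall x, x != 0 -> G_ ^~ x @ \oo --> G x) ->
  (forall m, integral_rV (G_ m) = 0) -> integral_rV G = 0.
Proof.
move=> mG GL DL GD GG I0.
have null : mu.-negligible [set t | rowT t = 0].
  exists (cube n 0); split; first exact: measurable_cube.
    rewrite [LHS](measure_cube _ (lexx 0)) mulr0 expr0n gtn_eqF//.
    exact: leq_trans hn.
  by move=> t /= t0; apply/rowT_norm_le => //; rewrite t0 normr0.
have ae_neq0 (P : n.-tuple T -> Prop) : (forall t, rowT t != 0 -> P t) -> {ae mu, forall t, P t}.
  move=> H; apply: (negligibleS _ null) => t /= Pt.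
  by apply/eqP; apply: contra_notT Pt => t0; exact: H.
have [_ _ cvI] : [/\ mu.-integrable setT (fun t => (G (rowT t))%:E),
  (fun m => \int[mu]_t `|(G_ m (rowT t))%:E - (G (rowT t))%:E|)%E @ \oo --> 0%E &
  (fun m => \int[mu]_t (G_ m (rowT t))%:E)%E @ \oo --> (\int[mu]_t (G (rowT t))%:E)%E].
  apply: (dominated_convergence measurableT (g := fun t => (D (rowT t))%:E)) => //.
  - by move=> m; apply/measurable_EFinP; exact: mG.
  - by apply/measurable_EFinP; exact: L1_meas.
  - apply: ae_neq0 => t t0 _; apply/fine_cvgP; split; first exact: nearW.
    exact: GG.
  - by apply: ae_neq0 => t t0 m _; rewrite /= lee_fin; exact: GD.
have GLm m : L1 (G_ m).
  have [N [mN N0 NP]] : {ae mu, forall t, `|G_ m (rowT t)| <= D (rowT t)} by apply: ae_neq0 => t; exact: GD.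
  have mGm : measurable_fun setT (fun t => (G_ m (rowT t))%:E) by apply/measurable_EFinP; exact: mG.
  apply/(negligible_integrable mN measurableT mGm N0).
  apply: (@le_integrable _ _ _ _ _ _ _ (fun t => (D (rowT t))%:E)).
  - exact: measurableD.
  - exact: measurable_funS mGm.
  - move=> t [_ Nt] /=; rewrite lee_fin (le_trans _ (ler_norm _))//.
    by apply: contrapT => H; apply: Nt; exact: NP.
  - by apply: integrableS DL => //; exact: measurableD.
have e m : (\int[mu]_t (G_ m (rowT t))%:E = 0)%E.
  rewrite -[LHS]fineK; first by congr EFin; exact: I0.
  exact: (integrable_fin_num measurableT (GLm m)).
have : (fun m => \int[mu]_t (G_ m (rowT t))%:E)%E @ \oo --> 0%E.
  by apply: cvg_near_cst; apply: nearW => m; exact: e.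
move=> cv0; have := @cvg_unique _ (@ereal_hausdorff R) _ _ _ _ cvI cv0.
by rewrite /integral_rV /Rintegral => ->.
Qed.

Variables (i j l : 'I_n) (phi : E -> R) (r : R).
Hypotheses (cphi : Coo phi) (sphi : supported r phi).

Let d (a b : 'I_n) : R := (a == b)%:R.

Let a x := 2 * n.-1%:R * (x 0 j * x 0 l * partial i phi x - x 0 i * x 0 l * partial j phi x).
Let b x := 2 * (d i l * partial j phi x - d j l * partial i phi x).

Let integrand (eps : R) x := a x * reg eps x ^+ n.+1 + b x * reg eps x ^+ n.-1.

(** Integration by parts reduces the claim to a pointwise identity. The term
    eps / (|x|^2 + eps) one could expect from the regularisation does not occur:
    the terms x_i x_j x_l of the two derivatives cancel, and the others only
    involve the power n+1 of [reg]. *)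
Lemma integral_integrand_eq0 (eps : R) : 0 < eps -> integral_rV (integrand eps) = 0.
Proof.
move=> e0.
have creg m : Coo (fun x => reg eps x ^+ m) by apply: CooX; exact: Coo_reg.
have dreg m s x := reg_is_derive m s x e0.
pose K s t x := x 0 s * x 0 t * reg eps x ^+ n.+1.
have cK s t : Coo (K s t) by apply: CooM => //; apply: CooM; exact: Coo_coord.
have dK s t q x : partial q (K s t) x = d q s * x 0 t * reg eps x ^+ n.+1
   + x 0 s * d q t * reg eps x ^+ n.+1
   - n.+1%:R * x 0 q * x 0 s * x 0 t * reg eps x ^+ n.+3.
  rewrite (partialM (phi := fun x => x 0 s * x 0 t) (chi := fun x => reg eps x ^+ n.+1)).
  - rewrite (partialM (phi := fun x => x 0 s) (chi := fun x => x 0 t)).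
    + by rewrite !partial_coord (partial_is_derive (dreg n.+1 q x)) /d; ring.
    + exact: Coo_derivable (Coo_coord s).
    + exact: Coo_derivable (Coo_coord t).
  - by apply: Coo_derivable; apply: CooM; exact: Coo_coord.
  - exact: Coo_derivable (creg _).
have dS q x : partial q (fun x => reg eps x ^+ n.-1) x = - n.-1%:R * x 0 q * reg eps x ^+ n.+1.
  by rewrite (partial_is_derive (dreg n.-1 q x)) nE.
have L (f g : E -> R) : Coo f -> Coo g -> supported r f -> L1 (fun x => f x * g x).
  move=> cf cg sf; apply: (@L1_test _ _ (fun x => f x * g x) r).
    by apply: Coo_continuous; exact: CooM.
  by move=> x xr; rewrite sf// mul0r.
have cpi s : Coo (partial s phi) by exact: Coo_partial.
have spi s : supported r (partial s phi) by exact: partial_far0.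
rewrite (eq_integral_rV (g := fun x =>
   (2 * n.-1%:R) * (partial i phi x * K j l x) + (- (2 * n.-1%:R)) * (partial j phi x * K i l x)
   + ((2 * d i l) * (partial j phi x * reg eps x ^+ n.-1)
   + (- (2 * d j l)) * (partial i phi x * reg eps x ^+ n.-1)))); last first.
  by move=> x; rewrite /integrand /a /b /K; ring.
rewrite integral_lin4; [|exact: L|exact: L|exact: L|exact: L].
have P s F : Coo F -> integral_rV (fun x => partial s phi x * F x) =
    - integral_rV (fun x => phi x * partial s F x).
  by move=> cF; exact: (integral_by_parts s cphi cF sphi).
rewrite (P i _ (cK j l)) (P j _ (cK i l)) (P j _ (creg n.-1)) (P i _ (creg n.-1)).
have L' s F : Coo F -> L1 (fun x => phi x * partial s F x).
  by move=> cF; apply: L => //; exact: Coo_partial.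
have S := integral_lin4 (2 * n.-1%:R) (- (2 * n.-1%:R)) (2 * d i l) (- (2 * d j l))
  (L' i _ (cK j l)) (L' j _ (cK i l)) (L' j _ (creg n.-1)) (L' i _ (creg n.-1)).
apply/eqP; rewrite -oppr_eq0; apply/eqP.
transitivity (integral_rV ((fun=> 0) : E -> R)); last first.
  by rewrite /integral_rV Rintegral_cst// mul0r.
rewrite [RHS](eq_integral_rV (g := fun x =>
   (2 * n.-1%:R) * (phi x * partial i (K j l) x) + (- (2 * n.-1%:R)) * (phi x * partial j (K i l) x)
   + ((2 * d i l) * (phi x * partial j (fun x => reg eps x ^+ n.-1) x)
   + (- (2 * d j l)) * (phi x * partial i (fun x => reg eps x ^+ n.-1) x)))).
  have alg (c1 c2 c3 I1 I2 I3 I4 : R) : - (c1 * (- I1) + (- c1) * (- I2) + (c2 * (- I3) + (- c3) * (- I4)))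
      = c1 * I1 + (- c1) * I2 + (c2 * I3 + (- c3) * I4) by ring.
  by rewrite S; exact: alg.
move=> x; rewrite !dK !dS /d !(eq_sym j i).
have -> : n.+1%:R = n.-1%:R + 2 :> R by rewrite -natrD addn2 -nE.
ring.
Qed.

(** The regularised identity at eps = 1/(m+1) as m tends to infinity; all
    integrands are dominated by a multiple of |x|^(1-n) on the support. *)
Lemma kernel_identity :
  n.-1%:R * (integral_rV (fun x => xray_kernel j l x * partial i phi x)
    - integral_rV (fun x => xray_kernel i l x * partial j phi x)) =
  - 2 * ((i == l)%:R * integral_rV (fun x => scalar_kernel x * partial j phi x)
    - (j == l)%:R * integral_rV (fun x => scalar_kernel x * partial i phi x)).
Proof.
have cpi s : Coo (partial s phi) by exact: Coo_partial.
have spi s : supported r (partial s phi) by exact: partial_far0.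
have LL k s : L1loc k -> L1 (fun x => k x * partial s phi x).
  move=> kL; have ak : admissible k (partial s phi) by left; split=> //; exists r.
  have := conv_L1 0 (cpi s) ak; congr L1.
  by apply/funext => x; rewrite addr0.
have [B B0 HB] := continuous_bounded_ball r (Coo_continuous (cpi i)).
have [B' B'0 HB'] := continuous_bounded_ball r (Coo_continuous (cpi j)).
have I0 : integral_rV (integrand 0) = 0.
  pose C : R := 2 * n.-1%:R * (B + B') + 2 * (B + B').
  have C0 : 0 <= C by rewrite addr_ge0// mulr_ge0// addr_ge0.
  have [_ /(_ r) rl] := L1loc_riesz (R := R) n1.
  have LI : L1 (integrand 0).
    have -> : integrand 0 = fun x => n.-1%:R * (xray_kernel j l x * partial i phi x)
        + (- n.-1%:R) * (xray_kernel i l x * partial j phi x)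
        + ((2 * d i l) * (scalar_kernel x * partial j phi x)
        + (- (2 * d j l)) * (scalar_kernel x * partial i phi x)).
      by apply/funext => x; rewrite !xray_kernelE /integrand /a /b /scalar_kernel; ring.
    apply: L1muD; apply: L1muD; apply: L1muZ; apply: LL;
      solve [exact: L1loc_xray_kernel | exact: L1loc_scalar_kernel].
  apply: (integral_limit_eq0 (G_ := fun m => integrand m.+1%:R^-1)
    (D := fun x => C * (riesz n.-1 x * (`|x| <= r)%R%:R)) _ LI (L1muZ C rl)).
  - move=> m; apply: measurable_funD; apply: measurable_funM.
    + apply: meas_continuous; apply: Coo_continuous; apply: CooZ; apply: CooB;
        by apply: CooM => //; apply: CooM; exact: Coo_coord.
    + by apply: measurable_funX; exact: meas_reg.
    + by apply: meas_continuous; apply: Coo_continuous; apply: CooZ; apply: CooB; exact: CooZ.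
    + by apply: measurable_funX; exact: meas_reg.
  - move=> m x x0; set eps := m.+1%:R^-1.
    have e0 : 0 <= eps by rewrite invr_ge0.
    have [xr|xr] := leP `|x| r; last first.
      by rewrite /integrand /a /b !(spi _ _ xr) !mulr0 !subr0 !mulr0 !mul0r addr0 normr0.
    have Bi := HB x xr; have Bj := HB' x xr.
    rewrite /= mulr1; set w := riesz n.-1 x; have w0 : 0 <= w by exact: riesz_ge0.
    have r1 := reg_riesz_le n.-1 e0 x0; rewrite -/w in r1.
    have r1' : `|reg eps x ^+ n.-1| <= w by rewrite ger0_norm// exprn_ge0// reg_ge0.
    have r2 s t := reg_riesz_le2 n.-1 s t e0 x0; rewrite -nE -/w in r2.
    have dle s t : `|d s t| <= 1 by rewrite /d; case: eqP; rewrite ?normr1 ?normr0.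
    have -> : integrand eps x =
      2 * n.-1%:R * (x 0 j * x 0 l * reg eps x ^+ n.+1 * partial i phi x
                     - x 0 i * x 0 l * reg eps x ^+ n.+1 * partial j phi x)
      + 2 * (d i l * (partial j phi x * reg eps x ^+ n.-1)
             - d j l * (partial i phi x * reg eps x ^+ n.-1)).
      by rewrite /integrand /a /b; ring.
    have N0 : 0 <= 2 * n.-1%:R :> R by rewrite mulr_ge0.
    rewrite /C [leRHS]mulrDl; apply: (le_trans (ler_normD _ _)); apply: lerD.
      rewrite normrM (ger0_norm N0) -[leRHS]mulrA ler_wpM2l// mulrDl.
      apply: le_trans (ler_normB _ _) _.
      by apply: lerD; rewrite normrM [leRHS]mulrC; apply: ler_pM.
    rewrite normrM (ger0_norm (ler0n _ 2)) -[leRHS]mulrA ler_wpM2l// [X in X * w]addrC mulrDl.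
    apply: le_trans (ler_normB _ _) _.
    apply: lerD; rewrite normrM -[leRHS]mul1r; apply: ler_pM => //;
      by rewrite normrM; apply: ler_pM.
  - move=> x x0.
    pose P : {poly R} := (a x)%:P * 'X^(n.+1) + (b x)%:P * 'X^(n.-1).
    have PE t : P.[t] = a x * t ^+ n.+1 + b x * t ^+ n.-1.
      by rewrite /P !hornerE.
    have -> : integrand 0 x = P.[reg 0 x] by rewrite PE.
    rewrite (_ : (fun m : nat => _) = horner P \o (fun m => reg m.+1%:R^-1 x)); last first.
      by apply/funext => m /=; rewrite PE.
    apply: (@cvg_comp _ _ _ (fun m : nat => reg m.+1%:R^-1 x) (horner P) _ (nbhs (reg 0 x)));
      last exact: continuous_horner.
    have s0 : Num.sqrt (normsq x + 0) != 0.
      rewrite addr0 gt_eqF// (lt_le_trans _ (norm_le_euclid x))// normr_gt0//.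
    rewrite /reg; apply: cvgV => //.
    apply: (@cvg_comp _ _ _ (fun m : nat => normsq x + m.+1%:R^-1) (@Num.sqrt R) _ (nbhs (normsq x + 0)));
      last exact: sqrt_continuous.
    by apply: cvgD; [exact: cvg_cst|exact: cvg_harmonic].
  - by move=> m; apply: integral_integrand_eq0; rewrite invr_gt0.
have := integral_lin4 (n.-1%:R) (- n.-1%:R) (2 * d i l) (- (2 * d j l))
  (LL _ i (L1loc_xray_kernel j l)) (LL _ j (L1loc_xray_kernel i l))
  (LL _ j L1loc_scalar_kernel) (LL _ i L1loc_scalar_kernel).
rewrite (eq_integral_rV (g := integrand 0)); last first.
  by move=> x; rewrite !xray_kernelE /integrand /a /b /scalar_kernel; ring.
have alg (N d1 d2 I1 I2 I3 I4 : R) :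
    0 = N * I1 + - N * I2 + (2 * d1 * I3 + - (2 * d2) * I4) ->
    N * (I1 - I2) = - 2 * (d1 * I3 - d2 * I4).
  by move=> H; apply/eqP; rewrite -subr_eq0; apply/eqP; rewrite [RHS]H; ring.
by rewrite I0; exact: alg.
Qed.

End KernelIdentity.

(** * Approximate identities from powers of a peaked function *)

Section ApproximateIdentity.
Context {R : realType} {n : nat}.
Local Notation E := 'rV[R]_n.
Implicit Types (phi chi k F : E -> R) (i : 'I_n) (x y : E).

Lemma partialsB s F phi : Coo F -> Coo phi ->
  partials s (fun x => F x - phi x) = fun x => partials s F x - partials s phi x.
Proof.
move=> cF cp; elim: s => //= i s ->; apply/funext => x; apply: partial_is_derive.
by apply: is_deriveB; apply: Coo_is_derive; exact: Coo_partials.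
Qed.

Lemma uniform_modulus F M N (eps : R) : Coo F -> 0 < eps ->
  exists m : nat, forall s x y, (size s <= N)%N -> `|y| <= M -> `|x| < m.+1%:R^-1 ->
    `|partials s F (x + y) - partials s F y| <= eps.
Proof.
move=> cF e0; elim: N F cF => [|N IH] F cF;
  have [del del0 Hd] := uniform_continuity M (Coo_continuous cF) e0;
  have [m0 Hm0] : exists m : nat, m.+1%:R^-1 < del by
    (exists (Num.truncn del^-1); rewrite invf_plt ?posrE//; exact: truncnS_gt).
  exists m0 => -[|//] x y _ yM xm /=; rewrite distrC ltW// Hd//.
  by rewrite opprD addrCA subrr addr0 normrN (lt_trans xm).
have /choice[g Hg] i := IH _ (Coo_partial i cF).
have mono_inv (a b : nat) : (a <= b)%N -> (b.+1%:R^-1 : R) <= a.+1%:R^-1.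
  by move=> ab; rewrite lef_pV2 ?posrE ?ltr0n// ler_nat.
exists (m0 + \sum_i g i)%N => s x y sN yM xm.
case: (lastP s) sN => [_|{}s i]; last first.
  rewrite size_rcons partials_rcons => sN; apply: Hg => //.
  apply: lt_le_trans xm _; apply: mono_inv.
  by rewrite (bigD1 i)//= addnCA leq_addr.
rewrite distrC ltW// Hd//.
rewrite opprD addrCA subrr addr0 normrN (lt_trans xm)// (le_lt_trans _ Hm0)//.
by apply: mono_inv; exact: leq_addr.
Qed.

Lemma geometric_small (t C eps : R) : 0 <= t -> t < 1 -> 0 <= C -> 0 < eps ->
  exists m0 : nat, forall m, (m0 <= m)%N -> C * t ^+ m <= eps.
Proof.
move=> t0 t1 C0 e0.
have : (fun m => t ^+ m) @ \oo --> 0 by apply: cvg_expr; rewrite ger0_norm.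
have eC : 0 < eps / (C + 1) by rewrite divr_gt0// ltr_wpDl.
move=> /cvgrPdist_le/(_ _ eC) [m0 _ Hm0]; exists m0 => m mm.
have := Hm0 m mm; rewrite /= sub0r normrN ger0_norm ?exprn_ge0// => H.
apply: le_trans (ler_wpM2l C0 H) _.
by rewrite mulrA ler_pdivrMr ?ltr_wpDl// mulrC ler_wpM2l ?lerDl// ltW.
Qed.

(** A strict maximum at 0, uniformly so outside neighbourhoods of 0. Both a
    smooth bump and a truncated parabola have this property; the latter is not
    continuous where it is truncated. *)
Definition peaked (r : R) (h : E -> R) := [/\ meas h, supported r h, (forall x, 0 <= h x),
  (forall d, 0 < d -> exists2 q, 0 <= q < h 0 & forall x, d <= `|x| -> h x <= q) &
  (forall q, q < h 0 -> exists2 d, 0 < d & forall x, `|x| <= d -> q <= h x)].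

Lemma meas_far (d : R) : meas (fun x : E => (d <= `|x|)%R%:R : R).
Proof.
apply: (@measurableT_comp _ _ _ _ _ _ (fun b : bool => b%:R : R)) => //.
by apply: measurable_fun_ler => //; exact: meas_norm.
Qed.

Section Peak.
Variables (r : R) (h : E -> R).
Hypotheses (r_ge0 : 0 <= r) (hp : peaked r h).

Let hmax x : h x <= h 0.
Proof.
have [_ _ _ hA _] := hp; have [->//|x0] := eqVneq x 0.
have [|q /andP[_ q0] /(_ x (lexx _)) hq] := hA `|x|; first by rewrite normr_gt0.
by rewrite (le_trans hq)// ltW.
Qed.

Lemma peak_L1 m : L1 (fun x => h x ^+ m.+1).
Proof.
have [mh sh h0 _ _] := hp.
apply: (@L1_bounded _ _ _ (h 0 ^+ m.+1) r).
- by apply: measurable_funX; exact: mh.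
- by rewrite exprn_ge0.
- by move=> x; rewrite ger0_norm ?exprn_ge0// lerXn2r ?nnegrE.
- by move=> x xr; rewrite sh// expr0n.
Qed.

(** With q < q' < h(0), where h <= q at distance d and h >= q' near 0, the two
    integrals of h^m compare like (q / q')^m. *)
Lemma peak_concentrates (d eta : R) : 0 < d -> 0 < eta -> exists m : nat,
  0 < integral_rV (fun x => h x ^+ m.+1) /\
  integral_rV (fun x => h x ^+ m.+1 * (d <= `|x|)%R%:R) <= eta * integral_rV (fun x => h x ^+ m.+1).
Proof.
move=> d0 eta0; have [mh sh h0 hA hB] := hp.
have [q /andP[q0 qh] hq] := hA d d0.
pose q' := (q + h 0) / 2.
have qq' : q < q' by rewrite /q'; lra.
have [d' d'0 hq'] := hB q' ltac:(rewrite /q'; lra).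
have q'0 : 0 < q' by exact: le_lt_trans qq'.
have t0 : 0 <= q / q' by rewrite divr_ge0// ltW.
have t1 : q / q' < 1 by rewrite ltr_pdivrMr// mul1r.
have V0 : 0 <= (2 * r) ^+ n by rewrite exprn_ge0// mulr_ge0.
have V'0 : 0 < (2 * d') ^+ n by rewrite exprn_gt0// mulr_gt0.
have [m0 Hm] := geometric_small t0 t1 V0 (mulr_gt0 eta0 V'0).
have {Hm} Hm := Hm m0.+1 (leqnSn _); exists m0.
have L := peak_L1 m0; set m := m0.+1 in Hm L *.
have lower : q' ^+ m * (2 * d') ^+ n <= integral_rV (fun x => h x ^+ m).
  rewrite -(integral_ball (n := n) (ltW d'0)) /integral_rV -RintegralZl//; last exact: L1_ball.
  apply: le_Rintegral => //; first by apply: L1muZ; exact: L1_ball.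
  move=> t _ /=; have [td|td] := leP `|rowT t| d'; last by rewrite mulr0 exprn_ge0.
  by rewrite mulr1 lerXn2r ?nnegrE ?(ltW q'0)// hq'.
have c0 : 0 < integral_rV (fun x => h x ^+ m).
  by apply: lt_le_trans lower; rewrite mulr_gt0// exprn_gt0.
split=> //.
apply: (@le_trans _ _ (q ^+ m * (2 * r) ^+ n)).
  rewrite -(integral_ball (n := n) r_ge0) /integral_rV -RintegralZl//; last exact: L1_ball.
  apply: le_Rintegral => //; last 1 first.
  - move=> t _ /=; have [tr|tr] := leP `|rowT t| r; last by rewrite sh// expr0n mul0r mulr0.
    rewrite mulr1; have [td|td] := leP d `|rowT t|; last by rewrite mulr0 exprn_ge0.
    by rewrite mulr1 lerXn2r ?nnegrE// hq.
  - apply: (L1mu_le L).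
      by apply: measurable_funM; [exact: L1_meas L|exact: meas_far].
    by move=> t; rewrite normrM; have [td|td] := leP d `|rowT t|; rewrite ?normr1 ?mulr1// normr0 mulr0.
  - by apply: L1muZ; exact: L1_ball.
apply: le_trans (ler_wpM2l (ltW eta0) lower).
have -> : q ^+ m = q' ^+ m * (q / q') ^+ m.
  by rewrite -exprMn; congr (_ ^+ m); field; rewrite gt_eqF.
by rewrite mulrCA -mulrA ler_wpM2l ?exprn_ge0 ?(ltW q'0)// mulrC.
Qed.

Definition peak_kernel (m : nat) x := h x ^+ m.+1 / integral_rV (fun x => h x ^+ m.+1).

Lemma approximate_identity F M N (eps : R) : 0 <= M -> Coo F -> 0 < eps -> exists m,
  Cbound M N (fun y => conv (peak_kernel m) F y - F y) eps.
Proof.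
move=> M0 cF e0; have [mh sh h0 hA hB] := hp.
have e2 : 0 < eps / 2 by rewrite divr_gt0.
have [md Hd] := uniform_modulus M N cF e2.
have [B B0 HB] := Cbound_exists (r + M) N cF.
have eta0 : 0 < eps / (4 * (B + 1)) by rewrite divr_gt0// mulr_gt0// ltr_wpDl.
have d0 : 0 < md.+1%:R^-1 :> R by rewrite invr_gt0 ltr0n.
have [m [c0 cm]] := peak_concentrates d0 eta0; exists m.
set c := integral_rV _ in c0 cm; set d := md.+1%:R^-1 in d0 cm Hd.
have kL : L1 (peak_kernel m).
  have := L1muZ c^-1 (peak_L1 m); congr L1mu.
  by apply/funext => t; rewrite /peak_kernel mulrC.
have k0 x : 0 <= peak_kernel m x by rewrite divr_ge0 ?exprn_ge0// ltW.
have ks : supported r (peak_kernel m).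
  by move=> x xr; rewrite /peak_kernel sh// expr0n mul0r.
have k1 : integral_rV (peak_kernel m) = 1.
  transitivity (c^-1 * integral_rV (fun x => h x ^+ m.+1)); last by rewrite mulVf// gt_eqF.
  rewrite /integral_rV -RintegralZl//; last exact: peak_L1.
  by apply: eq_Rintegral => t _; rewrite mulrC.
have kdL : L1 (fun x => peak_kernel m x * (d <= `|x|)%R%:R).
  apply: (L1mu_le kL); first by apply: measurable_funM; [exact: L1_meas kL|exact: meas_far].
  by move=> t; rewrite normrM; have [td|td] := leP d `|rowT t|; rewrite ?normr1 ?mulr1// normr0 mulr0.
have kd : integral_rV (fun x => peak_kernel m x * (d <= `|x|)%R%:R) <= eps / (4 * (B + 1)).
  rewrite -(ler_pM2r c0); apply: le_trans cm.
  rewrite /integral_rV -RintegralZr// le_eqVlt; apply/orP; left; apply/eqP.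
  apply: eq_Rintegral => t _.
  by rewrite mulrAC /peak_kernel -/c divfK// gt_eqF.
have ak s : admissible (peak_kernel m) (partials s F) by right; split=> //; exists r.
move=> s y sN yM.
have cs := Coo_partials s cF.
rewrite partialsB//; last by apply: Coo_conv => //; exact: (ak [::]).
rewrite partials_conv//; last exact: (ak [::]).
have L := conv_L1 y cs (ak s).
have yr : `|y| <= r + M by rewrite (le_trans yM)// lerDr.
have -> : conv (peak_kernel m) (partials s F) y - partials s F y =
    integral_rV (fun x => peak_kernel m x * (partials s F (x + y) - partials s F y)).
  rewrite -[in LHS](mul1r (partials s F y)) -k1 /conv /integral_rV -RintegralZr// -RintegralB//.
    by apply: eq_Rintegral => t _; rewrite mulrBr.
  by have := L1muZ (partials s F y) kL; congr L1mu; apply/funext => t; rewrite mulrC.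
pose G x := eps / 2 * peak_kernel m x + (2 * B) * (peak_kernel m x * (d <= `|x|)%R%:R).
have GL : L1 G by apply: L1muD; apply: L1muZ.
have DL : L1 (fun x => peak_kernel m x * (partials s F (x + y) - partials s F y)).
  have := L1muB L (L1muZ (partials s F y) kL); congr L1mu.
  by apply/funext => t; rewrite mulrBr [X in _ - X]mulrC.
apply: le_trans (le_normr_Rintegral measurableT DL) _.
apply: (@le_trans _ _ (integral_rV G)).
  apply: le_Rintegral => //; first exact: L1mu_norm DL.
  move=> t _; rewrite /G normrM (ger0_norm (k0 _)).
  have [td|td] := leP d `|rowT t|; last first.
    by rewrite !mulr0 addr0 mulrC ler_wpM2r// Hd.
  have [tr|tr] := leP `|rowT t| r; last by rewrite ks// !mul0r !mulr0 addr0.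
  rewrite mulr1; apply: (@le_trans _ _ (2 * B * peak_kernel m (rowT t))); last first.
    by rewrite lerDr mulr_ge0// ltW.
  rewrite mulrC ler_wpM2r//; apply: le_trans (ler_normB _ _) _.
  rewrite mulr_natl mulr2n; apply: lerD; apply: HB => //.
  by rewrite (le_trans (ler_normD _ _))// lerD.
rewrite /G /integral_rV RintegralD//; [|exact: L1muZ|exact: L1muZ].
rewrite !RintegralZl//.
move: k1 kd; rewrite /integral_rV => -> kd; rewrite mulr1.
apply: (@le_trans _ _ (eps / 2 + 2 * B * (eps / (4 * (B + 1))))).
  by rewrite lerD2l ler_wpM2l// mulr_ge0.
have -> : 2 * B * (eps / (4 * (B + 1))) = eps / 2 * (B / (B + 1)).
  by field; rewrite gt_eqF// ltr_wpDl.
have : B / (B + 1) <= 1 by rewrite ler_pdivrMr ?mul1r ?lerDl ?ltr_wpDl.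
by move=> H; rewrite [leRHS](splitr eps) lerD2l ler_piMr// ltW.
Qed.

End Peak.
End ApproximateIdentity.

(** * Bumps, cutoffs, monomials and powers of contractions *)

Section Bumps.
Context {R : realType} {n : nat}.
Local Notation E := 'rV[R]_n.
Implicit Types (phi chi k F G h : E -> R) (i : 'I_n) (x y : E) (u : (E -> R) -> R).

Lemma normsq0 : normsq (0 : E) = 0.
Proof. by rewrite /normsq big1// => i _; rewrite mxE expr0n. Qed.

Lemma norm_sq_le_normsq x : `|x| ^+ 2 <= normsq x.
Proof.
have h := norm_le_euclid x; rewrite -[leRHS]sqr_sqrtr ?normsq_ge0//.
by rewrite lerXn2r ?nnegrE ?sqrtr_ge0.
Qed.

Definition bump (r : R) x : R := flat 0 (r ^+ 2 - normsq x).

Lemma Coo_bump r : Coo (bump r).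
Proof. by apply: Coo_flat; apply: CooB; [exact: Coo_cst|exact: Coo_normsq]. Qed.

Lemma bump_ge0 r x : 0 <= bump r x. Proof. exact: flat_ge0. Qed.

Lemma bump_supported r : 0 <= r -> supported r (bump r).
Proof.
move=> r0 x xr; rewrite /bump flat_eq0// subr_le0.
apply: le_trans (norm_sq_le_normsq x).
by rewrite lerXn2r ?nnegrE// ltW.
Qed.

Lemma bump_gt0 r : 0 < r -> 0 < bump r 0.
Proof. by move=> r0; rewrite /bump normsq0 subr0 flat_gt0// exprn_gt0. Qed.

Lemma flat0_lt (s t : R) : s < t -> 0 < t -> flat 0 s < flat 0 t.
Proof.
move=> st t0; have [s0|s0] := leP s 0; first by rewrite flat_eq0// flat_gt0.
by rewrite /flat s0 t0 !expr0 !mul1r ltr_expR ltrN2 ltf_pV2.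
Qed.

Lemma flat0_le (s t : R) : s <= t -> flat 0 s <= flat 0 t.
Proof.
rewrite le_eqVlt => /predU1P[->//|st]; have [t0|t0] := leP t 0.
  by rewrite !flat_eq0// ltW// (lt_le_trans st).
by rewrite ltW// flat0_lt.
Qed.

Lemma bump_peaked r : 0 < r -> peaked r (bump r).
Proof.
move=> r0; split.
- by apply: meas_continuous; apply: Coo_continuous; exact: Coo_bump.
- exact/bump_supported/ltW.
- exact: bump_ge0.
- move=> d d0; exists (flat 0 (r ^+ 2 - d ^+ 2)).
    rewrite flat_ge0/= /bump normsq0 subr0 flat0_lt ?exprn_gt0//.
    by rewrite gtrBl exprn_gt0.
  move=> x dx; apply: flat0_le; rewrite lerD2l lerN2.
  apply: le_trans (norm_sq_le_normsq x); by rewrite lerXn2r ?nnegrE// ltW.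
- move=> q qb; have cb : continuous (bump r) by exact/Coo_continuous/Coo_bump.
  have e0 : 0 < bump r 0 - q by rewrite subr_gt0.
  have [del del0 Hd] := uniform_continuity 0 cb e0.
  exists (del / 2); first by rewrite divr_gt0.
  move=> x xd; have := Hd 0 x; rewrite normr0 lexx sub0r normrN => /(_ isT).
  have : `|x| < del by apply: le_lt_trans xd _; lra.
  move=> xd' /(_ xd'); rewrite ltr_norml => /andP[_]; lra.
Qed.

(** The quotient f / (f + g), with f and g flat functions of |x|^2 whose supports
    cover the space. *)
Lemma cutoff_exists (r : R) : 0 <= r -> exists r' chi,
  [/\ r <= r', Coo chi, supported r' chi & forall x, `|x| <= r -> chi x = 1].
Proof.
move=> r0; pose c := n%:R * r ^+ 2; pose r' := c + r + 1.
have c0 : 0 <= c by rewrite mulr_ge0// exprn_ge0.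
have r'1 : 1 <= r' by rewrite /r'; lra.
have cr : c < r' ^+ 2.
  by rewrite expr2; apply: (@lt_le_trans _ _ (r' * 1)); [rewrite /r'; lra|rewrite ler_wpM2l//; lra].
pose f x := flat 0 (r' ^+ 2 - normsq x); pose g x := flat 0 (normsq x - c).
have cf : Coo f by apply: Coo_flat; apply: CooB; [exact: Coo_cst|exact: Coo_normsq].
have cg : Coo g by apply: Coo_flat; apply: CooB; [exact: Coo_normsq|exact: Coo_cst].
have f0 x : 0 <= f x by exact: flat_ge0.
have g0 x : 0 <= g x by exact: flat_ge0.
have fg x : f x + g x != 0.
  rewrite gt_eqF//; have [h|h] := ltP (normsq x) (r' ^+ 2).
    by rewrite ltr_wpDr// flat_gt0// subr_gt0.
  by rewrite ltr_wpDl// flat_gt0// subr_gt0 (lt_le_trans cr).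
exists r', (fun x => f x * (f x + g x)^-1); split.
- by rewrite /r'; lra.
- by apply: CooM => //; apply: CooV => //; exact: CooD.
- by move=> x xr; rewrite (_ : f x = 0) ?mul0r//; apply: (bump_supported (r := r')) => //; lra.
- move=> x xr; have gx : g x = 0.
    rewrite /g flat_eq0// subr_le0; apply: le_trans (euclid_le_norm x) _.
    by rewrite ler_wpM2l// lerXn2r ?nnegrE.
  by have := fg x; rewrite gx addr0 => fx; rewrite divff.
Qed.

(** Multi-indices are words of coordinates, as for iterated derivatives. *)
Definition mono (al : seq 'I_n) x : R := \prod_(i <- al) x 0 i.

Lemma Coo_mono al : Coo (mono al).
Proof. by apply: Coo_prod => i; exact: Coo_coord. Qed.

Lemma mono_cons i al x : mono (i :: al) x = x 0 i * mono al x.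
Proof. by rewrite /mono big_cons. Qed.

(** A sum of words is enough, with repetitions instead of coefficients. *)
Lemma partial_mono i al : exists L : seq (seq 'I_n),
  (forall be, be \in L -> (size be).+1 = size al) /\
  forall x, partial i (mono al) x = \sum_(be <- L) mono be x.
Proof.
elim: al => [|k al [L [sL dL]]].
  exists [::]; split=> // x; rewrite big_nil.
  rewrite (_ : mono [::] = fun=> 1) ?partial_cst//.
  by apply/funext => y; rewrite /mono big_nil.
exists ((if i == k then [:: al] else [::]) ++ map (cons k) L); split.
  move=> be; rewrite mem_cat => /orP[|/mapP[ga gaL ->]].
    by case: eqP => // _; rewrite inE => /eqP ->.
  by rewrite /= sL.
move=> x; rewrite big_cat big_map/=.
rewrite (_ : mono (k :: al) = fun y => y 0 k * mono al y); last first.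
  by apply/funext => y; exact: mono_cons.
rewrite partialM ?partial_coord; [|exact: Coo_derivable (Coo_coord k)|exact: Coo_derivable (Coo_mono al)].
rewrite dL; congr (_ + _).
  by case: eqP => _; rewrite ?big_seq1 ?big_nil ?mul1r ?mul0r.
by rewrite mulr_sumr; apply: eq_bigr => be _; rewrite mono_cons.
Qed.

Lemma bernoulli_root (t : R) N : 0 <= t -> t < 1 -> exists2 s : R, 0 <= s < 1 & t <= s ^+ N.+1.
Proof.
move=> t0 t1; pose d := (1 - t) / N.+1%:R.
have N0 : 0 < N.+1%:R :> R by rewrite ltr0n.
have d0 : 0 < d by rewrite divr_gt0// subr_gt0.
have d1 : d <= 1.
  by rewrite ler_pdivrMr// mul1r (le_trans (_ : _ <= 1))// ?gerBl// ler1n.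
exists (1 - d); first by rewrite subr_ge0 d1 gtrBl.
have B m : 1 - m%:R * d <= (1 - d) ^+ m.
  elim: m => [|m IH]; first by rewrite mul0r subr0 expr0.
  rewrite exprS; apply: le_trans (ler_wpM2l (_ : 0 <= 1 - d) IH); last by rewrite subr_ge0.
  rewrite -[m.+1]addn1 natrD.
  have := mulr_ge0 (mulr_ge0 (ler0n R m) (ltW d0)) (ltW d0); nra.
by apply: le_trans (B N.+1); rewrite /d mulrCA divff ?gt_eqF// mulr1; lra.
Qed.

Lemma linear_geometric (s : R) m : 0 <= s -> s < 1 -> m%:R * s ^+ m <= (1 - s)^-1.
Proof.
move=> s0 s1; have s1' : 0 < 1 - s by rewrite subr_gt0.
rewrite -(ler_pM2r s1') mulVf ?gt_eqF//.
have : m%:R * s ^+ m <= \sum_(k < m) s ^+ k.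
  rewrite mulr_natl -[X in _ *+ X]card_ord -sumr_const.
  by apply: ler_sum => k _; apply: ler_wiXn2l => //; [exact: ltW|exact/ltnW/ltn_ord].
move=> H; apply: le_trans (ler_wpM2r (ltW s1') H) _.
have := subrX1 s m; move=> e.
have -> : (\sum_(k < m) s ^+ k) * (1 - s) = 1 - s ^+ m.
  rewrite -[1 - s]opprB mulrN mulrC -(subrX1 s m); ring.
by rewrite gerBl exprn_ge0.
Qed.

Lemma CboundZ M N (b : R) F B : Coo F -> Cbound M N F B ->
  Cbound M N (fun x => b * F x) (`|b| * B).
Proof.
move=> cF HB s x sN xM.
have -> : partials s (fun x => b * F x) x = b * partials s F x.
  rewrite (_ : partials s _ = fun x => b * partials s F x)//.
  elim: s {sN} => //= i s ->; apply/funext => y; apply: partial_is_derive.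
  by have := is_deriveZ b (Coo_is_derive i y (Coo_partials s cF)); exact.
by rewrite normrM ler_wpM2l// HB.
Qed.

(** Each of at most N derivatives lowers the exponent by one and brings out a
    factor at most m + N + 1. *)
Lemma power_decay_aux (M t : R) h : 0 <= M -> 0 <= t -> Coo h ->
  (forall x, `|x| <= M -> `|h x| <= t) -> t <= 1 ->
  forall N G, Coo G -> exists2 C, 0 <= C &
    forall m, Cbound M N (fun x => G x * h x ^+ (m + N)) (C * ((m + N).+1%:R ^+ N * t ^+ m)).
Proof.
move=> M0 t0 ch ht t1; elim=> [|N IH] G cG;
  have [C C0 HC] := continuous_bounded_ball M (Coo_continuous cG).
  exists C => // m [|//] x _ xM /=; rewrite addn0 expr0 mul1r normrM normrX.
  by apply: ler_pM; rewrite ?exprn_ge0 ?HC// lerXn2r ?nnegrE ?ht.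
have /choice[g1 Hg1] i : exists c, 0 <= c /\ forall m, Cbound M N
   (fun x => partial i G x * h x * h x ^+ (m + N)) (c * ((m + N).+1%:R ^+ N * t ^+ m)).
  have [|c c0 Hc] := IH (fun x => partial i G x * h x).
    by apply: CooM => //; exact: Coo_partial.
  by exists c.
have /choice[g2 Hg2] i : exists c, 0 <= c /\ forall m, Cbound M N
   (fun x => G x * partial i h x * h x ^+ (m + N)) (c * ((m + N).+1%:R ^+ N * t ^+ m)).
  have [|c c0 Hc] := IH (fun x => G x * partial i h x).
    by apply: CooM => //; exact: Coo_partial.
  by exists c.
pose S := \sum_i (g1 i + g2 i).
have gle i : g1 i + g2 i <= S.
  rewrite /S (bigD1 i)//= lerDl sumr_ge0// => j _.
  by rewrite addr_ge0//; [case: (Hg1 j)|case: (Hg2 j)].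
have S0 : 0 <= S by rewrite sumr_ge0// => j _; rewrite addr_ge0//; [case: (Hg1 j)|case: (Hg2 j)].
exists (C + S); first by rewrite addr_ge0.
move=> m; set D := (m + N.+1).+1%:R; have D1 : 1 <= D :> R by rewrite ler1n.
have tm0 : 0 <= t ^+ m by rewrite exprn_ge0.
apply/CboundS; split=> [x xM|i].
  rewrite normrM normrX; apply: (@le_trans _ _ (C * t ^+ m)).
    apply: ler_pM; rewrite ?exprn_ge0 ?HC//.
    apply: (@le_trans _ _ (t ^+ (m + N.+1))); first by rewrite lerXn2r ?nnegrE ?ht.
    by apply: ler_wiXn2l => //; exact: leq_addr.
  apply: (@le_trans _ _ ((C + S) * t ^+ m)); first by rewrite ler_wpM2r// lerDl.
  rewrite ler_wpM2l ?addr_ge0// ler_peMl// exprn_ege1//.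
have -> : partial i (fun x => G x * h x ^+ (m + N.+1)) = fun x =>
   partial i G x * h x * h x ^+ (m + N) + (m + N.+1)%:R * (G x * partial i h x * h x ^+ (m + N)).
  apply/funext => x; apply: partial_is_derive.
  have d1 := Coo_is_derive i x cG.
  have d2 := is_derive_pow (m + N.+1) (Coo_is_derive i x ch).
  apply: (is_derive_eq (is_deriveM d1 d2)).
  rewrite -[LHS]/(G x * _ + h x ^+ (m + N.+1) * partial i G x) addnS/= exprS; ring.
have [c10 Hc1] := Hg1 i; have [c20 Hc2] := Hg2 i.
set P := (m + N).+1%:R ^+ N * t ^+ m in Hc1 Hc2.
have B1 := Hc1 m; have B2 := Hc2 m.
have cc1 : Coo (fun x => partial i G x * h x * h x ^+ (m + N)).
  by apply: CooM; [apply: CooM => //; exact: Coo_partial|exact: CooX].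
have cc2 : Coo (fun x => G x * partial i h x * h x ^+ (m + N)).
  by apply: CooM; [apply: CooM => //; exact: Coo_partial|exact: CooX].
have B3 := CboundD cc1 (CooZ (m + N.+1)%:R cc2) B1 (CboundZ (m + N.+1)%:R cc2 B2).
apply: Cbound_le B3.
have P0 : 0 <= P by rewrite mulr_ge0// exprn_ge0.
have PD : P <= D ^+ N * t ^+ m.
  by rewrite ler_wpM2r// lerXn2r ?nnegrE// ler_nat addnS.
have Q0 : 0 <= D ^+ N * t ^+ m by rewrite mulr_ge0// exprn_ge0.
have -> : (C + S) * (D ^+ N.+1 * t ^+ m) = (C + S) * (D * (D ^+ N * t ^+ m)).
  by rewrite exprS !mulrA.
rewrite (ger0_norm (ler0n _ _)); set Q := D ^+ N * t ^+ m in PD Q0 *.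
have DD : (m + N.+1)%:R <= D by rewrite ler_nat.
apply: (@le_trans _ _ (g1 i * (D * Q) + g2 i * (D * Q))).
  apply: lerD.
    rewrite ler_wpM2l// (le_trans PD)// ler_peMl//.
  by rewrite mulrCA ler_wpM2l// ler_pM.
have DQ0 : 0 <= D * Q by rewrite mulr_ge0// (le_trans ler01).
rewrite -mulrDl ler_wpM2r//.
by rewrite (le_trans (gle i))// lerDr.
Qed.

(** Powers of a function with values in [-t, t], t < 1, tend to 0 with all their
    derivatives: the polynomial factor is absorbed by writing t <= s^(N+1). *)
Lemma power_decay (M t : R) h : 0 <= M -> 0 <= t -> t < 1 -> Coo h ->
  (forall x, `|x| <= M -> `|h x| <= t) ->
  forall N G (eps : R), Coo G -> 0 < eps -> exists m, Cbound M N (fun x => G x * h x ^+ m) eps.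
Proof.
move=> M0 t0 t1 ch ht N G eps cG e0.
have [C C0 HC] := power_decay_aux M0 t0 ch ht (ltW t1) N cG.
have [s /andP[s0 s1] ts] := bernoulli_root N t0 t1.
pose A := (1 - s)^-1 + N.+1%:R.
have A0 : 0 <= A by rewrite addr_ge0// invr_ge0 subr_ge0 ltW.
have CA0 : 0 <= C * A ^+ N by rewrite mulr_ge0// exprn_ge0.
have [m0 Hm] := geometric_small s0 s1 CA0 e0.
exists (m0 + N)%N; apply: Cbound_le (HC m0); apply: le_trans (Hm m0 (leqnn _)).
rewrite -mulrA ler_wpM2l//.
have sm0 : 0 <= s ^+ m0 by rewrite exprn_ge0.
apply: (@le_trans _ _ ((m0 + N).+1%:R ^+ N * (s ^+ m0 ^+ N * s ^+ m0))).
  rewrite ler_wpM2l ?exprn_ge0// -exprSr -exprM mulnC exprM.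
  by rewrite lerXn2r ?nnegrE ?exprn_ge0.
rewrite mulrA -exprMn ler_wpM2r// lerXn2r ?nnegrE ?mulr_ge0//.
rewrite -addnS natrD mulrDl /A; apply: lerD; first exact: linear_geometric.
by rewrite ler_piMr// exprn_ile1// ltW.
Qed.

End Bumps.

(** * Density of polynomials *)

Section PolynomialDensity.
Context {R : realType} {n : nat}.
Local Notation E := 'rV[R]_n.
Implicit Types (phi chi F : E -> R) (i : 'I_n) (x y : E).

Lemma meas_affine_comp (eps : R) (c : E) (g : E -> R) : meas g -> meas (fun x => g (eps *: x + c)).
Proof.
move=> mg.
have e : (fun t : n.-tuple (measurableTypeR R) => g (eps *: rowT t + c)) =
  (fun t => g (rowT t)) \o affT eps (fun i => c 0 i).
  apply/funext => t /=; congr g; apply/rowP => i; by rewrite !mxE tnth_mktuple.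
rewrite /meas e; apply: measurableT_comp; first exact: mg.
exact: measurable_affT.
Qed.

(** Convolution of a function of compact support with such a kernel K(x, y) is a
    polynomial in y. *)
Definition polynomial_in_y (K : E -> E -> R) := exists (I : finType) (a : I -> E -> R) (al : I -> seq 'I_n),
  (forall t, continuous (a t)) /\ forall x y, K x y = \sum_t a t x * mono (al t) y.

Lemma piy_ext K K' : (forall x y, K x y = K' x y) -> polynomial_in_y K -> polynomial_in_y K'.
Proof.
by move=> KK [I [a [al [ca e]]]]; exists I, a, al; split=> // x y; rewrite -KK.
Qed.

Lemma piy_x (a : E -> R) : continuous a -> polynomial_in_y (fun x _ => a x).
Proof.
move=> ca; exists 'I_1, (fun=> a), (fun=> [::]); split=> // x y.
by rewrite big_ord1 /mono big_nil mulr1.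
Qed.

Lemma piy_y i : polynomial_in_y (fun _ y => y 0 i).
Proof.
exists 'I_1, (fun=> fun=> 1), (fun=> [:: i]); split=> [_|x y].
  exact: cst_continuous.
by rewrite big_ord1 /mono big_seq1 mul1r.
Qed.

Lemma piyD K K' : polynomial_in_y K -> polynomial_in_y K' ->
  polynomial_in_y (fun x y => K x y + K' x y).
Proof.
move=> [I [a [al [ca e]]]] [I' [a' [al' [ca' e']]]].
exists (I + I')%type, (fun t => match t with inl s => a s | inr s => a' s end),
  (fun t => match t with inl s => al s | inr s => al' s end).
split=> [[t|t]|x y]; [exact: ca|exact: ca'|].
by rewrite big_sumType/= e e'.
Qed.

Lemma mono_cat al be x : mono (al ++ be) x = mono al x * mono be x :> R.
Proof. by rewrite /mono big_cat. Qed.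

Lemma piyM K K' : polynomial_in_y K -> polynomial_in_y K' ->
  polynomial_in_y (fun x y => K x y * K' x y).
Proof.
move=> [I [a [al [ca e]]]] [I' [a' [al' [ca' e']]]].
exists (I * I')%type, (fun t x => a t.1 x * a' t.2 x), (fun t => al t.1 ++ al' t.2).
split=> [t x|x y]; first by apply: continuousM; [exact: ca|exact: ca'].
rewrite e e' mulr_suml -(pair_bigA _ (fun s s' => a s x * a' s' x * mono (al s ++ al' s') y)) /=.
apply: eq_bigr => s _; rewrite mulr_sumr; apply: eq_bigr => s' _.
by rewrite mono_cat mulrACA.
Qed.

Lemma piy_sum (I : Type) (r : seq I) (K : I -> E -> E -> R) :
  (forall t, polynomial_in_y (K t)) -> polynomial_in_y (fun x y => \sum_(t <- r) K t x y).
Proof.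
move=> pK; elim: r => [|t r IH].
  apply: (piy_ext _ (piy_x (@cst_continuous _ _ (0 : R)))) => x y; by rewrite big_nil.
by apply: (piy_ext _ (piyD (pK t) IH)) => x y; rewrite big_cons.
Qed.

Lemma piyX K m : polynomial_in_y K -> polynomial_in_y (fun x y => K x y ^+ m).
Proof.
move=> pK; elim: m => [|m IH].
  by apply: (piy_ext _ (piy_x (@cst_continuous _ _ (1 : R)))) => x y.
by apply: (piy_ext _ (piyM pK IH)) => x y; rewrite exprS.
Qed.

Variable (r : R).
Hypothesis r0 : 0 < r.

Let D : R := n%:R * r ^+ 2 + 1.
Let D0 : 0 < D. Proof. by rewrite ltr_wpDl// mulr_ge0// exprn_ge0// ltW. Qed.

(** The radius r and the constant D are such that this is positive on the ball of
    radius r, hence [peaked] once truncated there. *)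
Definition landau x : R := 1 - D^-1 * normsq x.

Let iD0 : 0 < D^-1. Proof. by rewrite invr_gt0. Qed.

Definition cut_landau x : R := landau x * (`|x| <= r)%R%:R.

Let landau_ge0 x : `|x| <= r -> 0 <= landau x.
Proof.
move=> xr; rewrite subr_ge0 mulrC ler_pdivrMr// mul1r.
apply: le_trans (euclid_le_norm x) _; rewrite /D.
apply: (@le_trans _ _ (n%:R * r ^+ 2)); last by rewrite lerDl.
by rewrite ler_wpM2l// lerXn2r ?nnegrE// ltW.
Qed.

Let Coo_landau : Coo landau.
Proof. by apply: CooB; [exact: Coo_cst|apply: CooZ; exact: Coo_normsq]. Qed.

Let landau0 : landau 0 = 1.
Proof. by rewrite /landau normsq0 mulr0 subr0. Qed.

Let cut0 : cut_landau 0 = 1.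
Proof. by rewrite /cut_landau landau0 normr0 ltW// mulr1. Qed.

Lemma landau_peaked : peaked r cut_landau.
Proof.
split.
- apply: measurable_funM; last exact: meas_ball.
  by apply: meas_continuous; exact: Coo_continuous.
- by move=> x xr; rewrite /cut_landau leNgt xr mulr0.
- move=> x; rewrite /cut_landau; have [xr|xr] := leP `|x| r; last by rewrite mulr0.
  by rewrite mulr1 landau_ge0.
- move=> d d0; exists (Num.max 0 (1 - D^-1 * d ^+ 2)).
    by rewrite cut0 le_max lexx gt_max ltr01 gtrBl mulr_gt0// exprn_gt0.
  move=> x dx; rewrite /cut_landau le_max; have [xr|xr] := leP `|x| r; last first.
    by rewrite mulr0 lexx.
  apply/orP; right; rewrite mulr1 lerD2l lerN2 ler_wpM2l ?(ltW iD0)//.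
  by apply: le_trans (norm_sq_le_normsq x); rewrite lerXn2r ?nnegrE// ltW.
- move=> q q1; rewrite cut0 in q1.
  have e0 : 0 < 1 - q by rewrite subr_gt0.
  have [del del0 Hd] := uniform_continuity 0 (Coo_continuous Coo_landau) e0.
  exists (Num.min r (del / 2)); first by rewrite lt_min r0 divr_gt0.
  move=> x; rewrite le_min => /andP[xr xd]; rewrite /cut_landau xr mulr1.
  have := Hd 0 x; rewrite normr0 lexx sub0r normrN landau0 => /(_ isT).
  have : `|x| < del by apply: le_lt_trans xd _; lra.
  move=> xd' /(_ xd'); rewrite ltr_norml => /andP[_]; lra.
Qed.

Lemma piy_landau m : polynomial_in_y (fun x y => landau (x - y) ^+ m).
Proof.
apply: piyX.
apply: (piy_ext (K := fun x y => 1 + (- D^-1) * \sum_(i < n) ((x 0 i + -1 * y 0 i) * (x 0 i + -1 * y 0 i)))).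
  move=> x y; rewrite /landau mulNr; congr (_ - _ * _).
  by apply: eq_bigr => i _; rewrite !mxE mulN1r expr2.
have cc (c : R) : polynomial_in_y (fun _ _ => c) by apply: piy_x; exact: cst_continuous.
apply: piyD; first exact: cc.
apply: piyM; first exact: cc.
apply: piy_sum => i; apply: piyM; apply: piyD; try (apply: piy_x; apply: Coo_continuous; exact: Coo_coord);
  by apply: piyM; [exact: cc|exact: piy_y].
Qed.

(** For x and y in the ball of radius r/2 the truncation of the kernel is not
    seen, and powers of [landau] (x - y) are polynomials in y. *)
Lemma conv_landau m phi : Coo phi -> supported (r / 2) phi ->
  exists (I : finType) (c : I -> R) (al : I -> seq 'I_n),
  forall y, `|y| <= r / 2 -> conv (peak_kernel cut_landau m) phi y = \sum_t c t * mono (al t) y.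
Proof.
move=> cphi sphi; have [I [a [al [ca e]]]] := piy_landau m.+1.
pose Jc := integral_rV (fun x => cut_landau x ^+ m.+1).
exists I, (fun t => integral_rV (fun x => phi x * (a t x / Jc))), al => y yr.
pose g x := peak_kernel cut_landau m (1 *: x + - y) * phi x.
have [mh sh h0 _ _] := landau_peaked.
have mg : meas g.
  apply: measurable_funM; last by apply: meas_continuous; exact: Coo_continuous.
  apply: meas_affine_comp; apply: measurable_funM => //.
  by apply: measurable_funX; exact: mh.
transitivity (integral_rV g).
  rewrite -(integral_rV_affine y (or_introl (erefl 1)) mg).
  by apply: eq_integral_rV => x; rewrite /g !scale1r addrK.
have L1t t : L1 (fun x => phi x * (a t x / Jc)).
  apply: (@L1_test _ _ (fun x => phi x * (a t x / Jc)) (r / 2)).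
    move=> x; apply: (@continuousM R E phi (fun x => a t x / Jc)); first exact: Coo_continuous.
    by apply: (@continuousM R E (a t) (fun=> Jc^-1)); [exact: ca|exact: cst_continuous].
  by move=> x xr; rewrite sphi// mul0r.
transitivity (integral_rV (fun x => \sum_t mono (al t) y * (phi x * (a t x / Jc)))).
  apply: eq_integral_rV => x; have [xr|xr] := leP `|x| (r / 2); last first.
    rewrite /g sphi// mulr0 big1// => t _; by rewrite mul0r mulr0.
  rewrite /g scale1r /peak_kernel -/Jc /cut_landau (_ : _ <= r) ?mulr1; last first.
    by rewrite (le_trans (ler_normB _ _))// [leRHS](splitr r) lerD.
  by rewrite e !mulr_suml; apply: eq_bigr => t _; ring.
elim: (index_enum I) => [|t s IH].
  rewrite big_nil (eq_integral_rV (g := fun=> 0)); last by move=> x; rewrite big_nil.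
  by rewrite /integral_rV Rintegral_cst// mul0r.
rewrite big_cons -IH.
rewrite (eq_integral_rV (g := fun x => mono (al t) y * (phi x * (a t x / Jc)) +
    \sum_(t <- s) mono (al t) y * (phi x * (a t x / Jc)))); last by move=> x; rewrite big_cons.
have Ls : L1 (fun x => \sum_(t <- s) mono (al t) y * (phi x * (a t x / Jc))).
  elim: s {IH} => [|t' s IH].
    rewrite (_ : (fun _ => _) = fun=> 0); first exact: integrable0.
    by apply/funext => x; rewrite big_nil.
  rewrite (_ : (fun _ => _) = fun x => mono (al t') y * (phi x * (a t' x / Jc)) +
     \sum_(t <- s) mono (al t) y * (phi x * (a t x / Jc))); last by apply/funext => x; rewrite big_cons.
  by apply: L1muD => //; apply: L1muZ; exact: L1t.
rewrite /integral_rV RintegralD//; last by apply: L1muZ; exact: L1t.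
by rewrite RintegralZl//; [rewrite mulrC|exact: L1t].
Qed.

End PolynomialDensity.

(** A compactly supported distribution only sees the cut-off of phi, which
    Landau's polynomials approximate with all derivatives on a large ball. *)
Lemma polynomial_density (R : realType) (n : nat) (v : ('rV[R]_n -> R) -> R) :
  Edist v -> (forall al, v (mono al) = 0) -> forall phi, Coo phi -> v phi = 0.
Proof.
move=> Ev v0 phi cphi; have lv := Edist_linear Ev.
have [M1 M10 vloc] := Edist_local Ev.
have [_ [M [N [C [M0 C0 HC]]]]] := Ev.
have [r' [chi [rr' cchi schi chi1]]] := @cutoff_exists R n _ M10.
pose r := 2 * (r' + 1).
have r0 : 0 < r by rewrite mulr_gt0// ltr_wpDl// (le_trans M10).
have r2 : r / 2 = r' + 1 by rewrite /r; field.
pose Phi x := chi x * phi x.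
have cPhi : Coo Phi by exact: CooM.
have sPhi : supported (r / 2) Phi.
  move=> x; rewrite r2 => xr; rewrite /Phi schi ?mul0r//; lra.
have -> : v phi = v Phi.
  by apply: vloc => // x xM; rewrite /Phi chi1 ?mul1r// ltW.
apply/eqP; rewrite -normr_le0; apply/ler_addgt0Pl => eps e0; rewrite addr0.
have eC : 0 < eps / (C + 1) by rewrite divr_gt0// ltr_wpDl.
have [m Hm] := approximate_identity (ltW r0) (landau_peaked r0) N M0 cPhi eC.
have [I [c [al Hc]]] := conv_landau r0 m cPhi sPhi.
set k := peak_kernel _ m in Hm Hc.
have kL : L1 k.
  pose c' := integral_rV (fun x => cut_landau (n := n) r x ^+ m.+1).
  rewrite (_ : k = fun x => c'^-1 * cut_landau r x ^+ m.+1); last first.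
    by apply/funext => x; rewrite mulrC.
  by apply: L1muZ; exact: (peak_L1 (landau_peaked r0) m).
have [_ sh _ _ _] := landau_peaked (n := n) r0.
have ckP : Coo (conv k Phi).
  apply: Coo_conv => //; right; split=> //; exists r => x xr.
  by rewrite /k /peak_kernel sh// expr0n mul0r.
have vk : v (conv k Phi) = 0.
  have cm t : Coo (fun y => c t * mono (al t) y) by apply: CooZ; exact: Coo_mono.
  rewrite (vloc _ (fun y => \sum_t c t * mono (al t) y) ckP); last 2 first.
  - exact: Coo_sum.
  - by move=> y yM; apply: Hc; rewrite r2; lra.
  rewrite (linearC_sum _ lv)// big1// => t _.
  by rewrite (linearCZ _ lv) ?v0 ?mulr0//; exact: Coo_mono.
have -> : v Phi = - v (fun y => conv k Phi y - Phi y) by rewrite (linearCB lv)// vk sub0r opprK.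
rewrite normrN; apply: le_trans (HC _ _ (CooB ckP cPhi) Hm) _.
by rewrite mulrA ler_pdivrMr ?ltr_wpDl// mulrC ler_wpM2l ?lerDl// ltW.
Qed.

(** * Unique continuation for the Riesz potential of order 1 - n *)

Section UniqueContinuation.
Context {R : realType} {n : nat}.
Local Notation E := 'rV[R]_n.
Implicit Types (phi chi F G h : E -> R) (i : 'I_n) (x y : E).

Hypothesis hn : (2 <= n)%N.
Variables (u : (E -> R) -> R) (rho : R).
Hypotheses (Eu : Edist u) (rho0 : 0 < rho).
Hypothesis u_near : forall phi, Coo phi -> supported rho phi -> u phi = 0.
Hypothesis u_conv : forall phi, Coo phi -> supported rho phi -> u (conv scalar_kernel phi) = 0.

Let lu : Coo_linear u := Edist_linear Eu.
Let r4 : R := rho / 4.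
Let r40 : 0 < r4. Proof. by rewrite divr_gt0. Qed.

(** The bump makes |x|^2 positive at the origin; it is supported where u
    vanishes. *)
Let q x := normsq x + bump r4 x.
Let p x := (Num.sqrt (q x))^-1.

Let cq : Coo q.
Proof. by apply: CooD; [exact: Coo_normsq|exact: Coo_bump]. Qed.

Let q0 x : 0 < q x.
Proof.
have [->|x0] := eqVneq x 0; first by rewrite ltr_wpDl ?normsq_ge0// bump_gt0.
rewrite ltr_wpDr ?bump_ge0// (lt_le_trans _ (norm_sq_le_normsq x))// exprn_gt0// normr_gt0//.
Qed.

Let cp : Coo p. Proof. exact: Coo_invsqrt. Qed.

Let p2q x : p x ^+ 2 * q x = 1.
Proof. by rewrite /p exprVn sqr_sqrtr ?mulVf ?gt_eqF// ltW. Qed.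

Let p_far x : r4 < `|x| -> p x = reg 0 x.
Proof. by move=> xr; rewrite /p /q /reg (bump_supported (ltW r40) xr). Qed.

Let partial_p_far i a x : r4 < `|x| -> partial i (fun y => p y ^+ a) x = - a%:R * x 0 i * p x ^+ a.+2.
Proof.
move=> xr.
have s0 : Num.sqrt (q x) != 0 by rewrite sqrtr_eq0 -ltNge.
have dq : is_derive x (delta_mx 0 i) q (2 * x 0 i).
  have h1 := Coo_is_derive i x (@Coo_normsq R n).
  have h2 := Coo_is_derive i x (@Coo_bump R n r4).
  rewrite partial_normsq in h1; rewrite (partial_far0 i (bump_supported (ltW r40)) xr) in h2.
  by apply: (is_derive_eq (is_deriveD h1 h2)); rewrite addr0.
have dp := is_derive_comp1 (is_derive_inv1 s0) (is_derive_comp1 (is_derive1_sqrt (q0 x)) dq).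
apply: partial_is_derive; apply: (is_derive_eq (is_derive_pow a dp)).
rewrite /p; case: a => [|m]; first by rewrite !mul0r oppr0 !mul0r.
by rewrite /= !exprS; set w := _ ^+ m; field; rewrite s0.
Qed.

(** Testing F against mollifiers, rather than u F = 0 alone, makes the space
   stable under derivatives, which can be moved to the mollifier. *)
Let Z F := Coo F /\ forall phi, Coo phi -> supported r4 phi -> u (conv phi F) = 0.

Let adm phi F : Coo phi -> supported r4 phi -> admissible phi F.
Proof.
move=> cphi sphi; right; split; last by exists r4.
by apply: (@L1_test _ _ _ r4) => //; exact: Coo_continuous.
Qed.

Let u_far F G : Coo F -> Coo G -> (forall x, rho / 2 < `|x| -> F x = G x) -> u F = u G.
Proof.
move=> cF cG FG; apply/eqP; rewrite -subr_eq0 -(linearCB lu)//; apply/eqP.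
apply: u_near; first exact: CooB.
move=> x xr; rewrite FG ?subrr//; apply: lt_trans xr; have := rho0; lra.
Qed.

Let far_add x y : `|x| <= r4 -> rho / 2 < `|y| -> r4 < `|x + y|.
Proof.
move=> xr yr; rewrite addrC; apply: lt_le_trans (lerB_normD _ _).
by have := rho0; rewrite /r4 in xr *; lra.
Qed.

(** If x is small and y is outside the region where u vanishes, then x + y stays
   away from the origin. *)
Let Zeq F G : Z F -> Coo G -> (forall x, r4 < `|x| -> F x = G x) -> Z G.
Proof.
move=> [cF ZF] cG FG; split=> // phi cphi sphi; rewrite -(ZF phi cphi sphi).
apply: u_far; [by apply: Coo_conv => //; exact: adm..|] => y yr.
apply: eq_integral_rV => x; have [xr|xr] := leP `|x| r4; last by rewrite sphi// !mul0r.
by rewrite FG// far_add.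
Qed.

Let Zlin (a b : R) F G : Z F -> Z G -> Z (fun x => a * F x + b * G x).
Proof.
move=> [cF ZF] [cG ZG]; split; first by apply: CooD; exact: CooZ.
move=> phi cphi sphi.
have aF := adm F cphi sphi; have aG := adm G cphi sphi.
have cFc := Coo_conv cF aF; have cGc := Coo_conv cG aG.
rewrite (linear_ext u (chi := fun y => a * conv phi F y + b * conv phi G y)).
  rewrite lu//; last exact: CooZ.
  by rewrite (linearCZ b lu)// ZF// ZG// !mulr0 addr0.
move=> y; rewrite convD; last 2 first.
- by apply: (@conv_L1 _ _ phi (fun x => a * F x)); [exact: CooZ|exact: adm].
- by apply: (@conv_L1 _ _ phi (fun x => b * G x)); [exact: CooZ|exact: adm].
by rewrite !convZ//; exact: conv_L1.
Qed.

Let ZZ (a : R) F : Z F -> Z (fun x => a * F x).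
Proof.
move=> ZF; have := Zlin a 0 ZF ZF; congr Z.
by apply/funext => x; rewrite mul0r addr0.
Qed.

Let Z0 : Z (fun=> 0).
Proof.
split; first exact: Coo_cst.
move=> phi _ _; rewrite -[RHS](linearC0 lu); apply: linear_ext => y.
rewrite /conv (eq_integral_rV (g := fun=> 0)); last by move=> x; rewrite mulr0.
by rewrite /integral_rV Rintegral_cst// mul0r.
Qed.

Let Zsum (I : Type) (r : seq I) (F : I -> E -> R) :
  (forall k, Z (F k)) -> Z (fun x => \sum_(k <- r) F k x).
Proof.
move=> ZF; elim: r => [|k r IH].
  by have := Z0; congr Z; apply/funext => x; rewrite big_nil.
have := Zlin 1 1 (ZF k) IH; congr Z; apply/funext => x.
by rewrite big_cons !mul1r.
Qed.

Let Zpartial F i : Z F -> Z (partial i F).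
Proof.
move=> [cF ZF]; have cFi := Coo_partial i cF; split=> // phi cphi sphi.
have cphii := Coo_partial i cphi; have sphii := partial_far0 i sphi.
rewrite (linear_ext u (chi := fun y => -1 * conv (partial i phi) F y)).
  by rewrite (linearCZ _ lu) ?ZF ?mulr0//; apply: Coo_conv => //; exact: adm.
move=> y; rewrite /conv (integral_by_parts i cphi _ sphi); last exact: Coo_shift.
by rewrite mulN1r opprK partial_shift.
Qed.

(** The hypothesis on u, read through the reflection x |-> - x of the mollifier. *)
Let Zstart : Z (fun x => p x ^+ n.-1).
Proof.
have cpn : Coo (fun x => p x ^+ n.-1) by exact: CooX.
split=> // phi cphi sphi.
pose phi' x := phi (- 1 *: x + 0).
have cphi' : Coo phi' by exact: Coo_affine.
have sphi' : supported rho phi'.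
  move=> x xr; apply: sphi; rewrite addr0 scaleN1r normrN.
  by apply: lt_trans xr; have := rho0; rewrite /r4; lra.
rewrite -(u_conv cphi' sphi').
have aK : admissible scalar_kernel phi'.
  by left; split; [exact: L1loc_scalar_kernel|exists rho].
apply: u_far; [by apply: Coo_conv => //; exact: adm|exact: Coo_conv|] => y yr.
pose g x := phi x * scalar_kernel (1 *: x + y).
have mg : meas g.
  apply: measurable_funM; first by apply: meas_continuous; exact: Coo_continuous.
  by apply: meas_affine_comp; exact: meas_scalar_kernel.
transitivity (integral_rV g).
  apply: eq_integral_rV => x; have [xr|xr] := leP `|x| r4; last by rewrite /g sphi// !mul0r.
  by rewrite /g scale1r /scalar_kernel p_far// far_add.
rewrite -(integral_rV_affine (- y) (or_intror (erefl (-1))) mg).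
apply: eq_integral_rV => x; rewrite /g /phi' scale1r !scaleN1r addr0 subrK mulrC opprD.
congr (_ * _); rewrite /scalar_kernel /reg; congr ((Num.sqrt (_ + _))^-1 ^+ _).
by apply: eq_bigr => i _; rewrite mxE sqrrN.
Qed.

Let npred : n = n.-1.+1.
Proof. by rewrite prednK// ltnW. Qed.

(** Away from the origin d_i |x|^(-a) = - a x_i |x|^(-a-2), and the divergence
   of x |x|^(-a-2) is (n - a - 2) |x|^(-a-2). *)
Let Zstep a : (n.-1 <= a)%N -> Z (fun x => p x ^+ a) -> Z (fun x => p x ^+ a.+2).
Proof.
move=> na Za.
have a0 : a%:R != 0 :> R.
  by rewrite pnatr_eq0 -lt0n (leq_trans _ na)// -ltnS -npred.
have ci i := @Coo_coord R n i.
have Z1 i : Z (fun x => x 0 i * p x ^+ a.+2).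
  apply: (Zeq (ZZ (- a%:R^-1) (Zpartial i Za))); first by apply: CooM => //; exact: CooX.
  by move=> x xr; rewrite partial_p_far//; field.
have Z2 := Zsum (index_enum 'I_n) (fun i => Zpartial i (Z1 i)).
have D0 : (n%:R - a.+2%:R) != 0 :> R.
  have na2 : (n < a.+2)%N by rewrite [X in (X < _)%N]npred !ltnS.
  by rewrite subr_eq0 eqr_nat neq_ltn na2.
apply: (Zeq (ZZ (n%:R - a.+2%:R)^-1 Z2)); first exact: CooX.
move=> x xr.
have -> : \sum_i partial i (fun x => x 0 i * p x ^+ a.+2) x =
   \sum_(i < n) (p x ^+ a.+2 - a.+2%:R * p x ^+ a.+4 * x 0 i ^+ 2).
  apply: eq_bigr => i _; rewrite partialM; [|exact: Coo_derivable (ci i)|exact: Coo_derivable (CooX a.+2 cp)].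
  rewrite partial_coord eqxx mul1r partial_p_far//; set A := p x ^+ a.+4; set B := p x ^+ a.+2.
  by rewrite expr2; ring.
rewrite sumrB sumr_const card_ord -mulr_sumr -/(normsq x).
have e : p x ^+ 2 * normsq x = 1.
  by rewrite -(p2q x) /q (bump_supported (ltW r40) xr) addr0.
have -> : a.+2%:R * p x ^+ a.+4 * normsq x = a.+2%:R * p x ^+ a.+2 * (p x ^+ 2 * normsq x).
  by rewrite !exprS; ring.
rewrite e mulr1; set B := p x ^+ a.+2.
by rewrite -(mulr_natl B n) -mulrBl mulrA mulVf ?mul1r.
Qed.

Let Zpow j : Z (fun x => p x ^+ (n.-1 + 2 * j)).
Proof.
elim: j => [|j IH]; first by have := Zstart; rewrite muln0 addn0.
by rewrite mulnS addnCA add2n; apply: Zstep IH; exact: leq_addr.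
Qed.

(** Induction on the length of the word: x_i x^al |x|^(-a-2) is up to a factor
   the difference of (d_i x^al) |x|^(-a) and d_i (x^al |x|^(-a)). *)
Let Zmono m : forall al j, (size al <= m)%N -> (size al <= j)%N ->
  Z (fun x => mono al x * p x ^+ (n.-1 + 2 * j)).
Proof.
elim: m => [|m IH] [|i al] j //= sm sj.
- have := Zpow j; congr Z; apply/funext => x; by rewrite /mono big_nil mul1r.
- have := Zpow j; congr Z; apply/funext => x; by rewrite /mono big_nil mul1r.
case: j sj => // j; rewrite ltnS => sj; rewrite ltnS in sm.
set a := (n.-1 + 2 * j)%N.
have -> : (n.-1 + 2 * j.+1)%N = a.+2 by rewrite /a mulnS addnCA.
have a0 : a%:R != 0 :> R.
  by rewrite pnatr_eq0 -lt0n (leq_trans _ (leq_addr _ _))// -ltnS -npred.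
have Zal := IH al j sm sj; rewrite -/a in Zal.
have [L [sL dL]] := partial_mono (R := R) i al.
have ZL : Z (fun x => \sum_(be <- L) (if be \in L then mono be x * p x ^+ a else 0)).
  apply: Zsum => be; case: (boolP (be \in L)) => [beL|_]; last exact: Z0.
  have := sL _ beL => e; apply: IH; first by rewrite (leq_trans _ sm)// -e.
  by rewrite (leq_trans _ sj)// -e.
have cal := Coo_mono (R := R) al.
apply: (Zeq (Zlin a%:R^-1 (- a%:R^-1) ZL (Zpartial i Zal))).
  by apply: CooM; [exact: Coo_mono|exact: CooX].
move=> x xr.
rewrite (partialM (phi := mono al)); [|exact: Coo_derivable|exact: Coo_derivable (CooX a cp)].
have -> : \sum_(be <- L) (if be \in L then mono be x * p x ^+ a else 0) =
    (\sum_(be <- L) mono be x) * p x ^+ a.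
  by rewrite mulr_suml big_seq [RHS]big_seq; apply: eq_bigr => be ->.
rewrite dL partial_p_far// mono_cons; set S := \sum_(be <- L) _.
set A := p x ^+ a; set B := p x ^+ a.+2; set D := mono al x.
by field.
Qed.

Let u_of_Z F : Z F -> u F = 0.
Proof.
move=> [cF ZF]; have [_ [M [N [C [M0 C0 HC]]]]] := Eu.
apply/eqP; rewrite -normr_le0; apply/ler_addgt0Pl => eps e0; rewrite addr0.
have eC : 0 < eps / (C + 1) by rewrite divr_gt0// ltr_wpDl.
have [m Hm] := approximate_identity (ltW r40) (bump_peaked r40) N M0 cF eC.
set k := peak_kernel _ m in Hm.
have ck : Coo k.
  rewrite /k /peak_kernel; set c := integral_rV _.
  have := CooZ c^-1 (CooX m.+1 (@Coo_bump R n r4)); congr Coo.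
  by apply/funext => x; rewrite mulrC.
have sk : supported r4 k.
  by move=> x xr; rewrite /k /peak_kernel (bump_supported (ltW r40) xr) expr0n mul0r.
have ckF := Coo_conv cF (adm F ck sk).
have -> : u F = - u (fun y => conv k F y - F y) by rewrite (linearCB lu)// ZF// sub0r opprK.
rewrite normrN; apply: le_trans (HC _ _ (CooB ckF cF) Hm) _.
by rewrite mulrA ler_pdivrMr ?ltr_wpDl// mulrC ler_wpM2l ?lerDl// ltW.
Qed.

(** With h := 1 - p^2 / b, which is a contraction on a ball that carries u, the
   expansion of h^m shows u (G h^m) = u G, while G h^m tends to 0. *)
Let u_geom G : Coo G -> (forall i : nat, u (fun x => G x * p x ^+ (2 + 2 * i)) = 0) -> u G = 0.
Proof.
move=> cG H; have [_ [M [N [C [M0 C0 HC]]]]] := Eu.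
have [B B0 HB] := continuous_bounded_ball M (Coo_continuous cp).
have [Bq Bq0 HBq] := continuous_bounded_ball M (Coo_continuous cq).
pose b := B ^+ 2 + 1; have b0 : 0 < b by rewrite ltr_wpDl// exprn_ge0.
pose h x := 1 - b^-1 * p x ^+ 2.
have ch : Coo h by apply: CooB; [exact: Coo_cst|apply: CooZ; exact: CooX].
pose t := 1 - b^-1 * (Bq + 1)^-1.
have Bq1 : 0 < Bq + 1 by rewrite ltr_wpDl.
have ib0 : 0 < b^-1 by rewrite invr_gt0.
have iB0 : 0 < (Bq + 1)^-1 by rewrite invr_gt0.
have t1 : t < 1 by rewrite /t gtrBl mulr_gt0.
have t0 : 0 <= t.
  rewrite /t subr_ge0 -invfM invf_le1 ?mulr_gt0//.
  have : 1 <= b by rewrite /b lerDr exprn_ge0.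
  have : 1 <= Bq + 1 by rewrite lerDr.
  by move=> h1 h2; rewrite -[leLHS]mulr1; apply: ler_pM.
have ht x : `|x| <= M -> `|h x| <= t.
  move=> xM; have p0 : 0 <= p x by rewrite invr_ge0 sqrtr_ge0.
  have pB : p x ^+ 2 <= b.
    apply: (@le_trans _ _ (B ^+ 2)); last by rewrite lerDl.
    by rewrite lerXn2r ?nnegrE// -[leLHS]ger0_norm// HB.
  have pq : (Bq + 1)^-1 <= p x ^+ 2.
    rewrite -(ler_pM2r (q0 x)) p2q mulrC ler_pdivrMr// mul1r.
    by rewrite (le_trans (ler_norm _))// (le_trans (HBq _ xM))// lerDl.
  rewrite /h /t ger0_norm ?lerD2l ?lerN2 ?ler_wpM2l ?(ltW ib0)//.
  by rewrite subr_ge0 mulrC ler_pdivrMr// mul1r.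
have step m : forall i : nat, u (fun x => G x * h x ^+ m * p x ^+ (2 + 2 * i)) = 0.
  elim: m => [|m IH] i.
    by rewrite -(H i); apply: linear_ext => x; rewrite expr0 mulr1.
  rewrite (linear_ext u (chi := fun x =>
    (- b^-1) * (G x * h x ^+ m * p x ^+ (2 + 2 * i.+1)) + G x * h x ^+ m * p x ^+ (2 + 2 * i))).
    have cc j : Coo (fun x => G x * h x ^+ m * p x ^+ j).
      by apply: CooM; [apply: CooM => //; exact: CooX|exact: CooX].
    by rewrite lu; [rewrite (IH i.+1) (IH i) mulr0 addr0|exact: cc|exact: cc].
  move=> x; rewrite exprS {1}/h mulnS !exprD; ring.
have const m : u (fun x => G x * h x ^+ m) = u G.
  elim: m => [|m IH]; first by apply: linear_ext => x; rewrite expr0 mulr1.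
  rewrite -IH (linear_ext u (chi := fun x =>
    (- b^-1) * (G x * h x ^+ m * p x ^+ (2 + 2 * 0)) + G x * h x ^+ m)).
    have cc : Coo (fun x => G x * h x ^+ m) by apply: CooM => //; exact: CooX.
    have cc2 : Coo (fun x => G x * h x ^+ m * p x ^+ (2 + 2 * 0)) by apply: CooM => //; exact: CooX.
    by rewrite lu; [rewrite step mulr0 add0r|exact: cc2|exact: cc].
  move=> x; rewrite exprS {1}/h muln0 addn0; ring.
apply/eqP; rewrite -normr_le0; apply/ler_addgt0Pl => eps e0; rewrite addr0.
have eC : 0 < eps / (C + 1) by rewrite divr_gt0// ltr_wpDl.
have [m Hm] := power_decay M0 t0 t1 ch ht N cG eC.
rewrite -(const m); apply: le_trans (HC _ _ _ Hm) _; first by apply: CooM => //; exact: CooX.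
by rewrite mulrA ler_pdivrMr ?ltr_wpDl// mulrC ler_wpM2l ?lerDl// ltW.
Qed.

(** Descending induction on j, by its defect d = |al| - j. *)
Let u_mono al d : forall j, (size al <= j + d)%N -> u (fun x => mono al x * p x ^+ (n.-1 + 2 * j)) = 0.
Proof.
elim: d => [|d IH] j sj.
  by apply: u_of_Z; apply: (Zmono (m := size al)) => //; rewrite addn0 in sj.
apply: u_geom; first by apply: CooM; [exact: Coo_mono|exact: CooX].
move=> i; rewrite -(IH (j + i).+1); last by rewrite addSn -addnS addnAC addnS (leq_trans sj)// addnS ltnS leq_addr.
apply: linear_ext => x; rewrite -mulrA -exprD; congr (_ * _ ^+ _).
by rewrite -addnA; congr addn; rewrite mulnS mulnDr addnCA.
Qed.

Let u_poly al : u (fun x => p x ^+ n.-1 * mono al x) = 0.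
Proof.
have := u_mono (d := size al) (j := 0) (leqnn _); rewrite muln0 addn0 => e.
by rewrite -[RHS]e; apply: linear_ext => x; rewrite mulrC.
Qed.

Lemma riesz_unique_continuation phi : Coo phi -> u phi = 0.
Proof.
move=> cphi; have cpn : Coo (fun x => p x ^+ n.-1) by exact: CooX.
have c2 : Coo (fun x => phi x * (q x * p x) ^+ n.-1).
  by apply: CooM => //; apply: CooX; exact: CooM.
rewrite -(polynomial_density (Edist_mul cpn Eu) u_poly c2).
apply: linear_ext => x; rewrite mulrCA -exprMn.
by rewrite mulrCA -expr2 (mulrC (q x)) p2q expr1n mulr1.
Qed.

End UniqueContinuation.

(** * The Poincare lemma with compact supports *)

Section Primitive.
Context {R : realType} {n : nat}.
Local Notation E := 'rV[R]_n.
Local Notation leb := (@lebesgue_measure R).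
Local Notation T := (measurableTypeR R).
Implicit Types (phi chi F : E -> R) (i j : 'I_n) (x y : E).

Lemma integral_derivative01 (F f : R -> R) : (forall t : R, is_derive t 1 F (f t)) -> continuous f ->
  \int[leb]_(t in setT) (\1_`[0, 1]%classic t * f t) = F 1 - F 0.
Proof.
move=> dF cf.
have cF : continuous F by move=> t; exact: is_derive_continuous1 (dF t).
transitivity (\int[leb]_(t in `[0, 1]) f t).
  rewrite [RHS]Rintegral_mkcond; apply: eq_Rintegral => t _.
  by rewrite patchE indicE; case: ifPn => /=; rewrite ?mul1r ?mul0r.
rewrite /Rintegral (continuous_FTC2 (F := F) ltr01).
- by [].
- exact: continuous_subspaceT.
- split=> [t _| |]; first by have [] := dF t.
  + by apply: cvg_at_right_filter; exact: cF.
  + by apply: cvg_at_left_filter; exact: cF.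
- by move=> t _; rewrite derive1E; exact: (@derive_val _ _ _ _ _ _ _ (dF t)).
Qed.

Variable i0 : 'I_n.

(** For s = 0 this is the projection onto the hyperplane y_i0 = 0. *)
Definition scale_coord (s : R) y : E := \row_j ((if j == i0 then s else 1) * y 0 j).

Lemma scale_coord1 y : scale_coord 1 y = y.
Proof. by apply/rowP => j; rewrite mxE; case: eqP; rewrite mul1r. Qed.

Lemma scale_coord_line s y : scale_coord s y =
  (s * y 0 i0) *: delta_mx 0 i0 + (y - y 0 i0 *: delta_mx 0 i0).
Proof.
apply/rowP => j; rewrite !mxE eqxx /=.
by case: eqP => [->|_]; rewrite ?mulr1 ?mulr0 ?subrr ?addr0 ?subr0 ?add0r ?mul1r.
Qed.

Lemma scale_coord_is_derive phi y (s : R) : Coo phi ->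
  is_derive s 1 (fun s => phi (scale_coord s y)) (y 0 i0 * partial i0 phi (scale_coord s y)).
Proof.
move=> cphi.
have -> : (fun s => phi (scale_coord s y)) =
    (fun h => phi (h *: delta_mx 0 i0 + (y - y 0 i0 *: delta_mx 0 i0))) \o (fun s => y 0 i0 * s).
  by apply/funext => t /=; rewrite scale_coord_line mulrC.
rewrite mulrC; apply: is_derive1_comp.
  apply: is_derive_line; rewrite mulrC -scale_coord_line; exact: Coo_is_derive.
by have := is_deriveZ (y 0 i0) (is_derive_id (s : R) (1 : R)); rewrite [_ *: _]mulr1.
Qed.

Lemma scale_coord_continuous phi y : continuous phi -> continuous (fun s : R => phi (scale_coord s y)).
Proof.
move=> cphi s; apply: (@continuous_comp _ _ _ (fun s => scale_coord s y) phi); last exact: cphi.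
rewrite (_ : (fun _ => _) = fun s => (s * y 0 i0) *: delta_mx 0 i0 + (y - y 0 i0 *: delta_mx 0 i0)); last first.
  by apply/funext => t; exact: scale_coord_line.
apply: continuousD; last exact: cst_continuous.
apply: (@continuous_comp _ _ _ (fun s : R => s * y 0 i0) (fun h : R => h *: (delta_mx 0 i0 : E))).
  by apply: continuousM => //; exact: cst_continuous.
exact: scalel_continuous.
Qed.

Let clip (t : T) : R := if (0 <= t) && (t <= 1) then t else 0.
Let ind (t : T) : R := \1_`[0, 1]%classic t.
Let a (t : T) y := scale_coord (clip t) y.
Let c i (t : T) : R := if i == i0 then clip t else 1.

Let clip01 t : 0 <= clip t <= 1.
Proof. by rewrite /clip; case: ifPn => // _; rewrite lexx ler01. Qed.

Let clip_meas : measurable_fun setT clip.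
Proof.
apply: measurable_fun_ifT => //.
by apply: measurable_and; apply: measurable_fun_ler.
Qed.

Let clip_ind t (f : R -> R) : ind t * f (clip t) = ind t * f t.
Proof.
rewrite /ind indicE /clip; case: (boolP (t \in _)) => [|_]; last by rewrite !mul0r.
by rewrite inE /= in_itv /= => ->.
Qed.

Let a_meas phi y : continuous phi -> measurable_fun setT (fun t => phi (a t y)).
Proof.
move=> cphi; apply: (@measurableT_comp _ _ _ T T _ (fun s => phi (scale_coord s y))) => //.
by apply: continuous_measurable_fun; exact: scale_coord_continuous.
Qed.

Let a_lip t y y' : `|a t y - a t y'| <= `|y - y'|.
Proof.
apply: le_mx_norm => // j; rewrite !mxE -mulrBr normrM.
apply: (@le_trans _ _ `|(y - y') 0 j|); last exact: coord_le_norm.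
rewrite !mxE ler_piMl//; case: eqP => _; rewrite ?normr1//.
by have /andP[h1 h2] := clip01 t; rewrite ger0_norm.
Qed.

Let a_le t y : `|a t y| <= `|y|.
Proof.
have := a_lip t y 0; rewrite subr0 (_ : a t 0 = 0) ?subr0//.
by apply/rowP => j; rewrite !mxE mulr0.
Qed.

Let c_meas i : measurable_fun setT (c i).
Proof. by rewrite /c; case: eqP => _; [exact: clip_meas|exact: measurable_cst]. Qed.

Let c_le1 i t : `|c i t| <= 1.
Proof.
rewrite /c; case: eqP => _; rewrite ?normr1//.
by have /andP[h1 h2] := clip01 t; rewrite ger0_norm.
Qed.

Let a_line t i (h : R) y : a t (h *: delta_mx 0 i + y) = (h * c i t) *: delta_mx 0 i + a t y.
Proof.
apply/rowP => j; rewrite !mxE eqxx /= /c mulrDr; congr (_ + _).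
by have [->|ji] := eqVneq j i; rewrite ?mulr1 ?mulr0// mulrC.
Qed.

Let dom k phi : L1mu leb k -> dominated leb a k phi.
Proof.
by move=> kL M; exists k, M; split=> // t y yM _; exact: le_trans (a_le t y) yM.
Qed.

Let indL : L1mu leb ind.
Proof.
have -> : ind = \1_`[0, 1]%classic by [].
exact: integrable_indic_itv.
Qed.

Let int_ind : \int[leb]_t `|ind t| = 1.
Proof.
transitivity (\int[leb]_t (\1_`[0, 1]%classic t * (fun=> 1 : R) t)).
  by apply: eq_Rintegral => t _; rewrite mulr1 ger0_norm.
have d1 (t : R) : is_derive t 1 id (1 : R) := is_derive_id t (1 : R).
rewrite (integral_derivative01 d1) ?subr0//.
exact: cst_continuous.
Qed.

Let S phi := avg leb a ind phi.

(** The integral of phi from 0 to y_i0 in the coordinate i0, rescaled to a mean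
    over [0, 1] so that it is an average of the kind studied above. *)
Definition primitive phi y : R := y 0 i0 * S phi y.

Let S_bound M N phi B : 0 <= M -> forall k, L1mu leb k -> \int[leb]_t `|k t| <= 1 -> Coo phi ->
  Cbound M N phi B -> Cbound M N (avg leb a k phi) B.
Proof.
move=> M0; elim: N phi => [|N IH] phi k kL k1 cphi HB.
  move=> [|//] y _ yM /=; have B0 := Cbound_ge0 M0 HB.
  apply: (@le_trans _ _ (B * \int[leb]_t `|k t|)); last by rewrite ler_piMr.
  apply: avg_le => //; first exact: (avg_L1 a_meas y cphi (dom phi kL)).
  by move=> t _; apply: (HB [::]) => //; exact: le_trans (a_le t y) yM.
move/CboundS: (HB) => [H1 H2]; have B0 := Cbound_ge0 M0 HB.
apply/CboundS; split=> [y yM|i].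
  apply: (@le_trans _ _ (B * \int[leb]_t `|k t|)); last by rewrite ler_piMr.
  apply: avg_le => //; first exact: (avg_L1 a_meas y cphi (dom phi kL)).
  by move=> t _; apply: H1 => //; exact: le_trans (a_le t y) yM.
rewrite (partial_avg a_meas c_meas c_le1 a_line i cphi (dom phi kL)).
have kcL : L1mu leb (fun t => k t * c i t).
  by apply: (L1mu_bounded kL (c_meas i) ler01) => t _; exact: c_le1.
apply: IH => //; last exact: Coo_partial.
apply: le_trans k1; apply: le_Rintegral => //; [exact: L1mu_norm kcL|exact: L1mu_norm|].
by move=> t _; rewrite normrM ler_piMr// c_le1.
Qed.

Let Coo_S k phi : Coo phi -> L1mu leb k -> Coo (avg leb a k phi).
Proof. by move=> cphi kL; exact: (Coo_avg a_meas a_lip c_meas c_le1 a_line cphi (dom phi kL)). Qed.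

Lemma Coo_primitive phi : Coo phi -> Coo (primitive phi).
Proof. by move=> cphi; apply: CooM; [exact: Coo_coord|exact: Coo_S]. Qed.

Lemma primitive_bound M N : 0 <= M -> exists2 C, 0 <= C & forall phi B, Coo phi ->
  Cbound M N phi B -> Cbound M N (primitive phi) (C * B).
Proof.
move=> M0; have [C C0 HC] := CboundM N M0 (@Coo_coord R n i0).
exists C => // phi B cphi HB; apply: HC; first exact: Coo_S.
by apply: S_bound => //; rewrite int_ind.
Qed.

Lemma primitive_linear (b : R) phi chi y : Coo phi -> Coo chi ->
  primitive (fun x => b * phi x + chi x) y = b * primitive phi y + primitive chi y.
Proof.
move=> cphi cchi; rewrite /primitive.
have h1 := avg_L1 a_meas y cphi (dom phi indL).
have h2 := avg_L1 a_meas y cchi (dom chi indL).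
have -> : S (fun x => b * phi x + chi x) y = b * S phi y + S chi y.
  rewrite /S /avg -RintegralZl// -RintegralD//; last exact: L1muZ.
  by apply: eq_Rintegral => t _; ring.
by ring.
Qed.

Lemma partial_primitive_neq j phi : j != i0 -> Coo phi ->
  partial j (primitive phi) = primitive (partial j phi).
Proof.
move=> ji cphi; apply/funext => y; rewrite /primitive partialM; last 2 first.
- exact: Coo_derivable (Coo_coord i0).
- by apply: Coo_derivable; exact: Coo_S.
rewrite partial_coord (negbTE ji) mul0r add0r; congr (_ * _).
rewrite /S (partial_avg a_meas c_meas c_le1 a_line j cphi (dom phi indL)).
by apply: eq_Rintegral => t _; rewrite /c (negbTE ji) mulr1.
Qed.

Lemma partial_primitive phi : Coo phi -> partial i0 (primitive phi) = phi.
Proof.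
move=> cphi; apply/funext => y; rewrite /primitive partialM; last 2 first.
- exact: Coo_derivable (Coo_coord i0).
- by apply: Coo_derivable; exact: Coo_S.
rewrite partial_coord eqxx mul1r /S (partial_avg a_meas c_meas c_le1 a_line i0 cphi (dom phi indL)).
have cpi := Coo_partial i0 cphi.
have h1 := avg_L1 a_meas y cphi (dom phi indL).
have h2 := avg_L1 a_meas y cpi (dominated_partial c_meas c_le1 i0 (dom phi indL)).
rewrite /avg -RintegralZl// -RintegralD//; last exact: L1muZ.
pose f (s : R) := phi (scale_coord s y) + s * (y 0 i0 * partial i0 phi (scale_coord s y)).
transitivity (\int[leb]_t (\1_`[0, 1]%classic t * f t)).
  apply: eq_Rintegral => t _; rewrite -/(ind t) -(clip_ind t f) /f /a /c eqxx; ring.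
have dF (s : R) : is_derive s 1 (fun s => s * phi (scale_coord s y)) (f s).
  apply: (is_derive_eq (is_deriveM (is_derive_id s (1 : R)) (scale_coord_is_derive y s cphi))).
  by rewrite -[LHS]/(s * _ + phi (scale_coord s y) * 1) mulr1 addrC.
rewrite (integral_derivative01 dF).
  by rewrite mul1r mul0r subr0 scale_coord1.
move=> s; apply: (@continuousD R R R (fun s => phi (scale_coord s y)) (fun s => s * (y 0 i0 * partial i0 phi (scale_coord s y)))); first by apply: scale_coord_continuous; exact: Coo_continuous.
apply: (@continuousM R R id (fun s => y 0 i0 * partial i0 phi (scale_coord s y))) => //.
apply: (@continuousM R R (fun=> y 0 i0) (fun s => partial i0 phi (scale_coord s y))).
  exact: cst_continuous.
by apply: scale_coord_continuous; exact: Coo_continuous.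
Qed.

Lemma primitive_partial phi y : Coo phi ->
  primitive (partial i0 phi) y = phi y - phi (scale_coord 0 y).
Proof.
move=> cphi; have cpi := Coo_partial i0 cphi.
have h1 := avg_L1 a_meas y cpi (dom (partial i0 phi) indL).
rewrite /primitive /S /avg -RintegralZl//.
pose f (s : R) := y 0 i0 * partial i0 phi (scale_coord s y).
transitivity (\int[leb]_t (\1_`[0, 1]%classic t * f t)).
  apply: eq_Rintegral => t _; rewrite -/(ind t) -(clip_ind t f) /f /a; ring.
have dF (s : R) := scale_coord_is_derive y s cphi.
rewrite (integral_derivative01 dF) ?scale_coord1//.
move=> s; apply: (@continuousM R R (fun=> y 0 i0) (fun s => partial i0 phi (scale_coord s y))).
  exact: cst_continuous.
by apply: scale_coord_continuous; exact: Coo_continuous.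
Qed.

End Primitive.

(** The functional [- g i0 (primitive i0 phi)] is a potential, because
    [primitive i0] of the derivative in i0 is phi minus its restriction phi0 to
    the hyperplane; and [g i0 phi0 = 0], since phi0 is the derivative in
    direction i1 of a function that does not depend on the coordinate i0. *)
Lemma poincare_compact (R : realType) (n : nat) (g : 'I_n -> ('rV[R]_n -> R) -> R) (i0 i1 : 'I_n) :
  i1 != i0 -> (forall i, Edist (g i)) ->
  (forall i j phi, Coo phi -> g j (partial i phi) = g i (partial j phi)) ->
  exists2 psi, Edist psi & forall i phi, Coo phi -> g i phi = - psi (partial i phi).
Proof.
move=> i10 Eg closed; exists (fun phi => - g i0 (primitive i0 phi)).
  apply: EdistN; have [lg [M [N [C [M0 C0 HC]]]]] := Eg i0; split.
    move=> b phi chi cphi cchi; rewrite -lg; try exact: Coo_primitive.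
    by apply: linear_ext => y; exact: primitive_linear.
  have [D D0 HD] := primitive_bound (n := n) i0 N M0.
  exists M, N, (C * D); split=> //; first exact: mulr_ge0.
  by move=> phi B cphi HB; rewrite -mulrA; apply: HC; [exact: Coo_primitive|exact: HD].
move=> i phi cphi; rewrite opprK; have [->|ii0] := eqVneq i i0; last first.
  rewrite -partial_primitive_neq// closed; last exact: Coo_primitive.
  by rewrite partial_primitive.
have lg i := Edist_linear (Eg i).
pose phi0 y := phi (scale_coord i0 0 y).
have phi0E : phi0 = fun y => phi y - primitive i0 (partial i0 phi) y.
  by apply/funext => y; rewrite primitive_partial// subKr.
have cprim : Coo (primitive i0 (partial i0 phi)) by apply: Coo_primitive; exact: Coo_partial.
have cphi0 : Coo phi0 by rewrite phi0E; exact: CooB.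
have dphi0 : partial i0 phi0 = fun=> 0.
  apply/funext => y; apply: partial_is_derive.
  have := is_deriveB (Coo_is_derive i0 y cphi) (Coo_is_derive i0 y cprim).
  rewrite phi0E partial_primitive; last exact: Coo_partial.
  by rewrite subrr; exact.
have g0 : g i0 phi0 = 0.
  have c1 := Coo_primitive i1 cphi0.
  rewrite -(partial_primitive i1 cphi0) closed//.
  rewrite partial_primitive_neq// 1?eq_sym// dphi0.
  rewrite -[RHS](linearC0 (lg i1)); apply: linear_ext => y.
  have z := primitive_linear i1 1 y (Coo_cst 0) (Coo_cst (0 : R)).
  have e : (fun _ : 'rV[R]_n => 1 * 0 + 0) = fun=> 0 :> R by apply/funext => x; rewrite mulr0 addr0.
  rewrite e mul1r in z.
  by move/eqP: z; rewrite -subr_eq0 opprD addNKr oppr_eq0 => /eqP.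
by apply/eqP; rewrite -subr_eq0 -(linearCB (lg i0))// -phi0E g0.
Qed.

(** * Matrix fields, and the normal operator *)

Section Assembly.
Context {R : realType} {n : nat}.
Local Notation E := 'rV[R]_n.
Implicit Types (phi chi : E -> R) (x y c : E) (g f : 'I_n -> (E -> R) -> R).

Lemma Coo_det m (B : E -> 'M[R]_m) : (forall i j, Coo (fun x => B x i j)) ->
  Coo (fun x => \det (B x)).
Proof.
move=> cB; rewrite /determinant; apply: Coo_sum => s.
by apply: CooM; [exact: Coo_cst|apply: Coo_prod => i; exact: cB].
Qed.

Lemma Coo_invmx m (B : E -> 'M[R]_m) : (forall i j, Coo (fun x => B x i j)) ->
  (forall x, B x \in unitmx) -> forall i j, Coo (fun x => invmx (B x) i j).
Proof.
move=> cB uB i j.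
have -> : (fun x => invmx (B x) i j) =
    fun x => (\det (B x))^-1 * ((-1) ^+ (j + i) * \det (row' j (col' i (B x)))).
  by apply/funext => x; rewrite /invmx uB !mxE.
apply: CooM; first by apply: CooV => [|x]; [exact: Coo_det|rewrite -unitfE; exact: uB].
apply: CooM; first exact: Coo_cst.
by apply: Coo_det => a b; under eq_fun do rewrite !mxE; exact: cB.
Qed.

Lemma linearC_delta (u : 'I_n -> (E -> R) -> R) i phi : (forall l, Coo_linear (u l)) ->
  \sum_(l < n) u l (fun x => (i == l)%:R * phi x) = u i phi.
Proof.
move=> lu; rewrite (bigD1 i)//= big1 ?addr0.
  by rewrite eqxx; apply: linear_ext => x; rewrite mul1r.
move=> l li; rewrite -[RHS](linearC0 (lu l)).
by apply: linear_ext => x; rewrite eq_sym (negbTE li) mul0r.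
Qed.

Lemma Edist_mx_act (B : E -> 'M[R]_n) f : (forall i j, Coo (fun x => B x i j)) ->
  (forall i, Edist (f i)) -> forall i, Edist (mx_act B f i).
Proof. by move=> cB Ef i; apply: Edist_sum => j; exact: Edist_mul. Qed.

Lemma mx_actK (A : E -> 'M[R]_n) f i phi : (forall i j, Coo (fun x => A x i j)) ->
  (forall x, A x \in unitmx) -> (forall i, Edist (f i)) -> Coo phi ->
  mx_act (fun x => invmx (A x)) (mx_act A f) i phi = f i phi.
Proof.
move=> cA uA Ef cphi; have lf l := Edist_linear (Ef l).
rewrite /mx_act exchange_big /= -[RHS](linearC_delta i phi lf).
apply: eq_bigr => l _; rewrite -linearC_sum//; last first.
  by move=> j; do !apply: CooM => //; exact: Coo_invmx.
apply: linear_ext => x.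
have -> : (i == l)%:R = (1%:M : 'M[R]_n) i l by rewrite mxE.
rewrite -(mulVmx (uA x)) mxE mulr_suml; apply: eq_bigr => j _.
by rewrite mulrA [A x j l * _]mulrC.
Qed.

(** Test functions on a ball centred at c are translates of functions supported
    at the origin, for which a bound on the norm describes the support. *)
Lemma vanishes_on_ball V c (rho : R) (u : (E -> R) -> R) chi : vanishes_on V u ->
  (forall x, `|x - c| <= rho -> V x) -> Coo chi -> supported rho chi ->
  u (fun x => chi (x - c)) = 0.
Proof.
move=> Vu cV cchi schi.
have cB : compact [set x | `|x - c| <= rho].
  have -> : [set x | `|x - c| <= rho] = (fun x => x + c) @` [set x | `|x| <= rho].
    apply/seteqP; split=> [x /= xr|_ [x /= xr <-]]; last by rewrite addrK.
    by exists (x - c); rewrite ?subrK.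
  apply: continuous_compact; last exact: compact_ball.
  apply: continuous_subspaceT => x; apply: continuousD => //; exact: cst_continuous.
have sB : Defs.support (fun x => chi (x - c)) `<=` [set x | `|x - c| <= rho].
  have /closure_id -> : closed [set x | `|x - c| <= rho].
    by apply: compact_closed => //; exact: norm_hausdorff.
  apply: closure_subset => x /= nz; rewrite leNgt; apply/negP => /schi e.
  by rewrite e eqxx in nz.
apply: Vu; last by move=> x /sB; exact: cV.
split; first by apply/smoothP; exact: Coo_shift.
by apply: subclosed_compact sB => //; exact: closed_closure.
Qed.

Lemma conv0 k y : conv k (fun=> 0) y = 0 :> R.
Proof.
rewrite /conv (eq_integral_rV (g := fun=> 0)); last by move=> x; rewrite mulr0.
by rewrite /integral_rV /Rintegral integral0.
Qed.

Lemma conv_sum k (I : Type) (s : seq I) (F : I -> E -> R) r y : L1loc k ->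
  (forall a, Coo (F a)) -> (forall a, supported r (F a)) ->
  conv k (fun x => \sum_(a <- s) F a x) y = \sum_(a <- s) conv k (F a) y.
Proof.
move=> kL cF sF; elim: s => [|a s IH].
  rewrite big_nil -[RHS](conv0 k y); apply: eq_integral_rV => x.
  by rewrite big_nil.
have adm phi : supported r phi -> admissible k phi by move=> sp; left; split=> //; exists r.
rewrite big_cons -IH -convD.
- by apply: eq_integral_rV => x; rewrite big_cons.
- by apply: conv_L1 => //; exact: adm.
- apply: (@conv_L1 _ _ k (fun x => \sum_(b <- s) F b x)); first exact: Coo_sum.
  by apply: adm => x xr; rewrite big1// => b _; exact: sF.
Qed.

End Assembly.

Section NormalOperator.
Context {R : realType} {n : nat}.
Hypothesis hn : (2 <= n)%N.
Local Notation E := 'rV[R]_n.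
Implicit Types (phi chi : E -> R) (x y c : E) (i j l : 'I_n).
Variable g : 'I_n -> (E -> R) -> R.
Hypothesis Eg : forall i, Edist (g i).

Let lg i := Edist_linear (Eg i).

Let adm j l phi r : supported r phi -> admissible (xray_kernel j l) phi.
Proof. by move=> sp; left; split; [exact: L1loc_xray_kernel|exists r]. Qed.

Lemma N1E j phi : N1 g j phi = \sum_(l < n) g l (conv (xray_kernel j l) phi).
Proof. by []. Qed.

Lemma N1_sum (I : Type) (s : seq I) (F : I -> E -> R) r j :
  (forall a, Coo (F a)) -> (forall a, supported r (F a)) ->
  N1 g j (fun x => \sum_(a <- s) F a x) = \sum_(a <- s) N1 g j (F a).
Proof.
move=> cF sF; rewrite N1E.
under [RHS]eq_bigr do rewrite N1E.
rewrite exchange_big; apply: eq_bigr => l _.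
rewrite -linearC_sum//; last by move=> a; apply: Coo_conv => //; exact: adm (sF a).
by apply: linear_ext => y; apply: conv_sum sF => //; exact: L1loc_xray_kernel.
Qed.

(** The identity between the kernels, contracted with the components of g. The
    derivatives fall on phi, and are then pulled out of the convolution with the
    scalar kernel. *)
Lemma dext_conv_scalar_kernel i j phi r : Coo phi -> supported r phi ->
  N1 g j (partial i phi) = 0 -> N1 g i (partial j phi) = 0 ->
  dext g i j (conv scalar_kernel phi) = 0.
Proof.
move=> cphi sphi Nj Ni.
have ads phi' : supported r phi' -> admissible scalar_kernel phi'.
  by move=> sp; left; split; [exact: L1loc_scalar_kernel|exists r].
have sd a : supported r (partial a phi) by exact: partial_far0.
have cd a : Coo (partial a phi) by exact: Coo_partial.
have cx a b l : Coo (conv (xray_kernel a l) (partial b phi)).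
  by apply: Coo_conv => //; exact: adm (sd b).
have cs b : Coo (conv scalar_kernel (partial b phi)).
  by apply: Coo_conv => //; exact: ads.
have id l y : n.-1%:R * (conv (xray_kernel j l) (partial i phi) y -
      conv (xray_kernel i l) (partial j phi) y) =
    - 2 * ((i == l)%:R * conv scalar_kernel (partial j phi) y -
           (j == l)%:R * conv scalar_kernel (partial i phi) y).
  have sy : supported (r + `|y|) (fun x => phi (x + y)).
    move=> x xr; apply: sphi; rewrite (lt_le_trans _ (lerB_normD _ _))//.
    by rewrite ltrBrDr.
  have := kernel_identity hn i j l (Coo_shift y cphi) sy.
  by rewrite !partial_shift.
rewrite /dext /dpartial !partial_conv//; try exact: ads sphi.
have key : \sum_(l < n) g l (fun y => (i == l)%:R * conv scalar_kernel (partial j phi) y) -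
    \sum_(l < n) g l (fun y => (j == l)%:R * conv scalar_kernel (partial i phi) y) = 0.
  have two0 : - 2 != 0 :> R by rewrite oppr_eq0.
  apply: (mulfI two0); rewrite mulr0 -sumrB mulr_sumr.
  transitivity (n.-1%:R * (N1 g j (partial i phi) - N1 g i (partial j phi))); last first.
    by rewrite Nj Ni subr0 mulr0.
  rewrite !N1E -sumrB mulr_sumr; apply: eq_bigr => l _.
  rewrite -!linearCB//; try exact: CooZ.
  rewrite -!linearCZ//; last 2 first.
  - by apply: CooB; exact: CooZ.
  - exact: CooB.
  by apply: linear_ext => y; rewrite id.
have ei := linearC_delta i (conv scalar_kernel (partial j phi)) lg.
have ej := linearC_delta j (conv scalar_kernel (partial i phi)) lg.
rewrite opprK addrC -ei -ej; exact: key.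
Qed.

End NormalOperator.

(** Unique continuation for the components of dg, translated by c. *)
Lemma dext_eq0_of_local (R : realType) (n : nat) (hn : (2 <= n)%N)
    (g : 'I_n -> ('rV[R]_n -> R) -> R) (c : 'rV[R]_n) (rho : R) :
  (forall i, Edist (g i)) -> 0 < rho ->
  (forall i j phi, Coo phi -> supported rho phi -> dext g i j (fun x => phi (x - c)) = 0) ->
  (forall j phi, Coo phi -> supported rho phi -> N1 g j (fun x => phi (x - c)) = 0) ->
  forall i j phi, Coo phi -> dext g i j phi = 0.
Proof.
move=> Eg rho0 dg Ng i j phi cphi.
have Ed : Edist (dext g i j).
  by apply: EdistD; [|apply: EdistN]; apply: EdistN; exact: Edist_partial.
have H := riesz_unique_continuation hn (Edist_shift (- c) Ed) rho0 (dg i j).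
have := H _ (fun x => phi (x + c)) (Coo_shift c cphi).
rewrite (_ : (fun x => _) = phi); last by apply/funext => x; rewrite subrK.
apply=> chi cchi schi.
have -> : (fun x => conv scalar_kernel chi (x - c)) = conv scalar_kernel (fun x => chi (x - c)).
  by apply/funext => x; rewrite conv_shift.
have Np a b : N1 g a (partial b (fun x => chi (x - c))) = 0.
  rewrite partial_shift//; apply: Ng; first exact: Coo_partial.
  exact: partial_far0.
apply: (dext_conv_scalar_kernel hn Eg (r := rho + `|c|)) => //; first exact: Coo_shift.
move=> x xr; apply: schi; rewrite -(normrN c) in xr.
by rewrite (lt_le_trans _ (lerB_normD _ _))// ltrBrDr.
Qed.

(** The normal operator of A, tested against the j-th column of the inverse of A
    times phi, sums to the j-th component of N_1 (A f) tested against phi. *)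
Lemma N1_of_NA (R : realType) (n : nat) (hn : (2 <= n)%N) (A : 'rV[R]_n -> 'M[R]_n)
    (f : 'I_n -> ('rV[R]_n -> R) -> R) (c : 'rV[R]_n) (rho : R) :
  (forall i j, Coo (fun x => A x i j)) -> (forall x, A x \in unitmx) ->
  (forall i, Edist (f i)) ->
  (forall i phi, Coo phi -> supported rho phi -> NA A f i (fun x => phi (x - c)) = 0) ->
  forall j phi, Coo phi -> supported rho phi -> N1 (mx_act A f) j (fun x => phi (x - c)) = 0.
Proof.
move=> cA uA Ef HN j0 phi cphi sphi.
have Eg := Edist_mx_act cA Ef; have cB := Coo_invmx cA uA.
set g := mx_act A f in Eg *.
have cphic : Coo (fun x => phi (x - c)) by exact: Coo_shift.
have sphic : supported (rho + `|c|) (fun x => phi (x - c)).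
  move=> x xr; apply: sphi; rewrite -(normrN c) in xr.
  by rewrite (lt_le_trans _ (lerB_normD _ _))// ltrBrDr.
have z i : NA A f i (fun x => invmx (A x) i j0 * phi (x - c)) = 0.
  have cx : Coo (fun x => invmx (A (x + c)) i j0 * phi x).
    by apply: CooM => //; exact: Coo_shift (cB i j0).
  rewrite -[RHS](HN i _ cx); last by move=> x xr; rewrite sphi// mulr0.
  by congr (NA A f i _); apply/funext => x; rewrite subrK.
have N0 j : N1 g j (fun=> 0) = 0.
  have := N1_sum hn Eg [::] (F := fun (_ : unit) (_ : 'rV[R]_n) => 0) (r := 0) j.
  by rewrite !big_nil; apply=> // _; exact: Coo_cst.
have : \sum_(i < n) NA A f i (fun x => invmx (A x) i j0 * phi (x - c)) = 0.
  by apply: big1 => i _.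
rewrite /NA {1}/mx_act exchange_big /= -/g.
have e j : \sum_(i < n) N1 g j (fun x => (A x)^T i j * (invmx (A x) i j0 * phi (x - c))) =
    N1 g j (fun x => (j == j0)%:R * phi (x - c)).
  rewrite -(N1_sum hn Eg _ (r := rho + `|c|)).
  - congr (N1 g j); apply/funext => x.
    have -> : (j == j0)%:R = (1%:M : 'M[R]_n) j j0 by rewrite mxE.
    rewrite -(mulmxV (uA x)) mxE mulr_suml; apply: eq_bigr => i _.
    by rewrite mxE mulrA.
  - move=> i; apply: CooM; last exact: CooM.
    by rewrite (_ : (fun x => _) = fun x => A x j i)//; apply/funext => x; rewrite mxE.
  - by move=> i x xr; rewrite sphic// !mulr0.
rewrite (eq_bigr _ (fun j _ => e j)) (bigD1 j0)//= big1 ?addr0.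
  move=> <-; congr (N1 g j0); apply/funext => x; by rewrite eqxx mul1r.
move=> j jj; rewrite -[RHS](N0 j); congr (N1 g j); apply/funext => x.
by rewrite (negbTE jj) mul0r.
Qed.

Theorem corollary1p6 (R : realType) (n : nat) (hn : (2 <= n)%N)
    (A : 'rV[R]_n -> 'M[R]_n) (hA : smooth_mx A)
    (hAinv : forall x : 'rV[R]_n, A x \in unitmx)
    (f : 'I_n -> ('rV[R]_n -> R) -> R)
    (hf : forall i : 'I_n, compact_distribution (f i))
    (V : set 'rV[R]_n) (hV : open V) (hV0 : V !=set0)
    (hd : forall i j : 'I_n, vanishes_on V (dext (mx_act A f) i j))
    (hN : forall i : 'I_n, vanishes_on V (NA A f i)) :
  exists psi : ('rV[R]_n -> R) -> R, compact_distribution psi /\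
    forall i : 'I_n, eq_compact_distribution (f i)
      (mx_act (fun x => invmx (A x)) (dgrad psi) i).
Proof.
have cA i j : Coo (fun x => A x i j) by apply/smoothP; exact: hA.
have Ef i : Edist (f i) by exact/compact_distributionP.
have [c Vc] := hV0.
have [rho rho0 ballV] : exists2 rho : R, 0 < rho & forall x, `|x - c| <= rho -> V x.
  have /nbhs_ballP[e /= e0 He] := open_nbhs_nbhs (conj hV Vc).
  exists (e / 2); first exact: divr_gt0.
  move=> x xr; apply: He; rewrite -ball_normE /= distrC (le_lt_trans xr)//.
  by rewrite ltr_pdivrMr// ltr_pMr// ltr1n.
have Eg := Edist_mx_act cA Ef.
have NAc i phi : Coo phi -> supported rho phi -> NA A f i (fun x => phi (x - c)) = 0.
  by move=> cphi sphi; exact: vanishes_on_ball (hN i) ballV cphi sphi.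
have dc i j phi : Coo phi -> supported rho phi ->
    dext (mx_act A f) i j (fun x => phi (x - c)) = 0.
  by move=> cphi sphi; exact: vanishes_on_ball (hd i j) ballV cphi sphi.
have closed := dext_eq0_of_local hn Eg rho0 dc (N1_of_NA hn cA hAinv Ef NAc).
have n0 : (0 < n)%N by exact: ltnW.
have i10 : Ordinal hn != Ordinal n0 by [].
have [|psi Epsi gpsi] := poincare_compact i10 Eg.
  move=> i j phi cphi; have := closed i j phi cphi.
  by rewrite /dext /dpartial opprK addrC => /eqP; rewrite subr_eq0 => /eqP ->.
exists psi; split; first exact/compact_distributionP.
move=> i phi /smoothP cphi; rewrite -(mx_actK i cA hAinv Ef cphi).
apply: eq_bigr => j _; rewrite /dgrad /dpartial gpsi//.
by apply: CooM => //; exact: Coo_invmx.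
Qed.
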